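(* Let $\varphi:Q\to R$ be a Gorenstein homomorphism of local rings with $\ker\varphi\subseteq\mathfrak{m}_Q^2$. Suppose that there exist a Gorenstein local ring $P$ and a local ring homomorphism $\psi:P\to Q$ of finite flat dimension. Furthermore, let $I\subseteq P$ be an ideal such that $S=P/I$ is a lifting of $R$ to $P$ via $Q$, and suppose that (1) $0\neq I\subseteq\mathfrak{m}_P^2$ and (2) $\operatorname{grade}_P(S,P)\geq\operatorname{grade}_P(S,Q)$. Then there exist non-trivial totally acyclic complexes over $R$.
   Context: All local rings are commutative and Noetherian; $\mathfrak{m}_A$ denotes the maximal ideal of a local ring $A$. Finite flat dimension: a ring homomorphism $\psi:P\to Q$ has finite flat dimension if $Q$ has finite flat dimension as a $P$-module via $\psi$. Grade: for a finitely generated $A$-module $N$ and an $A$-module $M$, $\operatorname{grade}_A(N,M)=\min\{i : \operatorname{Ext}_A^i(N,M)\neq 0\}$, and $\operatorname{grade}_A N=\operatorname{grade}_A(N,A)$. A finitely generated $A$-module $M$ is perfect if $\operatorname{pd}_A M=\operatorname{grade}_A M$. Gorenstein homomorphism: an ideal $J\subseteq A$ such that $A/J$ is a perfect $A$-module is a Gorenstein ideal if $\operatorname{Ext}_A^{g}(A/J,A)\cong A/J$, where $g=\operatorname{pd}_A(A/J)$. A surjective ring homomorphism $\varphi:Q\to R$ is Gorenstein if $R$ is a perfect $Q$-module and $\ker\varphi$ is a Gorenstein ideal of $Q$. Lifting: let $P\to Q$ be a ring homomorphism and $M$ a finitely generated $Q$-module. A finitely generated $P$-module $N$ is a lifting of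 $M$ to $P$ via $Q$ if $M\cong Q\otimes_P N$ (as $Q$-modules) and $\operatorname{Tor}_i^P(Q,N)=0$ for all $i>0$. Totally acyclic complexes: an acyclic (exact) complex $\mathbf{C}=(C_i,\partial_i)_{i\in\mathbb{Z}}$ of finitely generated free $R$-modules is totally acyclic if $\operatorname{Hom}_R(\mathbf{C},R)$ is also acyclic. It is minimal if $\partial_i(C_i)\subseteq\mathfrak{m}_R C_{i-1}$ for all $i\in\mathbb{Z}$. A totally acyclic complex that is minimal and nonzero is called non-trivial. *)

(* Defs.v *)
From HB Require Import structures.
From mathcomp Require Import all_boot all_algebra.
From mathcomp Require Import generic_quotient ring_quotient.
From mathcomp Require Import boolp functions freeg.

Set Implicit Arguments.
Unset Strict Implicit.
Unset Printing Implicit Defensive.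

Import GRing.Theory.
Local Open Scope ring_scope.
Local Open Scope quotient_scope.

(** A submodule of [M : lmodType A] is a [U : submodClosed M], and an ideal of
    [A] is a submodule of the regular module [A^o]. *)

Section Modules.
Variable A : comNzRingType.
Implicit Types M N X Y Z F : lmodType A.

Definition trivial_mod M := forall x : M, x = 0.

Definition iso_mod M N := exists f : {linear M -> N}, bijective f.

Definition surjective (S T : Type) (f : S -> T) := forall y, exists x, f x = y.

Definition exact_at X Y Z (f : X -> Y) (g : Y -> Z) :=
  forall y, g y = 0 <-> exists x, f x = y.

Definition fin_gen M :=
  exists n (g : 'I_n -> M), forall x, exists c : 'I_n -> A,
    x = \sum_i c i *: g i.

Definition fin_gen_free M := exists n, iso_mod M 'rV[A]_n.

Section Submodule.
Variables (M : lmodType A) (U : submodClosed M).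

Definition submod : Type := {x : M | x \in U}.

HB.instance Definition _ := SubChoice.on submod.
HB.instance Definition _ := [SubChoice_isSubLmodule of submod by <:].

Definition submod_val : submod -> M := val.

Definition in_submod x (xU : x \in U) : submod := exist _ x xU.

Lemma submod_val_is_linear : linear submod_val.
Proof. by []. Qed.

HB.instance Definition _ :=
  GRing.isLinear.Build A submod M *:%R submod_val submod_val_is_linear.

End Submodule.

Section QuotientModule.
Variables (M : lmodType A) (U : submodClosed M).

(* [submodClosed] does not inherit from [zmodClosed], which [Quotient.quot]
   requires. *)
Definition submod_pred : {pred M} := fun x => x \in U.

Lemma submod_pred_zmod : zmod_closed submod_pred.
Proof. by case: (submodClosedP U) => U0 UL; exact: (GRing.submod_closedB (conj U0 UL)). Qed.

HB.instance Definition _ :=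
  GRing.isZmodClosed.Build M submod_pred submod_pred_zmod.

Definition quotmod : Type := Quotient.quot submod_pred.

HB.instance Definition _ := GRing.Zmodule.on quotmod.

Definition quotmod_pi : M -> quotmod := \pi_(Quotient.quot submod_pred).

Lemma quotmod_piE x y : quotmod_pi x = quotmod_pi y <-> x - y \in U.
Proof.
have E := Quotient.idealrBE submod_pred x y.
split=> [/eqP h|h]; first by rewrite -[_ \in U]/(x - y \in submod_pred) E; exact: h.
by apply/eqP; rewrite -[_ \in U]/(x - y \in submod_pred) E in h; exact: h.
Qed.

Lemma quotmod_reprK (q : quotmod) : quotmod_pi (repr q) = q.
Proof. exact: reprK. Qed.

Lemma quotmod_piB : zmod_morphism quotmod_pi.
Proof. exact: raddfB. Qed.

HB.instance Definition _ :=
  GRing.isZmodMorphism.Build M quotmod quotmod_pi quotmod_piB.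

Definition quotmod_scale (a : A) (q : quotmod) := quotmod_pi (a *: repr q).

Lemma quotmod_scale_pi a x : quotmod_scale a (quotmod_pi x) = quotmod_pi (a *: x).
Proof.
by apply/quotmod_piE; rewrite -scalerBr rpredZ //; apply/quotmod_piE/quotmod_reprK.
Qed.

Lemma quotmod_scaleA a b q :
  quotmod_scale a (quotmod_scale b q) = quotmod_scale (a * b) q.
Proof. by rewrite -[q]quotmod_reprK !quotmod_scale_pi scalerA. Qed.

Lemma quotmod_scale1 : left_id 1 quotmod_scale.
Proof. by move=> q; rewrite -[q]quotmod_reprK quotmod_scale_pi scale1r. Qed.

Lemma quotmod_scaleDr : right_distributive quotmod_scale +%R.
Proof.
move=> a p q; rewrite -[p]quotmod_reprK -[q]quotmod_reprK -raddfD.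
by rewrite !quotmod_scale_pi -raddfD scalerDr.
Qed.

Lemma quotmod_scaleDl q : {morph quotmod_scale^~ q : a b / a + b}.
Proof.
by move=> a b; rewrite -[q]quotmod_reprK !quotmod_scale_pi -raddfD scalerDl.
Qed.

HB.instance Definition _ := GRing.Zmodule_isLmodule.Build A quotmod
  quotmod_scaleA quotmod_scale1 quotmod_scaleDr quotmod_scaleDl.

Lemma quotmod_pi_scalable : scalable quotmod_pi.
Proof. by move=> a x; rewrite -quotmod_scale_pi. Qed.

HB.instance Definition _ :=
  GRing.isScalable.Build A M quotmod *:%R quotmod_pi quotmod_pi_scalable.

Definition quotmod_lift N (f : {linear M -> N})
  (fU : forall x, x \in U -> f x = 0) (q : quotmod) : N := f (repr q).

Section LiftTheory.
Variables (N : lmodType A) (f : {linear M -> N}).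
Hypothesis fU : forall x, x \in U -> f x = 0.

Lemma quotmod_liftE x : quotmod_lift fU (quotmod_pi x) = f x.
Proof.
apply/eqP; rewrite -subr_eq0 -linearB; apply/eqP/fU.
by apply/quotmod_piE/quotmod_reprK.
Qed.

Lemma quotmod_lift_is_linear : linear (quotmod_lift fU).
Proof.
move=> a p q; rewrite -[p]quotmod_reprK -[q]quotmod_reprK -linearP.
by rewrite !quotmod_liftE linearP.
Qed.

HB.instance Definition _ := GRing.isLinear.Build A quotmod N *:%R
  (quotmod_lift fU) quotmod_lift_is_linear.

End LiftTheory.
End QuotientModule.

Section Generated.
Variables (M : lmodType A) (S : M -> Prop).

Definition gensub : {pred M} :=
  fun x => `[< forall U : submodClosed M, (forall y, S y -> y \in U) -> x \in U >].

Lemma gensub_closed : submod_closed gensub.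
Proof.
split=> [|a x y /asboolP xS /asboolP yS]; apply/asboolP=> U SU; first exact: rpred0.
by rewrite rpredD ?rpredZ ?xS ?yS.
Qed.

HB.instance Definition _ := GRing.isSubmodClosed.Build A M gensub gensub_closed.

Lemma gensub_mem x : S x -> x \in gensub.
Proof. by move=> Sx; apply/asboolP=> U; apply. Qed.

Lemma gensub_min (U : submodClosed M) :
  (forall x, S x -> x \in U) -> {subset gensub <= U}.
Proof. by move=> SU x /asboolP; apply. Qed.

End Generated.

Definition ideal_mul (I : {pred A^o}) M (U : {pred M}) : {pred M} :=
  gensub (fun x => exists (a : A) u, [/\ a \in I, u \in U & x = a *: u]).

Section Kernel.
Variables (M N : lmodType A) (f : {linear M -> N}).

Definition lker : {pred M} := fun x => f x == 0.

Lemma lker_closed : submod_closed lker.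
Proof.
split=> [|a x y /eqP fx /eqP fy]; rewrite unfold_in /= ?linear0 //.
by rewrite linearP fx fy scaler0 addr0.
Qed.

HB.instance Definition _ := GRing.isSubmodClosed.Build A M lker lker_closed.

End Kernel.

Section Homology.
Variables (X Y Z : lmodType A) (f : {linear X -> Y}) (g : {linear Y -> Z}).

Definition boundaries : {pred submod (lker g)} :=
  fun z => `[< exists x, f x = submod_val z >].

Lemma boundaries_closed : submod_closed boundaries.
Proof.
split=> [|a u v /asboolP[x xu] /asboolP[y yv]]; apply/asboolP.
  by exists 0; rewrite !linear0.
by exists (a *: x + y); rewrite !linearP xu yv.
Qed.

HB.instance Definition _ :=
  GRing.isSubmodClosed.Build A (submod (lker g)) boundaries boundaries_closed.

(* [ker g / im f] when [g \o f = 0]. *)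
Definition homology : lmodType A := quotmod boundaries.

End Homology.

Section Hom.
Variables M N : lmodType A.

Definition linear_pred : {pred M -> N} := fun f => `[< linear f >].

Lemma linear_pred_closed : submod_closed linear_pred.
Proof.
split=> [|a f g /asboolP fL /asboolP gL]; apply/asboolP=> b x y.
  by rewrite scaler0 addr0.
rewrite !fctE fL gL !scalerDr !scalerA (mulrC a b) -!addrA.
by congr (_ + _); rewrite addrCA.
Qed.

HB.instance Definition _ :=
  GRing.isSubmodClosed.Build A (M -> N) linear_pred linear_pred_closed.

Definition Hom : lmodType A := submod linear_pred.

Definition hom_fun (f : Hom) : M -> N := submod_val f.

Lemma hom_fun_linear (f : Hom) : linear (hom_fun f).
Proof. by apply/asboolP; exact: (valP f). Qed.

End Hom.

Section Precomp.
Variables (X Y N : lmodType A) (f : {linear X -> Y}).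

Lemma precomp_subproof (h : Hom Y N) : hom_fun h \o f \in @linear_pred X N.
Proof. by apply/asboolP=> a x y /=; rewrite linearP hom_fun_linear. Qed.

Definition precomp (h : Hom Y N) : Hom X N := in_submod (precomp_subproof h).

Lemma precomp_is_linear : linear precomp.
Proof. by move=> a g h; apply/val_inj. Qed.

HB.instance Definition _ :=
  GRing.isLinear.Build A (Hom Y N) (Hom X N) *:%R precomp precomp_is_linear.

End Precomp.
Arguments precomp {X Y} N f h.

Record left_resolution M := LeftResolution {
  lres :> nat -> lmodType A;
  lres_diff : forall n, {linear lres n.+1 -> lres n};
  lres_aug : {linear lres 0 -> M};
  lres_surj : surjective lres_aug;
  lres_exact0 : exact_at (lres_diff 0) lres_aug;
  lres_exactS : forall n, exact_at (lres_diff n.+1) (lres_diff n)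
}.

Record right_resolution M := RightResolution {
  rres :> nat -> lmodType A;
  rres_diff : forall n, {linear rres n -> rres n.+1};
  rres_aug : {linear M -> rres 0};
  rres_inj : injective rres_aug;
  rres_exact0 : exact_at rres_aug (rres_diff 0);
  rres_exactS : forall n, exact_at (rres_diff n) (rres_diff n.+1)
}.

Definition vanishes_above (F : nat -> lmodType A) (n : nat) :=
  forall i, (n < i)%N -> trivial_mod (F i).

(** The standard free resolution: [F_0] is free on the set [M], and
    [F_(n+1)] is free on the underlying set of the kernel of [F_n -> F_(n-1)]
    (of [F_0 -> M] if [n = 0]). *)

Section FreeModule.
Variables (K : choiceType) (M : lmodType A) (f : K -> M).

Definition free_lift : {freeg K / A} -> M := fglift f.

Lemma free_lift_is_linear : linear free_lift.
Proof.
have fB : zmod_morphism free_lift := lift_is_additive f.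
pose g := GRing.isZmodMorphism.Build _ _ free_lift fB.
pose h : {additive {freeg K / A} -> M} := HB.pack free_lift g.
have fZ a D : h (a *: D) = a *: h D.
  rewrite -[a *: D]/(fgscale a D) /fgscale -[in RHS](freeg_sumE D) !raddf_sum.
  apply: eq_bigr => x _.
  by rewrite /= /free_lift !liftU scalerA.
by move=> a x y; rewrite -[free_lift]/(h : _ -> _) raddfD fZ.
Qed.

HB.instance Definition _ := GRing.isLinear.Build A {freeg K / A} M *:%R
  free_lift free_lift_is_linear.

Lemma free_liftU x : free_lift << x >> = f x.
Proof. by rewrite /free_lift liftU scale1r. Qed.

End FreeModule.

Definition free_mod (M : lmodType A) : lmodType A := {freeg M / A}.

Definition free_cover M : {linear free_mod M -> M} := free_lift id.

Definition free_syzygy M : lmodType A := submod (lker (free_cover M)).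

Definition free_diff M : {linear free_mod (free_syzygy M) -> free_mod M} :=
  @submod_val _ (lker (free_cover M)) \o free_cover (free_syzygy M).

Lemma free_cover_surj M : surjective (free_cover M).
Proof. by move=> x; exists << x >>; exact: (free_liftU id x). Qed.

Lemma free_exact0 M : exact_at (free_diff M) (free_cover M).
Proof.
move=> y; split=> [yK|[x <-]]; last exact/eqP/(valP (free_cover (free_syzygy M) x)).
have yK' : y \in lker (free_cover M) by apply/eqP.
have [x xE] := @free_cover_surj (free_syzygy M) (in_submod yK').
by exists x; rewrite /free_diff /= xE.
Qed.

Lemma free_exactS M : exact_at (free_diff (free_syzygy M)) (free_diff M).
Proof.
move=> y; rewrite -free_exact0; split=> [yK|yK]; first exact/val_inj.
by rewrite /free_diff /= yK linear0.
Qed.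

Definition std_free M n : lmodType A := free_mod (iter n free_syzygy M).

Definition std_diff M n : {linear std_free M n.+1 -> std_free M n} :=
  free_diff (iter n free_syzygy M).

Definition std_resolution M : left_resolution M :=
  @LeftResolution M (std_free M) (std_diff M) (free_cover M)
    (@free_cover_surj M) (@free_exact0 M)
    (fun n => @free_exactS (iter n free_syzygy M)).

Definition Ext (i : nat) N M : lmodType A :=
  let F := std_resolution N in
  if i is j.+1 then
    homology (precomp M (lres_diff F j)) (precomp M (lres_diff F j.+1))
  else homology (\0 : {linear Hom (F 0) M -> Hom (F 0) M}) (precomp M (lres_diff F 0)).

Definition projective M :=
  forall X Y (p : {linear X -> Y}) (f : {linear M -> Y}), surjective p ->
    exists g : {linear M -> X}, forall m, p (g m) = f m.

Definition injective_mod M :=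
  forall X Y (i : {linear X -> Y}) (f : {linear X -> M}), injective i ->
    exists g : {linear Y -> M}, forall x, g (i x) = f x.

Definition proj_dim_le M (n : nat) := exists F : left_resolution M,
  (forall i, projective (F i)) /\ vanishes_above F n.

Definition finite_inj_dim M := exists n (E : right_resolution M),
  (forall i, injective_mod (E i)) /\ vanishes_above E n.

End Modules.
Arguments precomp {A X Y} N f h.

(* The least [n] such that [P n], as an element of the naturals extended by
   [None], which stands for infinity. *)
Definition least (P : nat -> Prop) : option nat :=
  if pselect (exists n, `[< P n >]) is left exP then Some (ex_minn exP) else None.

Definition enat_le (m n : option nat) : bool :=
  if n is Some n' then (if m is Some m' then (m' <= n')%N else false) else true.

Definition proj_dim (A : comNzRingType) (M : lmodType A) : option nat :=
  least (proj_dim_le M).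

Definition grade (A : comNzRingType) (N M : lmodType A) : option nat :=
  least (fun i => ~ trivial_mod (Ext i N M)).

Definition perfect (A : comNzRingType) (M : lmodType A) :=
  fin_gen M /\ proj_dim M = grade M A^o.

Section Restriction.
Variables A B : comNzRingType.

Definition restr_scalars (f : {rmorphism A -> B}) (M : lmodType B) : Type := M.

Variables (f : {rmorphism A -> B}) (M : lmodType B).

HB.instance Definition _ := GRing.Zmodule.on (restr_scalars f M).

Definition restr_scale (a : A) (x : restr_scalars f M) : restr_scalars f M :=
  f a *: (x : M).

Lemma restr_scaleA a b x : restr_scale a (restr_scale b x) = restr_scale (a * b) x.
Proof. by rewrite /restr_scale scalerA rmorphM. Qed.

Lemma restr_scale1 : left_id 1 restr_scale.
Proof. by move=> x; rewrite /restr_scale rmorph1 scale1r. Qed.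

Lemma restr_scaleDr : right_distributive restr_scale +%R.
Proof. by move=> a x y; rewrite /restr_scale scalerDr. Qed.

Lemma restr_scaleDl x : {morph restr_scale^~ x : a b / a + b}.
Proof. by move=> a b; rewrite /restr_scale rmorphD scalerDl. Qed.

HB.instance Definition _ := GRing.Zmodule_isLmodule.Build A (restr_scalars f M)
  restr_scaleA restr_scale1 restr_scaleDr restr_scaleDl.

End Restriction.

(** For [f : A -> B], a [B]-module [M] and an [A]-module [N], this is the
    tensor product [M (x)_A N], with the [B]-module structure coming from [M]:
    the free [B]-module on [M * N] modulo the relations making [(m, n)]
    [B]-linear in [m], additive in [n] and [A]-balanced.  The case [f = id]
    is the usual tensor product of two [A]-modules. *)

Section Tensor.
Variables (A B : comNzRingType) (f : {rmorphism A -> B}).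

Section Def.
Variables (M : lmodType B) (N : lmodType A).

Local Notation gen m n := (<< (m, n) >> : {freeg (M * N)%type / B}).

Inductive tensor_rel : {freeg (M * N)%type / B} -> Prop :=
| TensorDl m m' n : tensor_rel (gen (m + m') n - gen m n - gen m' n)
| TensorDr m n n' : tensor_rel (gen m (n + n') - gen m n - gen m n')
| TensorZl b m n : tensor_rel (gen (b *: m) n - b *: gen m n)
| TensorZr a m n : tensor_rel (gen m (a *: n) - gen (f a *: m) n).

Definition tensor : lmodType B := quotmod (gensub tensor_rel).

Definition pure_tensor (m : M) (n : N) : tensor :=
  quotmod_pi (gensub tensor_rel) (gen m n).

Lemma pure_tensorDl m m' n :
  pure_tensor (m + m') n = pure_tensor m n + pure_tensor m' n.
Proof.
rewrite -raddfD; apply/quotmod_piE/gensub_mem.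
by rewrite opprD addrA; exact: TensorDl.
Qed.

Lemma pure_tensorDr m n n' :
  pure_tensor m (n + n') = pure_tensor m n + pure_tensor m n'.
Proof.
rewrite -raddfD; apply/quotmod_piE/gensub_mem.
by rewrite opprD addrA; exact: TensorDr.
Qed.

Lemma pure_tensorZl b m n : pure_tensor (b *: m) n = b *: pure_tensor m n.
Proof. by rewrite -linearZ; apply/quotmod_piE/gensub_mem; exact: TensorZl. Qed.

Lemma pure_tensorZr a m n : pure_tensor m (a *: n) = pure_tensor (f a *: m) n.
Proof. by apply/quotmod_piE/gensub_mem; exact: TensorZr. Qed.

Section Lift.
Variables (X : lmodType B) (h : M -> N -> X).
Hypothesis hDl : forall m m' n, h (m + m') n = h m n + h m' n.
Hypothesis hDr : forall m n n', h m (n + n') = h m n + h m n'.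
Hypothesis hZl : forall b m n, h (b *: m) n = b *: h m n.
Hypothesis hZr : forall a m n, h m (a *: n) = h (f a *: m) n.

Let h_lift : {linear {freeg (M * N)%type / B} -> X} :=
  free_lift (fun p : M * N => h p.1 p.2).

Lemma tensor_lift_subproof x : x \in gensub tensor_rel -> h_lift x = 0.
Proof.
have hU p : h_lift << p >> = h p.1 p.2 by exact: free_liftU.
move=> xR; apply/eqP; apply: (gensub_min (U := lker h_lift) _ xR) => y {x xR}.
case=> [m m' n|m n n'|b m n|a m n]; apply/eqP; rewrite ?linearB ?linearZ_LR !hU /=.
- by rewrite hDl -addrA -opprD subrr.
- by rewrite hDr -addrA -opprD subrr.
- by rewrite hZl scalerN subrr.
- by rewrite hZr subrr.
Qed.

Definition tensor_lift : {linear tensor -> X} := quotmod_lift tensor_lift_subproof.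

Lemma tensor_liftE m n : tensor_lift (pure_tensor m n) = h m n.
Proof. exact: etrans (quotmod_liftE _ _) (free_liftU _ _). Qed.

End Lift.
End Def.

Section Map.
Variables (M : lmodType B) (N N' : lmodType A) (g : {linear N -> N'}).

Let h (m : M) n := pure_tensor m (g n).

Lemma tensor_map_Dl m m' n : h (m + m') n = h m n + h m' n.
Proof. exact: pure_tensorDl. Qed.

Lemma tensor_map_Dr m n n' : h m (n + n') = h m n + h m n'.
Proof. by rewrite /h linearD pure_tensorDr. Qed.

Lemma tensor_map_Zl b m n : h (b *: m) n = b *: h m n.
Proof. exact: pure_tensorZl. Qed.

Lemma tensor_map_Zr a m n : h m (a *: n) = h (f a *: m) n.
Proof. by rewrite /h linearZ pure_tensorZr. Qed.

(* [id_M (x) g] *)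
Definition tensor_map : {linear tensor M N -> tensor M N'} :=
  tensor_lift tensor_map_Dl tensor_map_Dr tensor_map_Zl tensor_map_Zr.

End Map.

Definition Tor (i : nat) (M : lmodType B) (N : lmodType A) : lmodType B :=
  let F := std_resolution N in
  if i is j.+1 then
    homology (tensor_map M (lres_diff F j.+1)) (tensor_map M (lres_diff F j))
  else homology (tensor_map M (lres_diff F 0))
         (\0 : {linear tensor M (F 0) -> tensor M (F 0)}).

Definition lifting (M : lmodType B) (N : lmodType A) :=
  [/\ fin_gen N, iso_mod M (tensor B^o N)
    & forall i, (0 < i)%N -> trivial_mod (Tor i B^o N)].

End Tensor.

Definition flat (A : comNzRingType) (M : lmodType A) :=
  forall (X Y : lmodType A) (g : {linear X -> Y}), injective g ->
    injective (tensor_map (idfun : {rmorphism A -> A}) M g).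

Definition finite_flat_dim (A : comNzRingType) (M : lmodType A) :=
  exists n (F : left_resolution M), (forall i, flat (F i)) /\ vanishes_above F n.

Definition hom_finite_flat_dim (A B : comNzRingType) (f : {rmorphism A -> B}) :=
  finite_flat_dim (restr_scalars f B^o).

Section LocalRings.
Variable A : comNzRingType.

Definition noetherian := forall I : submodClosed A^o, fin_gen (submod I).

Definition maximal_ideal (I : submodClosed A^o) :=
  (1 : A^o) \notin I /\
  forall J : submodClosed A^o,
    {subset I <= J} -> (1 : A^o) \notin J -> {subset J <= I}.

Definition local_ring :=
  exists2 I : submodClosed A^o, maximal_ideal I
    & forall J : submodClosed A^o, maximal_ideal J -> J =i I.

Definition noeth_local := noetherian /\ local_ring.

(* The intersection of all maximal ideals, that is, the maximal ideal if [A] is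
   local. *)
Definition max_ideal : {pred A^o} :=
  fun x => `[< forall I : submodClosed A^o, maximal_ideal I -> x \in I >].

Lemma max_ideal_closed : submod_closed max_ideal.
Proof.
split=> [|a x y /asboolP xm /asboolP ym]; apply/asboolP=> I Imax; first exact: rpred0.
by rewrite rpredD ?rpredZ ?xm ?ym.
Qed.

HB.instance Definition _ :=
  GRing.isSubmodClosed.Build A A^o max_ideal max_ideal_closed.

Lemma local_max_ideal (I : submodClosed A^o) :
  local_ring -> maximal_ideal I -> max_ideal =i I.
Proof.
move=> [J Jmax Junique] Imax x; apply/asboolP/idP => [xm|xI K Kmax]; first exact: xm.
by rewrite Junique // -(Junique I).
Qed.

Definition gorenstein_local := noeth_local /\ finite_inj_dim A^o.

End LocalRings.
Arguments max_ideal A : clear implicits.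

Definition local_hom (A B : comNzRingType) (f : {rmorphism A -> B}) :=
  forall x, x \in max_ideal A -> f x \in max_ideal B.

Section RingKernel.
Variables (A B : comNzRingType) (f : {rmorphism A -> B}).

Definition rker : {pred A^o} := fun x => f x == 0.

Lemma rker_closed : submod_closed rker.
Proof.
split=> [|a x y /eqP fx /eqP fy]; rewrite unfold_in /= ?rmorph0 //.
by rewrite rmorphD rmorphM fx fy mulr0 addr0.
Qed.

HB.instance Definition _ := GRing.isSubmodClosed.Build A A^o rker rker_closed.

End RingKernel.

Definition gorenstein_ideal (A : comNzRingType) (J : submodClosed A^o) :=
  perfect (quotmod J) /\
  exists2 g, proj_dim (quotmod J) = Some g
    & iso_mod (Ext g (quotmod J) A^o) (quotmod J).

Definition gorenstein_hom (A B : comNzRingType) (f : {rmorphism A -> B}) :=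
  [/\ surjective f, perfect (restr_scalars f B^o) & gorenstein_ideal (rker f)].

Section Complexes.
Variable A : comNzRingType.

(* The differential is indexed by its source; exactness is stated at [i - 1]
   because [cx_diff (i + 1)] has codomain [C (i + 1 - 1)], which is not
   convertible to [C i]. *)
Record complex := Complex {
  cx_mod :> int -> lmodType A;
  cx_diff : forall i, {linear cx_mod i -> cx_mod (i - 1)};
  cx_diff2 : forall i x, cx_diff (i - 1) (cx_diff i x) = 0
}.

Definition acyclic (C : complex) :=
  forall i, exact_at (cx_diff C i) (cx_diff C (i - 1)).

Definition dual_acyclic (C : complex) :=
  forall i, exact_at (precomp A^o (cx_diff C (i - 1))) (precomp A^o (cx_diff C i)).

Definition totally_acyclic (C : complex) :=
  [/\ forall i, fin_gen_free (C i), acyclic C & dual_acyclic C].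

Definition minimal_complex (C : complex) :=
  forall i x, cx_diff C i x \in ideal_mul (max_ideal A) (@predT (C (i - 1))).

Definition nonzero_complex (C : complex) := exists i, ~ trivial_mod (C i).

Definition nontrivial_totally_acyclic (C : complex) :=
  [/\ totally_acyclic C, minimal_complex C & nonzero_complex C].

End Complexes.

(* Main.v *)
(** Put [S = P / I].  A minimal free resolution of [S] over [P] stays a minimal
    resolution over [Q], now of [R]; hence it has finite length [g], the grade
    hypothesis makes its dual exact below [g], and [S] is perfect over [P] with
    [Ext^g(S, P)] isomorphic to [S].  Therefore a finite injective resolution of
    [P] yields one of [S], and a finite flat resolution of [Q] over [P] yields one
    of [R] over [S].  By dimension shifting, acyclic complexes of finite free
    [S]-modules are totally acyclic and remain so after base change to [R].

    Such a complex is obtained by splicing the dual of a truncated minimal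
    resolution [F] of the residue field of [S] with a minimal resolution of a
    kernel.  It is nonzero because [F] is infinite: otherwise the Koszul complex on
    minimal generators of the maximal ideal would embed in [F] modulo the maximal
    ideal (Serre), so that the depth of [S] would be at least its embedding
    dimension (Auslander-Buchsbaum) and the Koszul complex would be acyclic, while
    [0 <> I <= m_P^2] gives it a nonzero first homology. *)

From HB Require Import structures.
Require Import Defs.
From mathcomp Require Import all_boot all_algebra.
From mathcomp Require Import generic_quotient ring_quotient.
From mathcomp Require Import boolp functions freeg.
From mathcomp Require Import ring zify.
From mathcomp Require classical_sets.

Set Implicit Arguments.
Unset Strict Implicit.
Unset Printing Implicit Defensive.

Import GRing.Theory.
Local Open Scope ring_scope.

(** * Submodules and minimal free resolutions *)

(** In the shifting arguments [S] enters only through a surjection [p] from [P]: matrices over [S]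
    are lifted to [P], [Hom_P(S, E)] becomes the set of elements of [E] annihilated by [ker p], and
    the base change of [L] to [S] becomes [L] modulo [(ker p) L]. This avoids change-of-rings
    isomorphisms, at the price that lifted complexes are complexes only modulo [I].

    Dimension shifting sees a bounded stretch of a complex, whose length is governed by the
    injective resolution of [P] or the flat resolution of [Q]. The results are therefore stated at
    one fixed position of an arbitrary exact sequence indexed by the naturals, and then slid along a
    complex indexed by the integers. The one-sided form is what the splicing requires: the
    resolution of the residue field is exact on one side only, and its dual is known to be exact
    only beyond the window, which is where it is truncated.

    Over [R] nothing is dualized anew: the dual complex over [S], already acyclic, is itself base
    changed to [R]. *)

Section Submodules.
Variable A : comNzRingType.

Definition lin_of (U V : lmodType A) (f : U -> V) (fL : linear f) :
  {linear U -> V} := HB.pack f (GRing.isLinear.Build A U V *:%R f fL).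

Definition is_submodule (M : lmodType A) (U : M -> Prop) :=
  U 0 /\ forall a x y, U x -> U y -> U (a *: x + y).

Lemma submod_of_closed (M : lmodType A) (U : M -> Prop) :
  is_submodule U -> submod_closed (fun x => `[< U x >]).
Proof.
case=> U0 UL; split=> [|a x y /asboolP Ux /asboolP Uy]; apply/asboolP => //.
exact: UL.
Qed.

Definition submod_of (M : lmodType A) (U : M -> Prop) (HU : is_submodule U) :
  submodClosed M :=
  HB.pack (fun x => `[< U x >])
    (GRing.isSubmodClosed.Build A M _ (submod_of_closed HU)).

Lemma submod_ofP (M : lmodType A) (U : M -> Prop) (HU : is_submodule U) x :
  reflect (U x) (x \in submod_of HU).
Proof. exact: asboolP. Qed.

Lemma is_submodule_mem (M : lmodType A) (U : submodClosed M) :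
  is_submodule (fun x => x \in U).
Proof. by split=> [|a x y]; [exact: rpred0 | move=> *; rewrite rpredD ?rpredZ]. Qed.

Lemma is_submoduleZ (M : lmodType A) (U : M -> Prop) a x :
  is_submodule U -> U x -> U (a *: x).
Proof. by case=> U0 UL Ux; rewrite -[_ *: _]addr0; apply: UL. Qed.

Lemma is_submoduleD (M : lmodType A) (U : M -> Prop) x y :
  is_submodule U -> U x -> U y -> U (x + y).
Proof. by case=> U0 UL Ux; rewrite -[x]scale1r; apply: UL. Qed.

Lemma is_submodule_sum (M : lmodType A) (U : M -> Prop) (I : finType)
    (F : I -> M) :
  is_submodule U -> (forall i, U (F i)) -> U (\sum_i F i).
Proof.
move=> HU UF; apply: (big_ind U) => //; first by case: HU.
by move=> x y; apply: is_submoduleD.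
Qed.

(** Finite generation is phrased through generating matrices, so that free resolutions become
    sequences of matrices. *)
Definition row_noetherian := forall n (U : 'rV[A]_n -> Prop), is_submodule U ->
  exists c (D : 'M[A]_(c, n)), forall v, U v <-> exists u, v = u *m D.

Lemma is_submodule_rows c n (U : 'rV[A]_n -> Prop) (D : 'M[A]_(c, n)) u :
  is_submodule U -> (forall i, U (row i D)) -> U (u *m D).
Proof.
move=> HU UD; rewrite mulmx_sum_row.
by apply: is_submodule_sum => // i; apply: is_submoduleZ.
Qed.

(** Induction on [n]: the first coordinates of the vectors in [U] form a finitely generated ideal,
    and the vectors of [U] with first coordinate zero form a submodule of a row space of rank one
    less. The generators are lifts of the former stacked on the latter. *)
Lemma noetherian_rows : noetherian A -> row_noetherian.
Proof.
move=> noethA; elim=> [|n IHn] U HU.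
  exists 0%N, 0 => v; split=> _; last by rewrite [v]thinmx0; case: HU.
  by exists 0; rewrite [v]thinmx0 mulmx0.
have HI : is_submodule (fun a : A^o => exists2 v, U v & v 0 ord0 = a).
  split=> [|a x y [v Uv <-] [w Uw <-]].
    by exists 0; [case: HU | rewrite mxE].
  by exists (a *: v + w); [case: HU => _; apply | rewrite !mxE].
have [k [g gP]] := noethA (submod_of HI).
have [w wP] : {w : 'I_k -> 'rV_n.+1 & 
    forall i, U (w i) /\ w i 0 ord0 = submod_val (g i)}.
  apply: (@choice _ _ (fun i v => U v /\ v 0 ord0 = submod_val (g i))) => i.
  by have /submod_ofP[v Uv vE] := valP (g i); exists v; split.
have HU' : is_submodule (fun v : 'rV_n => U (row_mx (0 : 'rV_1) v : 'rV_(1 + n))).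
  case: HU => U0 UL; split=> [|a x y Ux Uy]; first by rewrite row_mx0.
  have -> : row_mx 0 (a *: x + y) =
      a *: row_mx (0 : 'rV_1) x + row_mx (0 : 'rV_1) y :> 'rV_(1 + n).
    by rewrite scale_row_mx add_row_mx scaler0 addr0.
  exact: UL.
have [c [D DP]] := IHn _ HU'.
pose D' : 'M_(k + c, 1 + n) :=
  col_mx (\matrix_(i < k) w i) (row_mx (0 : 'M_(c, 1)) D).
exists (k + c)%N, D' => v; split=> [Uv|[u ->]].
  have vI : (v 0 ord0 : A^o) \in submod_of HI by apply/submod_ofP; exists v.
  have [b bP] := gP (in_submod vI).
  pose u1 : 'rV_k := \row_i b i.
  have v0E : v 0 ord0 = \sum_i b i * w i 0 ord0.
    have /(congr1 (@submod_val _ _ _)) := bP; rewrite /= linear_sum => E.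
    rewrite -[LHS]/(submod_val (in_submod vI)) E; apply: eq_bigr => i _.
    by rewrite linearZ (wP i).2.
  pose v' : 'rV_(1 + n) := v - u1 *m \matrix_(i < k) w i.
  have Uv' : U v'.
    rewrite /v' addrC -scaleN1r; case: (HU) => _; apply=> //.
    by apply: is_submodule_rows => // i; rewrite rowK; case: (wP i).
  have v'E : v' = row_mx (0 : 'rV_1) (rsubmx v').
    rewrite -[LHS]hsubmxK; congr row_mx; apply/rowP=> i; rewrite !mxE.
    have -> : lshift n i = ord0 by apply/val_inj; rewrite /= ord1.
    rewrite v0E; apply/eqP; rewrite subr_eq0; apply/eqP/eq_bigr => j _.
    by rewrite !mxE.
  have /DP[u2 u2E] : U (row_mx (0 : 'rV_1) (rsubmx v') : 'rV_(1 + n)).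
    by rewrite -v'E.
  have E : u2 *m row_mx (0 : 'M_(c, 1)) D = v' :> 'rV_(1 + n).
    by rewrite mul_mx_row mulmx0 -u2E.
  exists (row_mx u1 u2); rewrite /D' mul_row_col E.
  by rewrite addrC subrK.
apply: is_submodule_rows => // i; case: (split_ordP i) => j ->.
  by rewrite /D' rowKu rowK; exact: (wP j).1.
have -> : row (rshift k j) D' = row_mx (0 : 'rV_1) (row j D) :> 'rV_(1 + n).
  by rewrite /D' rowKd row_row_mx row0.
by apply/DP; exists (delta_mx 0 j); exact: rowE.
Qed.

End Submodules.

Section MinimalResolutions.
Variable A : comNzRingType.

(** A proper ideal whose complement consists of units. Unlike [max_ideal], this form passes along
    surjections at once, so that [S] can use the image of the maximal ideal of [P]. *)
Definition local_at (m : A -> Prop) :=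
  [/\ is_submodule (m : A^o -> Prop), ~ m 1 &
      forall x, ~ m x -> exists y, x * y = 1].

Definition row_space a b (U : 'rV[A]_b -> Prop) (D : 'M[A]_(a, b)) :=
  forall v, U v <-> exists u, v = u *m D.

(** Every relation among the rows has coefficients in [m]; over a local ring this says that the rows
    minimally generate their span. *)
Definition minimal_rows (m : A -> Prop) a b (D : 'M[A]_(a, b)) :=
  forall u : 'rV_a, u *m D = 0 -> forall i, m (u 0 i).

Definition mx_exact a b c (D' : 'M[A]_(a, b)) (D : 'M[A]_(b, c)) :=
  row_space (fun v => v *m D = 0) D'.

Lemma mx_exact0 a b c (D' : 'M[A]_(a, b)) (D : 'M[A]_(b, c)) :
  mx_exact D' D -> D' *m D = 0.
Proof.
move=> ex; apply/row_matrixP=> i; rewrite row_mul row0; apply/ex.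
by exists (delta_mx 0 i); rewrite -rowE.
Qed.

Lemma mx_exact_lift a b c l (D' : 'M[A]_(a, b)) (D : 'M[A]_(b, c)) (N : 'M_(l, b)) :
  mx_exact D' D -> N *m D = 0 -> exists s, N = s *m D'.
Proof.
move=> ex ND; have rowN k : row k N *m D = 0 by rewrite -row_mul ND row0.
have [s sP] := choice (fun k => (ex _).1 (rowN k)).
by exists (\matrix_k s k); apply/row_matrixP => k; rewrite row_mul rowK.
Qed.

Lemma minimal_entries (m : A -> Prop) a b l (M : 'M[A]_(a, b)) (M' : 'M[A]_(b, l)) :
  minimal_rows m M' -> M *m M' = 0 -> forall i j, m (M i j).
Proof.
move=> minM' MM' i j; have := minM' (row i M); rewrite -row_mul MM' row0.
by move=> /(_ erefl j); rewrite mxE.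
Qed.

Lemma is_submodule_ker a b (D : 'M[A]_(a, b)) :
  is_submodule (fun v : 'rV_a => v *m D = 0).
Proof.
split=> [|x u v uD vD]; first by rewrite mul0mx.
by rewrite mulmxDl -scalemxAl uD vD scaler0 addr0.
Qed.

Lemma mulmx_row'0 n c (u : 'rV[A]_n.+1) (D : 'M_(n.+1, c)) i :
  u 0 i = 0 -> u *m D = col' i u *m row' i D.
Proof.
move=> ui; apply/rowP=> j; rewrite !mxE (bigD1_ord i) //= ui mul0r add0r.
by apply: eq_bigr => k _; rewrite !mxE.
Qed.

(** Take the least possible number of generators: a relation with a coefficient outside [m], hence a
    unit, would allow one generator to be dropped. *)
Lemma minimal_generators (m : A -> Prop) n (U : 'rV[A]_n -> Prop) :
  row_noetherian A -> local_at m -> is_submodule U ->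
  exists c (D : 'M_(c, n)), row_space U D /\ minimal_rows m D.
Proof.
move=> noethA [_ _ mU] HU.
pose gen c := `[< exists D : 'M_(c, n), row_space U D >].
have exg : exists c, gen c.
  by have [c [D DP]] := noethA _ _ HU; exists c; apply/asboolP; exists D.
case: (ex_minnP exg) => c /asboolP[D DP] cmin; exists c, D; split=> // u uD i.
apply: contrapT => /mU[y uy].
case: c => [|c] in D DP cmin u uD i uy *; first by case: i uy.
have /cmin : gen c; last by rewrite ltnn.
apply/asboolP; exists (row' i D) => v; rewrite DP; split=> -[w ->].
  (* Subtracting this multiple of the relation [u] clears the coefficient of the generator [i]. *)
  pose w' := w - (w 0 i * y) *: u.
  have <- : w' *m D = w *m D by rewrite mulmxBl -scalemxAl uD scaler0 subr0.
  exists (col' i w'); apply: mulmx_row'0; rewrite !mxE -mulrA (mulrC y) uy.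
  by rewrite mulr1 subrr.
exists (\row_j if unlift i j is Some k then w 0 k else 0).
rewrite (@mulmx_row'0 _ _ _ _ i) ?mxE ?unlift_none //; congr (_ *m _).
by apply/rowP=> j; rewrite !mxE liftK.
Qed.

(** The first two values reduce by computation, so that a given matrix of size [a] by [b] can be the
    differential [D 0] without a cast. *)
Definition ranks (a b : nat) (r : nat -> nat) (i : nat) : nat :=
  match i with 0%N => b | 1%N => a | i.+2 => r i end.

Lemma minimal_resolution (m : A -> Prop) a b (D0 : 'M[A]_(a, b)) :
  row_noetherian A -> local_at m ->
  exists r (D : forall i, 'M[A]_(ranks a b r i.+1, ranks a b r i)),
  [/\ D 0%N = D0, forall i, mx_exact (D i.+1) (D i)
    & forall i, minimal_rows m (D i.+1)].
Proof.
move=> noethA locm.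
have syzP (a' b' : nat) (D : 'M[A]_(a', b')) :
    exists s : {c & 'M[A]_(c, a')},
      mx_exact (projT2 s) D /\ minimal_rows m (projT2 s).
  have [c [D' D'P]] := minimal_generators noethA locm (is_submodule_ker D).
  by exists (existT _ c D').
pose syz a' b' (D : 'M[A]_(a', b')) := projT1 (cid (syzP a' b' D)).
have syzE a' b' (D : 'M[A]_(a', b')) := projT2 (cid (syzP a' b' D)).
pose T := {x : nat * nat & 'M[A]_(x.1, x.2)}.
pose next (s : T) : T :=
  existT (fun x : nat * nat => 'M[A]_(x.1, x.2))
    (projT1 (syz _ _ (projT2 s)), (projT1 s).1) (projT2 (syz _ _ (projT2 s))).
pose stage i := iter i next (existT (fun x : nat * nat => 'M[A]_(x.1, x.2)) (a, b) D0).
pose r i := (projT1 (stage i.+1)).1.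
(* Only after this case split are the sizes of the stages convertible to [ranks]. *)
exists r, (fun i => match i return 'M[A]_(ranks a b r i.+1, ranks a b r i) with
  | 0%N => D0 | 1%N => projT2 (stage 1%N) | i.+2 => projT2 (stage i.+2) end).
split=> // -[|[|i]]; try exact: (syzE _ _ _).1; exact: (syzE _ _ _).2.
Qed.

End MinimalResolutions.

(** * Comparison of resolutions, Ext and Tor *)

(** Dependent choice along a family of types; [inv] is what keeps the construction extendable. *)
Lemma dependent_family (T : nat -> Type) (inv : forall n, T n -> Prop)
    (R : forall n, T n -> T n.+1 -> Prop) (x0 : T 0%N) :
  inv 0%N x0 -> (forall n x, inv n x -> exists y, R n x y /\ inv n.+1 y) ->
  exists f : forall n, T n, f 0%N = x0 /\ forall n, R n (f n) (f n.+1).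
Proof.
move=> inv0 step.
pose next n (x : {x : T n | inv n x}) : {y : T n.+1 | inv n.+1 y} :=
  let s := cid (step n (sval x) (svalP x)) in exist _ (sval s) (svalP s).2.
pose f := fix f n : {x : T n | inv n x} :=
  if n is k.+1 return {x : T n | inv n x} then next k (f k) else exist _ x0 inv0.
exists (fun n => sval (f n)); split=> // n.
exact: (svalP (cid (step n (sval (f n)) (svalP (f n))))).1.
Qed.

Section Comparison.
Variable A : comNzRingType.

Lemma is_submodule_im (X Y : lmodType A) (p : {linear X -> Y}) :
  is_submodule (fun y => exists x, p x = y).
Proof.
split=> [|a _ _ [x <-] [y <-]]; first by exists 0; rewrite linear0.
by exists (a *: x + y); rewrite linearP.
Qed.

(** Projectivity speaks of surjections only, so [Y] is replaced by the image of [p]. *)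
Lemma proj_lift (M X Y : lmodType A) (p : {linear X -> Y})
    (f : {linear M -> Y}) :
  projective M -> (forall m, exists x, p x = f m) ->
  exists g : {linear M -> X}, forall m, p (g m) = f m.
Proof.
move=> projM fim; pose U := submod_of (is_submodule_im p).
have pU x : p x \in U by apply/submod_ofP; exists x.
have fU m : f m \in U by apply/submod_ofP.
have pL : linear (fun x => in_submod (pU x)).
  by move=> a x y; apply: val_inj; rewrite /= linearP.
have fL : linear (fun m => in_submod (fU m)).
  by move=> a x y; apply: val_inj; rewrite /= linearP.
have [|g gP] := projM _ _ (lin_of pL) (lin_of fL).
  move=> [y yU]; have /submod_ofP[x xy] := yU.
  by exists x; apply: val_inj.
by exists g => m; have /(congr1 (@submod_val _ _ _)) := gP m.
Qed.

Variable M : lmodType A.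

Definition chain_map (F G : left_resolution M)
    (alpha : forall n, {linear F n -> G n}) :=
  (forall x, lres_aug G (alpha 0%N x) = lres_aug F x) /\
  (forall n x, lres_diff G n (alpha n.+1 x) = alpha n (lres_diff F n x)).

Lemma lres_diff2 (F : left_resolution M) n x :
  lres_diff F n (lres_diff F n.+1 x) = 0.
Proof. by apply/lres_exactS; exists x. Qed.

Lemma lres_aug_diff (F : left_resolution M) x : lres_aug F (lres_diff F 0 x) = 0.
Proof. by apply/lres_exact0; exists x. Qed.

Lemma chain_map_exists (F G : left_resolution M) :
  (forall i, projective (F i)) ->
  exists alpha, @chain_map F G alpha.
Proof.
move=> projF.
have [a0 a0P] := projF 0%N _ _ (lres_aug G) (lres_aug F) (@lres_surj _ _ G).
pose inv n (a : {linear F n -> G n}) :=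
  forall x, exists y, lres_diff G n y = a (lres_diff F n x).
pose R n (a : {linear F n -> G n}) (b : {linear F n.+1 -> G n.+1}) :=
  forall x, lres_diff G n (b x) = a (lres_diff F n x).
have [||f [f0 fR]] := @dependent_family _ inv R a0.
- by move=> x; apply/lres_exact0; rewrite a0P lres_aug_diff.
- move=> n a ia.
  have [g gP] := @proj_lift _ _ _ (lres_diff G n) (a \o lres_diff F n) (projF n.+1) ia.
  exists g; split=> // x; apply/lres_exactS.
  by rewrite gP /= lres_diff2 linear0.
by exists f; split=> //; rewrite f0.
Qed.

Lemma homotopy_exists (F : left_resolution M) (c : forall n, {linear F n -> F n}) :
  (forall i, projective (F i)) -> chain_map c ->
  exists h : forall n, {linear F n -> F n.+1},
    (forall x, c 0%N x = x + lres_diff F 0 (h 0%N x)) /\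
    (forall n x, c n.+1 x =
       x + lres_diff F n.+1 (h n.+1 x) + h n (lres_diff F n x)).
Proof.
move=> projF [c0 cS].
have lift n (e : {linear F n -> F n}) : (forall x, exists y, lres_diff F n y = e x) ->
    exists h : {linear F n -> F n.+1}, forall x, lres_diff F n (h x) = e x.
  exact: proj_lift.
have [h0 h0P] : exists h : {linear F 0 -> F 1}, forall x,
    lres_diff F 0 (h x) = (c 0%N \- idfun) x.
  apply: lift => x; apply/lres_exact0.
  by rewrite /= linearB /= c0 subrr.
(* This is the homotopy identity restricted to boundaries, where the term [h \o d] from the
   preceding degree vanishes. *)
pose inv n (h : {linear F n -> F n.+1}) := forall x, 
  c n (lres_diff F n x) = lres_diff F n x + lres_diff F n (h (lres_diff F n x)).
pose R n (h : {linear F n -> F n.+1}) (k : {linear F n.+1 -> F n.+2}) := forall x,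
  c n.+1 x = x + lres_diff F n.+1 (k x) + h (lres_diff F n x).
have [||h [hE hR]] := @dependent_family _ inv R h0.
- by move=> x; rewrite h0P /= addrC subrK.
- move=> n h ih.
  have [|k kP] := lift n.+1 (c n.+1 \- idfun \- (h \o lres_diff F n)).
    move=> x; apply/lres_exactS => /=.
    rewrite !linearB /= cS; apply/eqP; rewrite subr_eq0 subr_eq; apply/eqP.
    by rewrite ih addrC.
  exists k; split=> x.
    by rewrite kP /= -addrA subrK addrC subrK.
  rewrite kP /= lres_diff2 linear0 subr0.
  by rewrite addrC subrK.
exists h; split=> // x.
by rewrite hE h0P /= addrC subrK.
Qed.

Lemma comparison (F G : left_resolution M) :
  (forall i, projective (F i)) -> (forall i, projective (G i)) ->
  exists (alpha : forall n, {linear F n -> G n})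
    (beta : forall n, {linear G n -> F n}) (h : forall n, {linear G n -> G n.+1}),
  [/\ chain_map alpha, chain_map beta,
      forall x, alpha 0%N (beta 0%N x) = x + lres_diff G 0 (h 0%N x) &
      forall n x, alpha n.+1 (beta n.+1 x) =
        x + lres_diff G n.+1 (h n.+1 x) + h n (lres_diff G n x)].
Proof.
move=> projF projG.
have [a [a0 aS]] := chain_map_exists G projF.
have [b [b0 bS]] := chain_map_exists F projG.
have [|h [h0 hS]] := @homotopy_exists G (fun n => a n \o b n) projG.
  by split=> [x|n x] /=; rewrite ?a0 ?b0 // aS bS.
by exists a, b, h.
Qed.

End Comparison.

Section ExtTransfer.
Variable A : comNzRingType.

Lemma quotmod_eq0 (M : lmodType A) (U : submodClosed M) x :
  quotmod_pi U x = 0 <-> x \in U.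
Proof. by rewrite -[0](linear0 (quotmod_pi U)) quotmod_piE subr0. Qed.

Lemma homology_eq0 (X Y Z : lmodType A) (f : {linear X -> Y})
    (g : {linear Y -> Z}) (z : submod (Defs.lker g)) :
  quotmod_pi (@boundaries _ _ _ _ f g) z = 0 <-> exists x, f x = submod_val z.
Proof. by rewrite quotmod_eq0; split=> [/asboolP|?] //; apply/asboolP. Qed.

Lemma homology_trivial (X Y Z : lmodType A) (f : {linear X -> Y})
    (g : {linear Y -> Z}) :
  trivial_mod (homology f g) <-> forall y, g y = 0 -> exists x, f x = y.
Proof.
split=> [triv y gy|H z].
  have yK : y \in Defs.lker g by apply/eqP.
  by have /homology_eq0 := triv (quotmod_pi (@boundaries _ _ _ _ f g) (in_submod yK)).
rewrite -[z]quotmod_reprK; apply/homology_eq0/H.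
exact/eqP/(valP (repr z)).
Qed.

Lemma homology_cyclic (X Y Z : lmodType A) (f : {linear X -> Y})
    (g : {linear Y -> Z}) (e : homology f g) :
  (forall z : homology f g, exists c : A, z = c *: e) ->
  exists2 t, g t = 0 &
    forall y, g y = 0 -> exists (c : A) x, f x = y - c *: t.
Proof.
move=> cyc; exists (submod_val (repr e)); first exact/eqP/(valP (repr e)).
move=> y gy; have yK : y \in Defs.lker g by apply/eqP.
have [c cP] := cyc (quotmod_pi (@boundaries _ _ _ _ f g) (in_submod yK)).
exists c; apply/asboolP; move: cP.
by rewrite -{1}[e]quotmod_reprK -linearZ => /quotmod_piE.
Qed.

Section HomElements.
Variables X Y : lmodType A.

Lemma to_hom_subproof (f : {linear X -> Y}) : (f : X -> Y) \in @Defs.linear_pred A X Y.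
Proof. by apply/asboolP => a x y; rewrite linearP. Qed.

Definition to_hom (f : {linear X -> Y}) : Defs.Hom X Y := in_submod (to_hom_subproof f).

Definition of_hom (f : Defs.Hom X Y) : {linear X -> Y} := lin_of (hom_fun_linear f).

Lemma hom_eq0 (f : Defs.Hom X Y) : f = 0 <-> forall x, of_hom f x = 0.
Proof.
split=> [-> //|f0]; apply: val_inj; apply: funext => x; exact: f0.
Qed.

End HomElements.

Lemma precomp_eq0 (X Y M : lmodType A) (f : {linear X -> Y}) (h : Defs.Hom Y M) :
  precomp M f h = 0 <-> forall x, of_hom h (f x) = 0.
Proof. exact: hom_eq0. Qed.

Variable N : lmodType A.
Implicit Types F G : left_resolution N.

Definition cocycle F (M : lmodType A) i (f : F i -> M) :=
  forall x, f (lres_diff F i x) = 0.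

(** Nothing maps into degree 0 of the Hom complex, so there a coboundary is zero. Bare functions are
    allowed, so that differences such as [f x - c *: t x] need no linear structure. *)
Definition coboundary F (M : lmodType A) i : (F i -> M) -> Prop :=
  match i return (F i -> M) -> Prop with
  | 0%N => fun f => forall x, f x = 0
  | j.+1 => fun f => exists g : {linear F j -> M}, forall x, f x = g (lres_diff F j x)
  end.

Definition hom_exact F (M : lmodType A) i :=
  forall f : {linear F i -> M}, cocycle f -> coboundary f.

Lemma Ext_trivial M i : trivial_mod (Ext i N M) <-> hom_exact (std_resolution N) M i.
Proof.
split=> [triv f fc|ex].
  case: i => [|i] in triv f fc *.
    have /homology_trivial/(_ (to_hom f))[] := triv.
      by apply/hom_eq0 => x; exact: fc.
    by move=> _ /esym /hom_eq0.
  have /homology_trivial/(_ (to_hom f))[] := triv.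
    by apply/hom_eq0 => x; exact: fc.
  move=> g gf; exists (of_hom g) => x.
  by rewrite -[f x]/(of_hom (to_hom f) x) -gf.
case: i => [|i] in ex *; apply/homology_trivial => f /hom_eq0 fc.
  by exists 0; apply/esym/hom_eq0; apply: ex.
have [g gP] := ex (of_hom f) fc; exists (to_hom g).
by apply: val_inj; apply: funext => x; rewrite -[RHS]/(of_hom f x) gP.
Qed.

Lemma Ext_cyclic M i (e : Ext i N M) :
  (forall z : Ext i N M, exists c : A, z = c *: e) ->
  exists2 t : {linear std_resolution N i -> M}, cocycle t &
    forall f : {linear std_resolution N i -> M}, cocycle f ->
      exists c : A, coboundary (fun x => f x - c *: t x).
Proof.
case: i => [|i] in e *; move=> /homology_cyclic[t /precomp_eq0 tc tP].
  exists (of_hom t) => // f fc.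
  have [|c [g cE]] := tP (to_hom f); first by apply/precomp_eq0 => x; exact: fc.
  exists c => x.
  by have /(congr1 (fun h : Defs.Hom _ _ => hom_fun h x))/esym := cE.
exists (of_hom t) => // f fc.
have [|c [g cE]] := tP (to_hom f); first by apply/precomp_eq0 => x; exact: fc.
exists c, (of_hom g) => x.
by have /(congr1 (fun h : Defs.Hom _ _ => hom_fun h x))/esym := cE.
Qed.

Section Transfer.
Variables (F G : left_resolution N) (M : lmodType A).
Hypotheses (projF : forall i, projective (F i)) (projG : forall i, projective (G i)).

(** As [f] kills boundaries, [f] is [f \o alpha \o beta] minus [f \o h] applied to the differential,
    and the last term is a coboundary. The function [k] will be zero for exactness and a multiple of
    a fixed cocycle for cyclicity. *)
Lemma coboundary_transfer (alpha : forall n, {linear F n -> G n})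
    (beta : forall n, {linear G n -> F n}) (h : forall n, {linear G n -> G n.+1})
    i (f : {linear G i -> M}) (k : F i -> M) :
  chain_map beta ->
  (forall x, alpha 0%N (beta 0%N x) = x + lres_diff G 0 (h 0%N x)) ->
  (forall n x, alpha n.+1 (beta n.+1 x) =
        x + lres_diff G n.+1 (h n.+1 x) + h n (lres_diff G n x)) ->
  cocycle f -> coboundary (fun x => f (alpha i x) - k x) ->
  coboundary (fun x => f x - k (beta i x)).
Proof.
move=> [_ bS] h0 hS; case: i => [|i] in f k *; move=> fc /=.
  by move=> kc x; rewrite -[in RHS](kc (beta 0%N x)) h0 linearD fc addr0.
move=> [g gP]; exists ((g \o beta i) \- (f \o h i)) => x /=.
rewrite -bS -gP hS !linearD fc addr0 /=.
by rewrite addrAC addrK.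
Qed.

Lemma hom_exact_transfer i : hom_exact F M i -> hom_exact G M i.
Proof.
move=> ex f fc; have [a [b [h [ca cb h0 hS]]]] := comparison projF projG.
have /(coboundary_transfer cb h0 hS fc) :
    coboundary (fun x => f (a i x) - (fun=> 0) x).
  have := ex (f \o a i); rewrite /cocycle /=.
  have fac x : f (a i (lres_diff F i x)) = 0 by rewrite -ca.2 fc.
  move=> /(_ fac); case: i {ex fc fac} f => [|i] f /=.
    by move=> + x => ->; rewrite subr0.
  by case=> g gP; exists g => x; rewrite gP subr0.
by case: i {ex fc} f => [|i] f /= => [+ x|[g gP]];
  [move/(_ x); rewrite subr0 | exists g => x; rewrite -gP subr0].
Qed.

Lemma hom_cyclic_transfer i (t : {linear F i -> M}) :
  cocycle t ->
  (forall f : {linear F i -> M}, cocycle f ->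
      exists c : A, coboundary (fun x => f x - c *: t x)) ->
  exists2 u : {linear G i -> M}, cocycle u &
    forall f : {linear G i -> M}, cocycle f ->
      exists c : A, coboundary (fun x => f x - c *: u x).
Proof.
move=> tc tP; have [a [b [h [ca cb h0 hS]]]] := comparison projF projG.
exists (t \o b i) => [x|f fc]; first by rewrite /= -cb.2 tc.
have fac : cocycle (f \o a i) by move=> x; rewrite /= -ca.2 fc.
have [c cP] := tP (f \o a i) fac; exists c.
exact: (@coboundary_transfer a b h i f (fun x => c *: t x) cb h0 hS fc cP).
Qed.

End Transfer.
End ExtTransfer.

(** * Free modules and resolutions given by matrices *)

Section FreeModules.
Variable A : comNzRingType.

Lemma freegU_scale (K : choiceType) (a : A) (x : K) :
  << a *g x >> = a *: << x >> :> {freeg K / A}.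
Proof.
apply/eqP/freeg_eqP => y.
by rewrite -[a *: _]/(fgscale a _) coeff_fgscale !coeffU mul1r.
Qed.

Lemma freeg_ext (K : choiceType) (M : lmodType A)
    (f g : {linear {freeg K / A} -> M}) :
  (forall x, f << x >> = g << x >>) -> f =1 g.
Proof.
move=> fg D; rewrite -(freeg_sumE D) !linear_sum; apply: eq_bigr => x _.
by rewrite freegU_scale !linearZ fg.
Qed.

Lemma free_mod_projective (M : lmodType A) : projective (free_mod M).
Proof.
move=> X Y p f psurj.
have [g gP] := choice (fun x : M => psurj (f << x >>)).
exists (free_lift g) => D.
pose h : {linear {freeg M / A} -> Y} := p \o free_lift g.
rewrite -[LHS]/(h D); apply: (@freeg_ext M Y h f) => x.
by rewrite /h /= free_liftU.
Qed.

Lemma std_projective (M : lmodType A) i : projective (std_resolution M i).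
Proof. exact: free_mod_projective. Qed.

Lemma row_ext n (M : lmodType A) (f g : {linear 'rV[A]_n -> M}) :
  (forall i, f (delta_mx 0 i) = g (delta_mx 0 i)) -> f =1 g.
Proof.
move=> fg v; rewrite [v]row_sum_delta !linear_sum; apply: eq_bigr => i _.
by rewrite !linearZ fg.
Qed.

Lemma row_lift_linear n (M : lmodType A) (m : 'I_n -> M) :
  linear (fun v : 'rV[A]_n => \sum_i v 0 i *: m i).
Proof.
move=> a u v; rewrite scaler_sumr -big_split; apply: eq_bigr => i _.
by rewrite !mxE scalerDl scalerA.
Qed.

Definition row_lift n (M : lmodType A) (m : 'I_n -> M) : {linear 'rV[A]_n -> M} :=
  lin_of (row_lift_linear m).

Lemma row_lift_delta n (M : lmodType A) (m : 'I_n -> M) i :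
  row_lift m (delta_mx 0 i) = m i.
Proof.
rewrite /row_lift /= (bigD1 i) //= big1 ?addr0 ?mxE ?eqxx ?scale1r // => j ji.
by rewrite mxE eqxx (negbTE ji) scale0r.
Qed.

Lemma row_projective n : projective 'rV[A]_n.
Proof.
move=> X Y p f psurj.
have [g gP] := choice (fun i => psurj (f (delta_mx 0 i))).
exists (row_lift g) => v.
pose h : {linear 'rV[A]_n -> Y} := p \o row_lift g.
rewrite -[LHS]/(h v); apply: (@row_ext _ _ h f) => i.
by rewrite -[LHS]/(p (row_lift g (delta_mx 0 i))) row_lift_delta.
Qed.

Lemma mulmxr_linear a b (D : 'M[A]_(a, b)) : linear (fun v : 'rV_a => v *m D).
Proof. by move=> c u v; rewrite mulmxDl scalemxAl. Qed.

Definition mx_lin a b (D : 'M[A]_(a, b)) : {linear 'rV[A]_a -> 'rV[A]_b} :=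
  lin_of (mulmxr_linear D).

Section MatrixResolution.
Variables (n : nat -> nat) (D : forall i, 'M[A]_(n i.+1, n i)).
Variables (M : lmodType A) (aug : {linear 'rV[A]_(n 0) -> M}).
Hypothesis aug_surj : Defs.surjective aug.
Hypothesis aug_ker : row_space (fun v => aug v = 0) (D 0).
Hypothesis Dexact : forall i, mx_exact (D i.+1) (D i).

Definition mx_resolution : left_resolution M.
Proof.
refine (@LeftResolution A M (fun i => 'rV[A]_(n i)) (fun i => mx_lin (D i)) aug
  aug_surj _ _).
- by move=> v; rewrite aug_ker; split=> -[u uv]; exists u.
- by move=> i v; rewrite Dexact; split=> -[u uv]; exists u.
Defined.

Lemma mx_resolution_projective i : projective (mx_resolution i).
Proof. exact: row_projective. Qed.

End MatrixResolution.

End FreeModules.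

(** * Hom complexes as matrices acting on tuples *)

Section MatrixAction.
Variable A : comNzRingType.
Implicit Types V W : lmodType A.

(** A tuple in [V] stands for a linear map from a row space to [V], and [mxact D] is then
    precomposition with [mx_lin D]. With [D] transposed, the same action describes tensoring [D]
    with [V]. *)
Definition mxact V a b (D : 'M[A]_(a, b)) (v : 'I_b -> V) : 'I_a -> V :=
  fun i => \sum_j D i j *: v j.

Lemma mxact_linear V a b (D : 'M[A]_(a, b)) : linear (@mxact V a b D).
Proof.
move=> c u v; apply: funext => i; rewrite !fctE /mxact scaler_sumr -big_split.
by apply: eq_bigr => j _; rewrite /= scalerDr !scalerA mulrC.
Qed.

HB.instance Definition _ V a b (D : 'M[A]_(a, b)) :=
  GRing.isLinear.Build A ('I_b -> V) ('I_a -> V) *:%R (@mxact V a b D)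
    (mxact_linear D).

Lemma mxactM V a b c (D : 'M[A]_(a, b)) (E : 'M[A]_(b, c)) (v : 'I_c -> V) :
  mxact (D *m E) v = mxact D (mxact E v).
Proof.
apply: funext => i; rewrite /mxact.
under eq_bigr do rewrite mxE scaler_suml.
rewrite exchange_big; apply: eq_bigr => j _; rewrite scaler_sumr.
by apply: eq_bigr => k _; rewrite scalerA.
Qed.

Lemma mxact_lin V W a b (D : 'M[A]_(a, b)) (f : {linear V -> W}) (v : 'I_b -> V) :
  f \o mxact D v = mxact D (f \o v).
Proof.
apply: funext => i; rewrite /mxact /= linear_sum.
by apply: eq_bigr => j _; rewrite linearZ.
Qed.

Lemma mxact0l V a b (v : 'I_b -> V) : mxact (0 : 'M[A]_(a, b)) v = 0.
Proof.
by apply: funext => i; rewrite /mxact big1 // => j _; rewrite mxE scale0r.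
Qed.

Lemma row_lift_mulmx V a b (D : 'M[A]_(a, b)) (v : 'I_b -> V) (x : 'rV_a) :
  row_lift v (x *m D) = row_lift (mxact D v) x.
Proof.
rewrite /row_lift /= /mxact; under eq_bigr do rewrite mxE scaler_suml.
rewrite exchange_big; apply: eq_bigr => j _; rewrite scaler_sumr.
by apply: eq_bigr => k _; rewrite scalerA.
Qed.

Lemma row_lift_delta_fun n V (f : {linear 'rV[A]_n -> V}) :
  row_lift (fun i => f (delta_mx 0 i)) =1 f.
Proof. by apply: row_ext => i; rewrite row_lift_delta. Qed.

(* Exactness at [i] of the complex [Hom(G, V)], where [G] is the complex of row
   spaces with differentials [D]. *)
Definition dual_exact (n : nat -> nat) (D : forall i, 'M[A]_(n i.+1, n i)) V
    (i : nat) : Prop :=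
  match i with
  | 0%N => forall v : 'I_(n 0) -> V, mxact (D 0) v = 0 -> v = 0
  | j.+1 => forall v : 'I_(n j.+1) -> V, mxact (D j.+1) v = 0 ->
      exists w, v = mxact (D j) w
  end.

Section DualExact.
Variables (n : nat -> nat) (D : forall i, 'M[A]_(n i.+1, n i)).
Variables (M : lmodType A) (aug : {linear 'rV[A]_(n 0) -> M}).
Hypothesis aug_surj : Defs.surjective aug.
Hypothesis aug_ker : row_space (fun v => aug v = 0) (D 0).
Hypothesis Dexact : forall i, mx_exact (D i.+1) (D i).
Let G := mx_resolution aug_surj aug_ker Dexact.

Lemma row_lift_cocycle V i (v : 'I_(n i) -> V) :
  mxact (D i) v = 0 -> @cocycle A M G V i (row_lift v).
Proof.
move=> Dv x; rewrite [LHS](row_lift_mulmx (D i)) Dv /=.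
by apply: big1 => j _; rewrite scaler0.
Qed.

Lemma cocycle_mxact V i (f : {linear 'rV[A]_(n i) -> V}) :
  @cocycle A M G V i f -> mxact (D i) (fun k => f (delta_mx 0 k)) = 0.
Proof.
move=> fc; apply: funext => k.
have := fc (delta_mx 0 k); rewrite -[X in X = _]/(f (delta_mx 0 k *m D i)).
by rewrite -row_lift_delta_fun row_lift_mulmx row_lift_delta.
Qed.

Lemma hom_exact_mx V i : hom_exact G V i <-> dual_exact D V i.
Proof.
split.
  case: i => [|i] ex v Dv.
    apply: funext => k; rewrite -(row_lift_delta v k).
    exact: (ex (row_lift v) (row_lift_cocycle Dv)).
  have [g gP] := ex (row_lift v) (row_lift_cocycle Dv).
  exists (fun k => g (delta_mx 0 k)); apply: funext => k.
  rewrite -(row_lift_delta v k) gP -[lres_diff _ _ _]/(delta_mx 0 k *m D i).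
  by rewrite -row_lift_delta_fun row_lift_mulmx row_lift_delta.
case: i => [|i] ex f /cocycle_mxact fc.
  move=> x; rewrite -row_lift_delta_fun (ex _ fc) /=.
  by apply: big1 => j _; rewrite scaler0.
have [w wP] := ex _ fc; exists (row_lift w) => x.
by rewrite -row_lift_delta_fun wP -row_lift_mulmx.
Qed.

Lemma hom_cyclic_mx V i (t : {linear G i -> V}) :
  cocycle t ->
  (forall f : {linear G i -> V}, cocycle f ->
      exists c : A, coboundary (fun x => f x - c *: t x)) ->
  exists2 u : 'I_(n i) -> V, mxact (D i) u = 0 &
    forall v, mxact (D i) v = 0 -> exists c : A,
      match i return ('I_(n i) -> V) -> Prop with
      | 0%N => fun v => v = 0
      | j.+1 => fun v => exists w, v = mxact (D j) w
      end (v - c *: u).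
Proof.
move=> tc tP; exists (fun k => t (delta_mx 0 k)); first exact: cocycle_mxact.
move=> v Dv; have [c cP] := tP (row_lift v) (row_lift_cocycle Dv); exists c.
case: i => [|i] in t tc tP v Dv cP *.
  apply: funext => k; rewrite !fctE -(row_lift_delta v k); exact: cP.
case: cP => g gP; exists (fun k => g (delta_mx 0 k)); apply: funext => k.
rewrite !fctE -(row_lift_delta v k) gP -[lres_diff _ _ _]/(delta_mx 0 k *m D i).
by rewrite -row_lift_delta_fun row_lift_mulmx row_lift_delta.
Qed.

End DualExact.
End MatrixAction.

Section RestrictedAction.
Variables (A B : comNzRingType) (f : {rmorphism A -> B}).

Lemma mxact_restr (V : lmodType B) a b (D : 'M[A]_(a, b)) (v : 'I_b -> V) :
  @mxact A (restr_scalars f V) a b D v = mxact (map_mx f D) v.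
Proof. by apply: funext => i; apply: eq_bigr => j _; rewrite mxE. Qed.

(** This compares [Ext] over [P] with values in [Q] to [Ext] over [Q]: on restricted scalars a
    matrix acts through its image. *)
Lemma dual_exact_restr (n : nat -> nat) (D : forall i, 'M[A]_(n i.+1, n i))
    (V : lmodType B) i :
  dual_exact D (restr_scalars f V) i <-> dual_exact (fun i => map_mx f (D i)) V i.
Proof.
case: i => [|i]; split=> ex v Dv.
- by apply: ex; rewrite mxact_restr.
- by apply: ex; rewrite -mxact_restr.
- by have [|w ->] := ex v; [rewrite mxact_restr | exists w; rewrite mxact_restr].
- by have [|w ->] := ex v; [rewrite -mxact_restr | exists w; rewrite -mxact_restr].
Qed.

End RestrictedAction.

(** * Base change of matrix resolutions and Tor *)

Section TensorFacts.
Variables (A B : comNzRingType) (f : {rmorphism A -> B}).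

Lemma tensor_ext (M : lmodType B) (N : lmodType A) (X : lmodType B)
    (g h : {linear tensor f M N -> X}) :
  (forall m n, g (pure_tensor f m n) = h (pure_tensor f m n)) -> g =1 h.
Proof.
move=> gh t; rewrite -[t]quotmod_reprK.
pose p := quotmod_pi (gensub (@tensor_rel A B f M N)).
pose g' : {linear {freeg (M * N)%type / B} -> X} := g \o p.
pose h' : {linear {freeg (M * N)%type / B} -> X} := h \o p.
by apply: (@freeg_ext _ _ _ g' h') => -[m n]; exact: gh.
Qed.

Lemma pure_tensor0l (M : lmodType B) (N : lmodType A) n :
  @pure_tensor A B f M N 0 n = 0.
Proof. by rewrite -[X in pure_tensor f X](scale0r (0 : M)) pure_tensorZl scale0r. Qed.

Lemma pure_tensor0r (M : lmodType B) (N : lmodType A) m :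
  @pure_tensor A B f M N m 0 = 0.
Proof.
by rewrite -[X in pure_tensor f _ X](scale0r (0 : N)) pure_tensorZr rmorph0 scale0r
  pure_tensor0l.
Qed.

Lemma pure_tensor_suml (M : lmodType B) (N : lmodType A) (I : finType)
    (m : I -> M) n :
  @pure_tensor A B f M N (\sum_i m i) n = \sum_i pure_tensor f (m i) n.
Proof.
apply: (big_morph (fun m => pure_tensor f m n)); last exact: pure_tensor0l.
by move=> m1 m2; exact: pure_tensorDl.
Qed.

Lemma pure_tensor_sumr (M : lmodType B) (N : lmodType A) (I : finType) m
    (n : I -> N) :
  @pure_tensor A B f M N m (\sum_i n i) = \sum_i pure_tensor f m (n i).
Proof.
apply: (big_morph (fun n => pure_tensor f m n)); last exact: pure_tensor0r.
by move=> n1 n2; exact: pure_tensorDr.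
Qed.

Lemma tensor_map_pure (M : lmodType B) (N N' : lmodType A)
    (g : {linear N -> N'}) m n :
  tensor_map f M g (pure_tensor f m n) = pure_tensor f m (g n).
Proof. exact: tensor_liftE. Qed.

End TensorFacts.

Section TensorRows.
Variables (A B : comNzRingType) (f : {rmorphism A -> B}).

Definition row_tensor n (v : 'rV[B]_n) : tensor f B^o 'rV[A]_n :=
  \sum_k pure_tensor f (v 0 k : B^o) (delta_mx 0 k).

Lemma row_tensor_mulmx a b (D : 'M[A]_(a, b)) (v : 'rV[B]_a) :
  tensor_map f B^o (mx_lin D) (row_tensor v) = row_tensor (v *m map_mx f D).
Proof.
rewrite /row_tensor linear_sum.
under [RHS]eq_bigr do rewrite mxE pure_tensor_suml.
rewrite exchange_big; apply: eq_bigr => k _.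
rewrite [LHS]tensor_map_pure -[mx_lin D _]/(delta_mx 0 k *m D) -rowE [row k D]row_sum_delta pure_tensor_sumr.
by apply: eq_bigr => l _; rewrite pure_tensorZr !mxE mulrC.
Qed.

Section Untensor.
Variable n : nat.

Let h (q : B^o) (x : 'rV[A]_n) : 'rV[B]_n := (q : B) *: map_mx f x.

Lemma untensor_Dl m m' x : h (m + m') x = h m x + h m' x.
Proof. exact: scalerDl. Qed.
Lemma untensor_Dr m x x' : h m (x + x') = h m x + h m x'.
Proof. by rewrite /h map_mxD scalerDr. Qed.
Lemma untensor_Zl b m x : h (b *: m) x = b *: h m x.
Proof. by rewrite /h scalerA. Qed.
Lemma untensor_Zr a m x : h m (a *: x) = h (f a *: m) x.
Proof. by rewrite /h map_mxZ scalerA mulrC. Qed.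

Definition untensor : {linear tensor f B^o 'rV[A]_n -> 'rV[B]_n} :=
  tensor_lift untensor_Dl untensor_Dr untensor_Zl untensor_Zr.

Lemma untensor_pure q x : untensor (pure_tensor f q x) = (q : B) *: map_mx f x.
Proof. exact: tensor_liftE. Qed.

Lemma row_tensorK v : untensor (row_tensor v) = v.
Proof.
rewrite /row_tensor linear_sum [RHS]row_sum_delta; apply: eq_bigr => k _.
by rewrite untensor_pure map_delta_mx.
Qed.

End Untensor.

Lemma untensor_mulmx a b (D : 'M[A]_(a, b)) (t : tensor f B^o 'rV[A]_a) :
  untensor b (tensor_map f B^o (mx_lin D) t) = untensor a t *m map_mx f D.
Proof.
pose g : {linear tensor f B^o 'rV[A]_a -> 'rV[B]_b} :=
  @untensor b \o tensor_map f B^o (mx_lin D).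
pose k : {linear tensor f B^o 'rV[A]_a -> 'rV[B]_b} :=
  mx_lin (map_mx f D) \o @untensor a.
apply: (tensor_ext (g := g) (h := k)) => q x.
rewrite -[LHS]/(untensor b (tensor_map f B^o (mx_lin D) (pure_tensor f q x))).
rewrite -[RHS]/(untensor a (pure_tensor f q x) *m map_mx f D).
by rewrite tensor_map_pure !untensor_pure map_mxM scalemxAl.
Qed.

Variables (n : nat -> nat) (D : forall i, 'M[A]_(n i.+1, n i)).
Variables (M : lmodType A) (aug : {linear 'rV[A]_(n 0) -> M}).
Hypothesis aug_surj : Defs.surjective aug.
Hypothesis aug_ker : row_space (fun v => aug v = 0) (D 0).
Hypothesis Dexact : forall i, mx_exact (D i.+1) (D i).

(** A cycle [v] is carried to the standard resolution, where vanishing of [Tor] bounds it; carrying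
    the bounding element back and correcting by the homotopy [h] bounds [v] itself. *)
Lemma Tor_mx_exact :
  (forall i, (0 < i)%N -> trivial_mod (Tor f i B^o M)) ->
  forall i, mx_exact (map_mx f (D i.+1)) (map_mx f (D i)).
Proof.
move=> TorM i v; split=> [vD|[u ->]]; last first.
  by rewrite -mulmxA -map_mxM (mx_exact0 (@Dexact i)) map_mx0 mulmx0.
pose G := mx_resolution aug_surj aug_ker Dexact.
have [a [b [h [ca cb h0 hS]]]] := comparison (F := std_resolution M) (G := G)
  (@std_projective _ M) (@mx_resolution_projective A n D M aug aug_surj aug_ker Dexact).
pose T (X Y : lmodType A) (g : {linear X -> Y}) := tensor_map f B^o g.
(* Commutative squares stay commutative after tensoring, as seen on pure tensors. *)
have Tcomp (X Y Z W : lmodType A) (g1 : {linear Y -> Z}) (g2 : {linear X -> Y})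
    (k1 : {linear W -> Z}) (k2 : {linear X -> W}) :
    (forall x, g1 (g2 x) = k1 (k2 x)) -> forall t, T _ _ g1 (T _ _ g2 t) = T _ _ k1 (T _ _ k2 t).
  move=> E; apply: (tensor_ext (g := T _ _ g1 \o T _ _ g2) (h := T _ _ k1 \o T _ _ k2)).
  move=> m x; rewrite -[LHS]/(T _ _ g1 (T _ _ g2 (pure_tensor f m x))).
  rewrite -[RHS]/(T _ _ k1 (T _ _ k2 (pure_tensor f m x))).
  by rewrite /T !tensor_map_pure E.
pose t : tensor f B^o (G i.+1) := row_tensor v.
have dt : T _ _ (lres_diff G i) t = 0.
  rewrite /T /t [LHS]row_tensor_mulmx vD /row_tensor big1 // => k _.
  by rewrite mxE; exact: pure_tensor0l.
have /homology_trivial/(_ (T _ _ (b i.+1) t))[] := TorM i.+1 isT.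
  rewrite -[LHS]/(T _ _ (lres_diff (std_resolution M) i) (T _ _ (b i.+1) t)).
  by rewrite (Tcomp _ _ _ _ _ _ (b i) (lres_diff G i)) ?dt ?linear0 //; exact: cb.2.
move=> s sE.
have tE : T _ _ (a i.+1) (T _ _ (b i.+1) t) =
    t + T _ _ (lres_diff G i.+1) (T _ _ (h i.+1) t) + T _ _ (h i) (T _ _ (lres_diff G i) t).
  apply: (tensor_ext (g := T _ _ (a i.+1) \o T _ _ (b i.+1))
    (h := (idfun \+ (T _ _ (lres_diff G i.+1) \o T _ _ (h i.+1)))
       \+ (T _ _ (h i) \o T _ _ (lres_diff G i)))) => m x.
  rewrite -[LHS]/(T _ _ (a i.+1) (T _ _ (b i.+1) (pure_tensor f m x))).
  rewrite -[RHS]/(pure_tensor f m x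
    + T _ _ (lres_diff G i.+1) (T _ _ (h i.+1) (pure_tensor f m x))
    + T _ _ (h i) (T _ _ (lres_diff G i) (pure_tensor f m x))).
  by rewrite /T !tensor_map_pure hS !pure_tensorDr.
have /eqP := tE; rewrite dt linear0 addr0 -subr_eq -sE => /eqP/esym.
rewrite -[tensor_map _ _ _ s]/(T _ _ (lres_diff (std_resolution M) i.+1) s).
rewrite (Tcomp _ _ _ _ _ _ (lres_diff G i.+1) (a i.+2)); last first.
  by move=> x; rewrite ca.2.
rewrite -linearB => tE'.
exists (untensor _ (T _ _ (a i.+2) s - T _ _ (h i.+1) t)).
have tK : untensor (n i.+1) t = v by rewrite /t row_tensorK.
rewrite -tK.
by rewrite [in LHS]tE' [LHS](untensor_mulmx (D i.+1)).
Qed.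

End TensorRows.

Lemma least_some (P : nat -> Prop) n :
  least P = Some n -> P n /\ forall i, P i -> (n <= i)%N.
Proof.
rewrite /least; case: pselect => // exP [<-].
case: ex_minnP => k /asboolP Pk kmin; split=> // i Pi.
by apply: kmin; apply/asboolP.
Qed.

Lemma least_exists (P : nat -> Prop) i :
  P i -> exists2 n, least P = Some n & (n <= i)%N.
Proof.
move=> Pi; rewrite /least; case: pselect => [exP|[]].
  by exists (ex_minn exP) => //; case: ex_minnP => k _; apply; apply/asboolP.
by exists i; apply/asboolP.
Qed.

(** The form in which the grade hypothesis is applied: with [P] and [Q] the nonvanishing of [Ext]
    into the rings [Q] and [P] respectively, vanishing below [g] passes from the former to the
    latter. *)
Lemma enat_le_least (P Q : nat -> Prop) g :
  enat_le (least P) (least Q) ->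
  (forall i, (i < g)%N -> ~ P i) -> forall i, (i < g)%N -> ~ Q i.
Proof.
move=> le_PQ nP i ig /least_exists[k Qk ki]; move: le_PQ; rewrite Qk /=.
case EP: (least P) => [l|] // lk; have [Pl _] := least_some EP.
exact: (nP l (leq_ltn_trans (leq_trans lk ki) ig)).
Qed.

(** * Length and last rank of a minimal resolution *)

Section MinimalComplex.
Variable A : comNzRingType.
Variables (n : nat -> nat) (D : forall i, 'M[A]_(n i.+1, n i)).

Lemma dual_exact_cols i p (N : 'M[A]_(n i, p)) :
  dual_exact D A^o i -> D i *m N = 0 ->
  match i return 'M[A]_(n i, p) -> Prop with
  | 0%N => fun N => N = 0
  | j.+1 => fun N => exists W, N = D j *m W
  end N.
Proof.
move=> ex DN.
have DNk k : mxact (D i) (fun l => N l k : A^o) = 0.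
  apply: funext => l; have /matrixP/(_ l k) := DN.
  by rewrite !mxE => E; rewrite /mxact; exact: E.
case: i => [|i] in N ex DN DNk *.
  by apply/matrixP => l k; rewrite mxE; have /(congr1 (@^~ l)) := ex _ (DNk k).
have [w wP] := choice (fun k => ex _ (DNk k)).
exists (\matrix_(j, k) w k j); apply/matrixP => l k; rewrite !mxE.
have /(congr1 (@^~ l)) := wP k; rewrite /mxact => ->.
by apply: eq_bigr => j _; rewrite mxE.
Qed.

(* A null-homotopy of the multiplication by [c] is built downwards, from degree
   [i.+1] to degree [0], using exactness of the dual complex. *)
Lemma null_homotopic_down c i (s : 'M[A]_(n i.+1, n i.+2)) (s' : 'M_(n i, n i.+1)) :
  (forall j, (j <= i)%N -> dual_exact D A^o j) ->
  (forall i, D i.+1 *m D i = 0) ->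
  c%:M = s *m D i.+1 + D i *m s' -> exists t : 'M_(n 0, n 1), c%:M = t *m D 0.
Proof.
move=> ex DD; elim: i => [|i IHi] in s s' ex *; move=> cE.
  exists s'; apply/eqP; rewrite -subr_eq0; apply/eqP.
  apply: (dual_exact_cols (ex 0%N isT)).
  rewrite mulmxBr scalar_mxC cE mulmxDl -mulmxA DD mulmx0 add0r.
  by rewrite mulmxA subrr.
have [] := dual_exact_cols (N := c%:M - s' *m D i.+1) (ex i.+1 (leqnn _)).
  rewrite mulmxBr scalar_mxC cE mulmxDl -mulmxA DD mulmx0 add0r.
  by rewrite mulmxA subrr.
move=> w wE; apply: (IHi s' w) => [j ji|]; first exact/ex/leqW.
by rewrite -wE addrC subrK.
Qed.

Variables (M : lmodType A) (aug : {linear 'rV[A]_(n 0) -> M}).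
Hypothesis aug_surj : Defs.surjective aug.
Hypothesis aug_ker : row_space (fun v => aug v = 0) (D 0).
Hypothesis Dexact : forall i, mx_exact (D i.+1) (D i).
Variable m : A -> Prop.
Hypotheses (msub : is_submodule (m : A^o -> Prop)) (m1 : ~ m 1).
Hypothesis Dm : forall i j k, m (D i j k).

Lemma is_idealM (x y : A) : m x -> m (y * x).
Proof. exact: (@is_submoduleZ A A^o m y x msub). Qed.

Lemma is_ideal_sum (I : finType) (F : I -> A) : (forall i, m (F i)) -> m (\sum_i F i).
Proof. exact: (@is_submodule_sum A A^o m I F msub). Qed.

(** Beyond [g] the identity of the minimal resolution factors, up to homotopy, through the zero
    module [F i]. So the identity matrix is minus the homotopy terms, whose entries lie in [m]
    because those of [D] do. *)
Lemma minimal_length g : proj_dim_le M g -> forall i, (g < i)%N -> n i = 0%N.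
Proof.
case=> F [projF vanF] i; pose G := mx_resolution aug_surj aug_ker Dexact.
have [a [b [h [ca cb h0 hS]]]] := comparison (F := F) (G := G) projF
  (@mx_resolution_projective A n D M aug aug_surj aug_ker Dexact).
case: i => [|i] // gi; apply/eqP; rewrite -leqn0 leqNgt; apply/negP => n_gt0.
pose k := Ordinal n_gt0; pose x : 'rV[A]_(n i.+1) := delta_mx 0 k.
have := hS i x; rewrite (vanF i.+1 gi (b i.+1 x)) linear0.
rewrite -[lres_diff G i.+1 _]/((h i.+1 x : 'rV_(n i.+2)) *m D i.+1).
rewrite -[lres_diff G i x]/(x *m D i) /x -rowE [row k _]row_sum_delta.
rewrite (linear_sum (h i)).
move=> /rowP/(_ k); rewrite !mxE !eqxx /= -addrA => /eqP.
rewrite eq_sym addr_eq0 => /eqP E; apply: m1; have E1 : (1 : A) = _ := E; rewrite E1 -mulN1r.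
apply/is_idealM/(@is_submoduleD A A^o m) => //.
  by apply: is_ideal_sum => j; apply: is_idealM.
rewrite summxE; apply: is_ideal_sum => j.
by rewrite linearZ /= !mxE mulrC; apply: is_idealM.
Qed.

(** Coboundaries vanish modulo [m], so [u] would span the whole space of rank [n g] over the residue
    field. *)
Lemma cyclic_cokernel_rank g (u : 'I_(n g) -> A^o) :
  (forall v : 'I_(n g) -> A^o, exists c : A,
      match g return ('I_(n g) -> A^o) -> Prop with
      | 0%N => fun v => v = 0
      | j.+1 => fun v => exists w, v = mxact (D j) w
      end (v - c *: u)) ->
  (n g <= 1)%N.
Proof.
move=> cyc; rewrite leqNgt; apply/negP => n_gt1.
have approx (v : 'I_(n g) -> A^o) : exists c : A, forall i, m (v i - c * u i).
  have [c cP] := cyc v; exists c => i; case: g => [|g] in u cyc n_gt1 v i cP *.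
    have /(congr1 (@^~ i)) := cP; rewrite !fctE => ->; by case: msub.
  have [w /(congr1 (@^~ i))] := cP; rewrite !fctE => ->.
  by apply: is_ideal_sum => j; rewrite -[_ *: _]/(D g i j * w j) mulrC; apply: is_idealM.
pose i0 := Ordinal (ltnW n_gt1); pose i1 := Ordinal n_gt1.
have [a aP] := approx (fun i => (i == i0)%:R).
have [b bP] := approx (fun i => (i == i1)%:R).
have := aP i0; have := aP i1; have := bP i0; have := bP i1.
rewrite !eqxx /= !sub0r => b1 b0 a1 a0; apply: m1.
set x := u i0 in a0 b0; set y := u i1 in a1 b1.
(* Modulo [m], [a * x] and [b * y] are 1 while [a * y] and [b * x] are 0; each summand displays one
   factor lying in [m]. *)
have -> : 1 = (1 - a * x) + (a * x) * (1 - b * y) + (- (b * x)) * (- (a * y)) :> A.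
  rewrite mulrBr mulr1 addrA subrK mulrNN.
  by rewrite [b * x * _]mulrACA [b * a]mulrC mulrACA subrK.
apply: (@is_submoduleD A A^o m _ _ msub); last exact: is_idealM.
by apply: (@is_submoduleD A A^o m _ _ msub) => //; apply: is_idealM.
Qed.

End MinimalComplex.

(** * Local rings and the lifting [P / I] *)

Section LocalRings.
Variable A : comNzRingType.
Implicit Types (x y : A).

Lemma maximal_ideal_exists x :
  ~ (exists y, x * y = 1) -> exists2 I : submodClosed A^o, maximal_ideal I & x \in I.
Proof.
move=> xnu.
pose prop (X : A^o -> Prop) := [/\ is_submodule X, X x & ~ X 1].
(* The empty set is adjoined to the proper ideals containing [x] because the union of the empty
   chain is empty. It is not maximal, as the principal ideal of [x] contains it strictly. *)
pose none : A^o -> Prop := fun=> False.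
have [F Fprop Ftot|M [[M0|[HM Mx M1]] Mmax]] :=
    @classical_sets.Zorn_bigcup A^o (fun X => X = none \/ prop X).
- have [[X FX [HX Xx X1]]|noX] := pselect (exists2 X, F X & prop X); last first.
    left; apply: funext => t; apply: propext; split=> // -[X FX Xt].
    by case: (Fprop X FX) => [X0|pX]; [rewrite X0 in Xt | apply: noX; exists X].
  have Fsub Y t : F Y -> Y t -> prop Y.
    by move=> FY Yt; case: (Fprop Y FY) => // Y0; rewrite Y0 in Yt.
  right; split; first split; first by exists X => //; case: HX.
  + move=> a u v [U FU Uu] [V FV Vv].
    have [[_ HU] _ _] := Fsub U u FU Uu; have [[_ HV] _ _] := Fsub V v FV Vv.
    by have [UV|VU] := Ftot U V FU FV; [exists V => // | exists U => //];
      [apply: HV => //; exact: UV | apply: HU => //; exact: VU].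
  + by exists X.
  by move=> [Y FY Y1]; have [_ _] := Fsub Y 1 FY Y1; apply.
- case: (Mmax (fun t => exists y, t = x * y)).
    rewrite M0; split=> [t []|E].
    by apply: (E x); exists 1; rewrite mulr1.
  right; split; [split| |].
  + by exists 0; rewrite mulr0.
  + move=> a _ _ [y ->] [z ->]; exists (a * y + z).
    by rewrite mulrDr mulrCA.
  + by exists 1; rewrite mulr1.
  + by move=> [y /esym xy]; apply: xnu; exists y.
exists (submod_of HM); last by apply/asboolP.
split=> [|J MJ J1 t tJ]; first by apply/negP => /submod_ofP.
apply/submod_ofP; apply: contrapT => nMt; apply: (Mmax (fun t => t \in J)).
  by split=> [u Mu|E]; [apply: MJ; exact/submod_ofP | exact/nMt/E].
right; split; first exact: is_submodule_mem.
  by apply: MJ; exact/submod_ofP.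
exact/negP.
Qed.

Lemma max_ideal_submodule : is_submodule (fun x : A^o => x \in max_ideal A).
Proof. exact: is_submodule_mem. Qed.

Lemma local_max_ideal1 : local_ring A -> (1 : A) \notin max_ideal A.
Proof.
case=> I Imax _; apply/negP => /asboolP /(_ I Imax).
by case: Imax => /negP.
Qed.

Lemma local_ring_at : local_ring A -> local_at (fun x => x \in max_ideal A).
Proof.
move=> locA; split; first exact: max_ideal_submodule.
  exact/negP/local_max_ideal1.
move=> x xm; apply: contrapT => /maximal_ideal_exists[I Imax xI]; apply: xm.
by rewrite (local_max_ideal locA Imax).
Qed.

End LocalRings.

(** The preimage of a maximal ideal [K] is maximal: an ideal [J] above it contains the kernel, so if
    [J] is proper then so is its image, which therefore lies in [K]. *)
Lemma surj_local_hom (A B : comNzRingType) (f : {rmorphism A -> B}) :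
  Defs.surjective f -> local_hom f.
Proof.
move=> fsurj x /asboolP xm; apply/asboolP => K [K1 Kmax].
have HI : is_submodule (fun a : A^o => (f a : B^o) \in K).
  split=> [|a u v uK vK]; first by rewrite rmorph0 rpred0.
  rewrite rmorphD rmorphM rpredD // .
  exact: (rpredZ (f a : B) uK).
have /xm /submod_ofP // : maximal_ideal (submod_of HI).
split=> [|J IJ J1 a aJ]; first by apply/negP => /submod_ofP; rewrite rmorph1 (negbTE K1).
have HfJ : is_submodule (fun b : B^o => exists2 u, u \in J & f u = b).
  split=> [|b _ _ [u uJ <-] [v vJ <-]]; first by exists 0; rewrite ?rpred0 ?rmorph0.
  have [c <-] := fsurj b; exists (c *: u + v); first by rewrite rpredD ?rpredZ.
  by rewrite rmorphD rmorphM.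
apply/submod_ofP; apply: (Kmax (submod_of HfJ)) => [b bK||].
- apply/submod_ofP; have [c cb] := fsurj b; exists c => //; apply: IJ.
  by apply/submod_ofP; rewrite cb.
- apply/negP => /submod_ofP[u uJ fu1]; case/negP: J1.
  rewrite -[1](subrK u) addrC; apply: rpredD => //; apply: IJ; apply/submod_ofP.
  by rewrite rmorphB fu1 rmorph1 subrr rpred0.
by apply/submod_ofP; exists a.
Qed.

Section IdealAugmentation.
Variables (A : comNzRingType) (I : submodClosed A^o).

Lemma ideal_aug_linear : linear (fun v : 'rV[A]_1 => quotmod_pi I (v 0 0 : A^o)).
Proof. by move=> a u v; rewrite !mxE -linearP. Qed.

Definition ideal_aug : {linear 'rV[A]_1 -> quotmod I} := lin_of ideal_aug_linear.

Lemma ideal_aug_surj : Defs.surjective ideal_aug.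
Proof.
move=> q; exists (\row_i (repr q : A)); rewrite /ideal_aug /= mxE.
exact: quotmod_reprK.
Qed.

Lemma ideal_aug_eq0 v : ideal_aug v = 0 <-> (v 0 0 : A^o) \in I.
Proof. exact: quotmod_eq0. Qed.

End IdealAugmentation.

Lemma Ext_mx_exact (A : comNzRingType) (n : nat -> nat)
    (D : forall i, 'M[A]_(n i.+1, n i)) (M V : lmodType A)
    (aug : {linear 'rV[A]_(n 0) -> M}) (aug_surj : Defs.surjective aug)
    (aug_ker : row_space (fun v => aug v = 0) (D 0))
    (Dexact : forall i, mx_exact (D i.+1) (D i)) i :
  trivial_mod (Ext i M V) <-> dual_exact D V i.
Proof.
rewrite Ext_trivial -(hom_exact_mx aug_surj aug_ker Dexact).
split; apply: hom_exact_transfer; try exact: std_projective;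
  exact: mx_resolution_projective.
Qed.

(** * The kernel of [phi] is the extension of [I] along [psi] *)

Section Lifting.
Variables (P Q R : comNzRingType) (phi : {rmorphism Q -> R}) (psi : {rmorphism P -> Q}).
Variables (I : submodClosed P^o).
Hypothesis liftS : lifting psi (restr_scalars phi R^o) (quotmod I).

(** The isomorphism of [R] with the tensor product need not respect the units, so the argument goes
    through annihilators: [psi i] kills every pure tensor, hence it kills 1 in [R]. *)
Lemma lifting_ideal (i : P) : (i : P^o) \in I -> phi (psi i) = 0.
Proof.
move=> iI; have [_ [f [g fK gK]] _] := liftS.
have kill (t : tensor psi Q^o (quotmod I)) : psi i *: t = 0.
  pose s : {linear tensor psi Q^o (quotmod I) -> tensor psi Q^o (quotmod I)} :=
    psi i \*: idfun.
  apply: (tensor_ext (g := s) (h := \0)) => q x.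
  rewrite -[LHS]/(psi i *: pure_tensor psi q x) -pure_tensorZl -pure_tensorZr.
  have -> : i *: x = 0; last exact: pure_tensor0r.
  rewrite -[x]quotmod_reprK -linearZ; apply/quotmod_eq0.
  by rewrite -[_ *: _]/(i * (repr x : P)) mulrC; exact: (rpredZ (repr x : P) iI).
have : psi i *: (1 : restr_scalars phi R^o) = 0.
  by apply: (can_inj fK); rewrite linearZ linear0; exact: kill.
by rewrite -[_ *: _]/(phi (psi i) * 1) mulr1.
Qed.

(** If [phi q = 0], then [q] kills the tensor product, so the pure tensor of [q] and the class of 1
    is zero. Its image under the multiplication map to [Q] modulo [W], the extension of [I], is the
    class of [q]. *)
Lemma lifting_kernel c (D : 'M[P]_(c, 1)) :
  row_space (fun v => (v 0 0 : P^o) \in I) D ->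
  forall q, phi q = 0 <-> exists u : 'rV_c, q = (u *m map_mx psi D) 0 0.
Proof.
move=> DI q; split=> [phiq|[u ->]]; last first.
  rewrite mxE rmorph_sum big1 // => k _; rewrite mxE rmorphM lifting_ideal ?mulr0 //.
  have -> : D k 0 = row k D 0 0 by rewrite mxE.
  by apply/DI; exists (delta_mx 0 k); rewrite rowE.
have HW : is_submodule (fun q : Q^o => exists u : 'rV_c, q = (u *m map_mx psi D) 0 0).
  split=> [|x _ _ [u ->] [v ->]]; first by exists 0; rewrite mul0mx mxE.
  by exists (x *: u + v); rewrite mulmxDl -scalemxAl !mxE.
pose W := submod_of HW.
have gL (x : Q) : linear (fun p : P^o =>
    quotmod_pi W (psi p * x) : restr_scalars psi (quotmod W)).
  move=> a u v; rewrite rmorphD rmorphM mulrDl -mulrA.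
  rewrite -[_ *: (_ : restr_scalars _ _)]/(psi a *: quotmod_pi W (psi u * x)).
  by rewrite -linearP.
have gI (x : Q) (p : P^o) : p \in I -> lin_of (gL x) p = 0.
  move=> pI; apply/(quotmod_eq0 W (psi p * x))/submod_ofP.
  have /DI[u uE] : (const_mx p : 'rV_1) 0 0 \in I by rewrite mxE.
  exists (x *: map_mx psi u).
  by rewrite -scalemxAl -map_mxM -uE !mxE mulrC.
pose h (x : Q^o) (p : quotmod I) : quotmod W := quotmod_lift (gI x) p.
have hE x (p : P) : h x (quotmod_pi I p) = quotmod_pi W (psi p * x).
  exact: (quotmod_liftE (gI x)).
have hDl m m' p : h (m + m') p = h m p + h m' p.
  by rewrite -[p]quotmod_reprK !hE mulrDr linearD.
have hDr m p p' : h m (p + p') = h m p + h m p'.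
  rewrite -[p]quotmod_reprK -[p']quotmod_reprK -linearD !hE.
  by rewrite rmorphD mulrDl linearD.
have hZl b m p : h (b *: m) p = b *: h m p.
  by rewrite -[p]quotmod_reprK !hE -linearZ; congr quotmod_pi; exact: mulrCA.
have hZr a m p : h m (a *: p) = h (psi a *: m) p.
  rewrite -[p]quotmod_reprK -linearZ !hE rmorphM; congr quotmod_pi.
  by rewrite -[_ *: m]/(psi a * m) mulrCA mulrA.
have [_ [f [g fK gK]] _] := liftS.
have t0 : pure_tensor psi (q : Q^o) (quotmod_pi I 1) = 0.
  have -> : (q : Q^o) = q *: (1 : Q^o) by rewrite -[RHS]/(q * 1) mulr1.
  rewrite pure_tensorZl -[X in _ *: X]gK -linearZ.
  have -> : q *: g (pure_tensor psi (1 : Q^o) (quotmod_pi I 1)) = 0.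
    by rewrite -[LHS]/(phi q * _) phiq mul0r.
  exact: linear0.
have := congr1 (tensor_lift hDl hDr hZl hZr) t0.
rewrite tensor_liftE linear0 hE rmorph1 mul1r.
by move=> /quotmod_eq0/submod_ofP.
Qed.

End Lifting.

(* [D] is the minimal resolution of [P / I]; its base change to [Q] is the minimal
   resolution of [Q / rker phi], whose length and whose dual are those of a
   Gorenstein quotient.  The grade hypothesis carries the exactness of the dual
   back to [P]. *)
Lemma gorenstein_resolution (P Q R : comNzRingType) (phi : {rmorphism Q -> R})
    (psi : {rmorphism P -> Q}) (I : submodClosed P^o) :
  noeth_local P -> local_ring Q -> gorenstein_ideal (rker phi) ->
  local_hom psi -> lifting psi (restr_scalars phi R^o) (quotmod I) ->
  (exists2 x : P^o, x \in I & x != 0) -> {subset I <= max_ideal P} ->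
  enat_le (grade (quotmod I) (restr_scalars psi Q^o)) (grade (quotmod I) P^o) ->
  exists a r (D : forall i, 'M[P]_(ranks a 1 r i.+1, ranks a 1 r i)) g,
  [/\ row_space (fun v => (v 0 0 : P^o) \in I) (D 0),
      forall i, mx_exact (D i.+1) (D i),
      forall i, mx_exact (map_mx psi (D i.+1)) (map_mx psi (D i)),
      forall i, (i <= g)%N -> dual_exact D P^o i &
      ranks a 1 r g.+1 = 1%N /\ forall i, (g.+1 < i)%N -> ranks a 1 r i = 0%N].
Proof.
move=> [noethP locP] locQ [[_ pdgr] [g pdg [e [e' eK e'K]]]] psiloc liftS I_neq0 Im grle.
have locmP := local_ring_at locP.
have noethP' := noetherian_rows noethP.
have HI : is_submodule (fun v : 'rV[P]_1 => (v 0 0 : P^o) \in I).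
  split=> [|x u v uI vI]; first by rewrite mxE rpred0.
  rewrite !mxE rpredD //; exact: (rpredZ x uI).
have [a [D0 [D0I D0min]]] := minimal_generators noethP' locmP HI.
have [r [D [DE Dex Dmin]]] := minimal_resolution D0 noethP' locmP.
have {D0I}DI : row_space (fun v => (v 0 0 : P^o) \in I) (D 0) by rewrite DE.
have {}D0min : minimal_rows (fun x => x \in max_ideal P) (D 0).
  by rewrite DE.
set n := ranks a 1 r in D DE Dex Dmin DI D0min *.
have Dm i j k : D i j k \in max_ideal P.
  case: i => [|i] in j k *.
    have -> : D 0%N j k = row j (D 0) 0 0.
      by rewrite !mxE; congr (D _ _ _); apply/val_inj; case: k => -[].
    by apply: Im; apply/DI; exists (delta_mx 0 j); rewrite rowE.
  have : row j (D i.+1) *m D i = 0 by apply/Dex; exists (delta_mx 0 j); rewrite rowE.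
  case: i => [|i] in j k *.
    by move=> /D0min /(_ k); rewrite mxE.
  by move=> /Dmin /(_ k); rewrite mxE.
have DQm i j k : map_mx psi (D i) j k \in max_ideal Q by rewrite mxE; apply: psiloc.
have augPker : row_space (fun v => ideal_aug I v = 0) (D 0).
  by move=> v; rewrite ideal_aug_eq0; exact: DI.
have augPsurj := @ideal_aug_surj _ I.
have TorS : forall i, (0 < i)%N -> trivial_mod (Tor psi i Q^o (quotmod I)) by case: liftS.
have DexQ := Tor_mx_exact augPsurj augPker Dex TorS.
pose J := rker phi.
have augQker : row_space (fun v => ideal_aug J v = 0) (map_mx psi (D 0)).
  move=> v; rewrite ideal_aug_eq0.
  have -> : (v 0 0 \in (J : submodClosed Q^o)) <-> phi (v 0 0) = 0.
    by split=> /eqP.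
  rewrite (lifting_kernel liftS DI); split=> -[u uE]; exists u.
    by apply/rowP => i; rewrite ord1 uE.
  by rewrite uE.
have augQsurj := @ideal_aug_surj _ J.
have [pdle _] := least_some pdg.
have [|/= _ grmin] := @least_some _ g (esym _ : grade (quotmod J) Q^o = Some g).
  by rewrite -pdgr pdg.
have m1Q : ~ ((1 : Q) \in max_ideal Q) by apply/negP/local_max_ideal1.
have submQ := @max_ideal_submodule Q.
have n_gt := minimal_length augQsurj augQker DexQ submQ m1Q DQm pdle.
have ExtQ i : (i < g)%N -> dual_exact (fun i => map_mx psi (D i)) Q^o i.
  move=> ig; apply/(Ext_mx_exact _ augQsurj augQker DexQ).
  apply: contrapT => /grmin; by rewrite leqNgt ig.
have ExtP i : (i < g)%N -> dual_exact D P^o i.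
  move=> ig; apply/(Ext_mx_exact _ augPsurj augPker Dex).
  apply: contrapT; apply: (enat_le_least grle) ig => j jg; apply.
  by apply/(Ext_mx_exact _ augPsurj augPker Dex)/dual_exact_restr/ExtQ.
(* The Gorenstein isomorphism makes the top [Ext] cyclic, which will bound the last rank by 1. *)
have ExtQcyc (z : Ext g (quotmod J) Q^o) :
    exists c : Q, z = c *: e' (quotmod_pi J (1 : Q^o)).
  exists (repr (e z)); apply: (can_inj eK).
  rewrite linearZ e'K -linearZ -[LHS]quotmod_reprK; congr quotmod_pi.
  by rewrite -[RHS]/(_ * 1) mulr1.
have [t tc tP] := Ext_cyclic ExtQcyc.
have [t' t'c t'P] := hom_cyclic_transfer (@std_projective _ _)
  (@mx_resolution_projective _ _ _ _ _ augQsurj augQker DexQ) tc tP.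
have [u uc uP] := hom_cyclic_mx t'c t'P.
have ng : (n g <= 1)%N.
  apply: (cyclic_cokernel_rank submQ m1Q DQm (u := u)) => v; apply: uP.
  by apply: funext => -[k kn]; exfalso; move: kn; rewrite (n_gt g.+1 (ltnSn g)).
clear ExtQcyc tc tP t'c t'P uc uP t t' u.
(* In length 0 the matrix [D 0] would have no rows, forcing [I] to be zero. From here on the
   projective dimension is [g.+1]. *)
case: g => [|g] in pdg e e' eK e'K pdle grmin n_gt ExtQ ExtP ng *.
  have [x xI /eqP[]] := I_neq0.
  have /DI[w wE] : (const_mx x : 'rV_1) 0 0 \in I by rewrite mxE.
  have := congr1 (fun v : 'rV_1 => v 0 0) wE; rewrite !mxE => ->; apply: big1 => k _.
  by exfalso; case: k => k; rewrite (n_gt 1%N isT).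
exists a, r, D, g; split=> //; split=> //.
apply/eqP; rewrite eqn_leq ng lt0n; apply/eqP => ng0; have {}ng0 : n g.+1 = 0%N := ng0.
(* If the last module were zero, multiplication by 1 on it would vanish; descending to degree 0
   would then put 1 in [I]. *)
have [|||v vE] := @null_homotopic_down P n D 1 g 0 0.
- by move=> j jg; apply: ExtP.
- by move=> i; exact: mx_exact0.
- by apply/matrixP => -[k kn]; exfalso; have : (k < n g.+1)%N := kn; rewrite ng0.
case: (locmP) => _ []; apply: Im.
have -> : (1 : P) = (row 0 (1%:M : 'M_1)) 0 0 by rewrite !mxE.
by rewrite vE; apply/DI; exists (row 0 v); rewrite row_mul.
Qed.

(** * Injective and flat modules over a quotient *)

Section ModKernel.
Variables (A B : comNzRingType) (p : {rmorphism A -> B}).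
Hypothesis p_surj : Defs.surjective p.

(** The tuples in [Hom_A(B, V)], viewed inside [V]; single elements are tuples indexed by [unit]. *)
Definition killed (V : lmodType A) (T : Type) (v : T -> V) :=
  forall k, p k = 0 -> forall i, k *: v i = 0.

Lemma mx_lift a b (D : 'M[B]_(a, b)) : exists D', map_mx p D' = D.
Proof.
have [f fP] := choice (fun ij : 'I_a * 'I_b => p_surj (D ij.1 ij.2)).
by exists (\matrix_(i, j) f (i, j)); apply/matrixP => i j; rewrite !mxE (fP (i, j)).
Qed.

Lemma mx_exact_mod a b c (M' : 'M[A]_(a, b)) (M : 'M[A]_(b, c)) (x : 'rV[A]_b) :
  mx_exact (map_mx p M') (map_mx p M) ->
  (forall j, p ((x *m M) 0 j) = 0) ->
  exists y : 'rV_a, forall i, p ((x - y *m M') 0 i) = 0.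
Proof.
move=> ex xM.
have /ex[u uE] : map_mx p x *m map_mx p M = 0.
  by rewrite -map_mxM; apply/rowP => j; rewrite !mxE; have := xM j; rewrite mxE.
have [y yE] := mx_lift u; exists y => i; rewrite !mxE rmorphB.
have := congr1 (fun v : 'rV_b => v 0 i) uE; rewrite -yE -map_mxM !mxE => ->.
by rewrite subrr.
Qed.

Lemma is_submodule_row_mod n :
  is_submodule (fun x : 'rV[A]_n => forall j, p (x 0 j) = 0).
Proof.
split=> [j|a u v uK vK j]; first by rewrite mxE rmorph0.
by rewrite !mxE rmorphD rmorphM uK vK mulr0 addr0.
Qed.

(** For surjective [p] this is [B^n] as an [A]-module. *)
Definition row_mod n := quotmod (submod_of (is_submodule_row_mod n)).

Definition row_mod_pi n : {linear 'rV[A]_n -> row_mod n} :=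
  quotmod_pi (submod_of (is_submodule_row_mod n)).

Lemma row_mod_pi0 n (x : 'rV_n) : row_mod_pi n x = 0 <-> forall j, p (x 0 j) = 0.
Proof. by rewrite quotmod_eq0; split=> [/submod_ofP|?] //; apply/submod_ofP. Qed.

Lemma row_mod_pi_killed n (x : 'rV_n) k : p k = 0 -> k *: row_mod_pi n x = 0.
Proof.
by move=> pk; rewrite -linearZ; apply/row_mod_pi0 => j; rewrite mxE rmorphM pk mul0r.
Qed.

Section Factor.
Variables (b c : nat) (M : 'M[A]_(b, c)).

Definition mod_lin : {linear 'rV[A]_b -> row_mod c} := row_mod_pi c \o mx_lin M.

(** The image of [M] over [B], in coimage form; its embedding in [row_mod c] is the injection to
    which injectivity and flatness are applied. *)
Definition mod_coimage := quotmod (Defs.lker mod_lin).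

Lemma mod_coimage_ker x : x \in Defs.lker mod_lin -> mod_lin x = 0.
Proof. by move/eqP. Qed.

Definition mod_coimage_emb : {linear mod_coimage -> row_mod c} :=
  quotmod_lift mod_coimage_ker.

Lemma mod_coimage_emb_pi x :
  mod_coimage_emb (quotmod_pi (Defs.lker mod_lin) x) = row_mod_pi c (x *m M).
Proof. exact: (quotmod_liftE mod_coimage_ker). Qed.

Lemma mod_coimage_emb_inj : injective mod_coimage_emb.
Proof.
move=> x y; rewrite -[x]quotmod_reprK -[y]quotmod_reprK.
rewrite [LHS](quotmod_liftE mod_coimage_ker) [RHS](quotmod_liftE mod_coimage_ker).
move=> E; have E0 : mod_lin (repr x - repr y) = 0 by rewrite linearB E subrr.
exact/quotmod_piE/eqP.
Qed.

End Factor.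

(** A killed tuple [v] is a map on [B^b]. By exactness it vanishes on the kernel of [M], so it
    factors through the image of [M] and extends to [B^c] by injectivity of [E]. *)
Lemma injective_mx (E : lmodType A) a b c (M' : 'M[A]_(a, b)) (M : 'M[A]_(b, c))
    (v : 'I_b -> E) :
  injective_mod E -> mx_exact (map_mx p M') (map_mx p M) ->
  killed v -> mxact M' v = 0 ->
  exists2 w : 'I_c -> E, killed w & v = mxact M w.
Proof.
move=> injE ex vK Mv.
have vker x : x \in Defs.lker (mod_lin M) -> row_lift v x = 0.
  move=> /eqP/row_mod_pi0 xM; have [y yE] := mx_exact_mod ex xM.
  rewrite -[x](subrK (y *m M')) linearD row_lift_mulmx Mv.
  rewrite -[LHS]/(row_lift v (x - y *m M') + \sum_j y 0 j *: 0).
  rewrite [X in _ + X]big1 ?addr0 => [|j _]; last by rewrite scaler0.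
  by apply: big1 => j _; apply: vK.
have [g gP] := injE _ _ (mod_coimage_emb M) (quotmod_lift vker) (@mod_coimage_emb_inj _ _ M).
exists (fun j => g (row_mod_pi c (delta_mx 0 j))).
  by move=> k pk j; rewrite -linearZ row_mod_pi_killed ?linear0.
apply: funext => i; rewrite -(row_lift_delta v i).
rewrite -[LHS](quotmod_liftE vker) -gP.
rewrite mod_coimage_emb_pi -rowE [row i M]row_sum_delta.
rewrite !linear_sum; apply: eq_bigr => j _.
by rewrite !linearZ mxE.
Qed.

Definition killsub (L : lmodType A) : submodClosed L :=
  gensub (fun x : L => exists k l, p k = 0 /\ x = k *: l).

Lemma killsub_mem (L : lmodType A) k (l : L) : p k = 0 -> k *: l \in killsub L.
Proof. by move=> pk; apply: gensub_mem; exists k, l. Qed.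

Lemma killsub_ind (L : lmodType A) (U : L -> Prop) :
  is_submodule U -> (forall k l, p k = 0 -> U (k *: l)) ->
  forall x, x \in killsub L -> U x.
Proof.
move=> HU UK x xK; apply/(submod_ofP HU).
apply: (gensub_min (U := submod_of HU)) xK => _ [k [l [pk ->]]].
exact/submod_ofP/UK.
Qed.

(** Flatness keeps the image of [M] embedded after tensoring with [L], so the tensor [t] defined by
    [l] vanishes as soon as its image does. Mapping the tensor product to tuples modulo [W], the
    submodule of tuples satisfying the conclusion, then shows that [l] is in [W]. *)
Lemma flat_mx (L : lmodType A) a b c (M' : 'M[A]_(a, b)) (M : 'M[A]_(b, c))
    (l : 'I_b -> L) :
  flat L -> mx_exact (map_mx p M') (map_mx p M) ->
  (forall j, mxact M^T l j \in killsub L) ->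
  exists l', forall i, l i - mxact M'^T l' i \in killsub L.
Proof.
move=> flatL ex lM; pose id_A : {rmorphism A -> A} := idfun.
pose t : tensor id_A L (mod_coimage M) :=
  \sum_i pure_tensor id_A (l i) (quotmod_pi (Defs.lker (mod_lin M)) (delta_mx 0 i)).
have t0 : t = 0.
  apply: (flatL _ _ (mod_coimage_emb M) (@mod_coimage_emb_inj _ _ M)).
  rewrite linear0 linear_sum.
  transitivity (\sum_i \sum_j pure_tensor id_A (M i j *: l i) (row_mod_pi c (delta_mx 0 j))).
    apply: eq_bigr => i _; rewrite [LHS]tensor_map_pure.
    rewrite mod_coimage_emb_pi -rowE [row i M]row_sum_delta.
    rewrite linear_sum pure_tensor_sumr; apply: eq_bigr => j _.
    by rewrite linearZ pure_tensorZr mxE.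
  rewrite exchange_big; apply: big1 => j _; rewrite -pure_tensor_suml.
  have -> : \sum_i M i j *: l i = mxact M^T l j.
    by apply: eq_bigr => i _; rewrite mxE.
  apply: (killsub_ind (U := fun x => pure_tensor id_A x (row_mod_pi c (delta_mx 0 j)) = 0)
    _ _ (lM j)) => [|k x pk].
    split=> [|s u w uE wE]; first exact: pure_tensor0l.
    by rewrite pure_tensorDl pure_tensorZl uE wE scaler0 addr0.
  rewrite -[k]/(id_A k) -pure_tensorZr row_mod_pi_killed //.
  exact: pure_tensor0r.
have HW : is_submodule (fun w : 'I_b -> L =>
    exists l', forall i, w i - mxact M'^T l' i \in killsub L).
  split=> [|s u w [lu uE] [lw wE]].
    by exists 0 => i; rewrite linear0 subrr rpred0.
  exists (s *: lu + lw) => i; rewrite linearP.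
  have -> : (s *: u + w) i - (s *: mxact M'^T lu + mxact M'^T lw) i =
      s *: (u i - mxact M'^T lu i) + (w i - mxact M'^T lw i).
    by rewrite !fctE scalerBr opprD addrACA.
  by rewrite rpredD ?rpredZ.
pose W := submod_of HW.
have gL (x : L) : linear (fun y : 'rV[A]_b => quotmod_pi W (fun i => y 0 i *: x)).
  move=> s y z; rewrite -linearP; congr quotmod_pi; apply: funext => i.
  by rewrite !mxE !fctE scalerDl scalerA.
have gK (x : L) y : y \in Defs.lker (mod_lin M) -> lin_of (gL x) y = 0.
  move=> /eqP/row_mod_pi0 yM; have [z zE] := mx_exact_mod ex yM.
  apply/(quotmod_eq0 W)/submod_ofP; exists (fun k => z 0 k *: x) => i.
  have -> : y 0 i *: x - mxact M'^T (fun k => z 0 k *: x) i = (y - z *m M') 0 i *: x.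
    rewrite !mxE scalerBl scaler_suml; congr (_ - _); apply: eq_bigr => k _.
    by rewrite scalerA mxE mulrC.
  exact: killsub_mem.
pose h (x : L) (q : mod_coimage M) : quotmod W := quotmod_lift (gK x) q.
have hE x y : h x (quotmod_pi _ y) = quotmod_pi W (fun i => y 0 i *: x).
  exact: (quotmod_liftE (gK x)).
have hDl m m' q : h (m + m') q = h m q + h m' q.
  rewrite -[q]quotmod_reprK !hE -linearD; congr quotmod_pi.
  by apply: funext => i; rewrite !fctE scalerDr.
have hDr m q q' : h m (q + q') = h m q + h m q' by rewrite /h linearD.
have hZl s m q : h (s *: m) q = s *: h m q.
  rewrite -[q]quotmod_reprK !hE -linearZ; congr quotmod_pi.
  by apply: funext => i; rewrite !fctE !scalerA mulrC.
have hZr s m q : h m (s *: q) = h (id_A s *: m) q by rewrite hZl /h linearZ.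
have := congr1 (tensor_lift hDl hDr hZl hZr) t0.
rewrite linear0 linear_sum; under eq_bigr do rewrite tensor_liftE hE.
rewrite -linear_sum => /quotmod_eq0/submod_ofP[l' lE]; exists l' => i.
have := lE i; rewrite fct_sumE (bigD1 i) //= big1 ?addr0 => [|k ki].
  by rewrite mxE !eqxx scale1r.
by rewrite mxE eq_sym (negbTE ki) andbF scale0r.
Qed.

End ModKernel.

Lemma ord_eq1 k : k = 1%N -> {l0 : 'I_k | forall l, l = l0}.
Proof. by move=> ->; exists ord0 => l; exact: ord1. Qed.

(** * The double complex of a free and an injective resolution *)

Section Balancing.
Variables (P : comNzRingType) (E : right_resolution P^o).
Hypothesis injE : forall j, injective_mod (E j).
Variables (n : nat -> nat) (D : forall i, 'M[P]_(n i.+1, n i)).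
Hypothesis Dexact : forall i, mx_exact (D i.+1) (D i).

Local Notation d j := (rres_diff E j).

Lemma rres_diff2 j x : d j.+1 (d j x) = 0.
Proof. by apply/rres_exactS; exists x. Qed.

Lemma rres_diff_aug x : d 0 (rres_aug E x) = 0.
Proof. by apply/rres_exact0; exists x. Qed.

Lemma resolution_lift j (T : Type) (y : T -> E j.+1) :
  (forall k, d j.+1 (y k) = 0) -> exists u : T -> E j, y = d j \o u.
Proof.
move=> dy; have [u uP] := choice (fun k => (@rres_exactS _ _ E j (y k)).1 (dy k)).
by exists u; apply: funext => k; rewrite /= uP.
Qed.

Lemma injective_rows j i (y : 'I_(n i.+1) -> E j) :
  mxact (D i.+1) y = 0 -> exists v, y = mxact (D i) v.
Proof.
move=> Dy; pose id_P : {rmorphism P -> P} := idfun.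
have ex : mx_exact (map_mx id_P (D i.+1)) (map_mx id_P (D i)).
  by rewrite !map_mx_id.
have yK : killed id_P y by move=> k /= -> l; rewrite scale0r.
have [|w _ wE] := injective_mx (p := id_P) _ (@injE j) ex yK Dy; last by exists w.
by move=> x; exists x.
Qed.

Lemma mxactDD j i (v : 'I_(n i) -> E j) : mxact (D i.+1) (mxact (D i) v) = 0.
Proof. by rewrite -mxactM (mx_exact0 (@Dexact i)) mxact0l. Qed.

Definition bicycle j i (y : 'I_(n i) -> E j) :=
  mxact (D i) y = 0 /\ forall k, d j (y k) = 0.

(** For [j = 0] the cycles of [d] come from [P], and this quotient is cohomology of [Hom(G, P)]. At
    the other end, [col_boundary] for [i = 0] involves the tuples killed by [D 0], giving cohomology
    of [Hom(M, E)]. *)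
Definition row_boundary j i (y : 'I_(n i.+1) -> E j) :=
  exists2 a : 'I_(n i) -> E j, forall k, d j (a k) = 0 & y = mxact (D i) a.

Definition col_boundary j i (y : 'I_(n i) -> E j.+1) :=
  exists2 b : 'I_(n i) -> E j, mxact (D i) b = 0 & y = d j \o b.

(* The bicycles modulo boundaries compute [Ext(M, P)], where [M] is the module
   resolved by [D], from every position of the double complex [Hom(G_i, E^j)];
   the next lemmas transport its presentation as a cyclic module along an
   antidiagonal. *)
Definition cyclic_modulo (T' T : P -> Prop) j i (bd : ('I_(n i) -> E j) -> Prop) :=
  exists eta, [/\ @bicycle j i eta,
    forall y, bicycle y -> exists c : P, bd (y - c *: eta),
    forall c : P, T' c -> bd (c *: eta) &
    forall c : P, bd (c *: eta) -> T c].

(** Injectivity of [E j] writes the generator as [mxact (D i) v], and the new generator is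
    [d j \o v]. *)
Lemma row_to_col T' T j i :
  @cyclic_modulo T' T j i.+1 (@row_boundary j i) ->
  @cyclic_modulo T' T j.+1 i (@col_boundary j i).
Proof.
case=> eta [[Deta deta] gen ann' ann]; have [v vE] := injective_rows Deta.
exists (d j \o v); split.
- split=> [|k]; last exact: rres_diff2.
  by rewrite -mxact_lin -vE; apply: funext => k; exact: deta.
- move=> y [Dy dy]; have [u uE] := resolution_lift dy.
  have [|c [a da aE]] := gen (mxact (D i) u).
    split=> [|k]; first exact: mxactDD.
    by have := congr1 (@^~ k) (mxact_lin (D i) (d j) u); rewrite /= => ->; rewrite -uE Dy.
  exists c, (u - c *: v - a).
    by rewrite !linearB linearZ /= -aE vE subrr.
  apply: funext => k; rewrite uE.
  have E' : d j (u k - c *: v k - a k) = d j (u k) - c *: d j (v k).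
    by rewrite !linearB linearZ /= da subr0.
  exact: esym E'.
- move=> c /ann'[a da aE]; exists (c *: v - a).
    by rewrite linearB linearZ /= -aE vE subrr.
  apply: funext => k; have E' : d j (c *: v k - a k) = c *: d j (v k).
    by rewrite linearB linearZ /= da subr0.
  exact: esym E'.
move=> c [b Db bE]; apply: ann; exists (c *: v - b).
  move=> k; transitivity (d j (c *: v k - b k)); first by [].
  rewrite linearB linearZ /=.
  by have /(congr1 (@^~ k)) := bE; rewrite !fctE /= => ->; rewrite subrr.
by rewrite linearB linearZ /= Db subr0 vE.
Qed.

(** Here both kinds of boundaries are the same tuples: each has the form [mxact (D i) (d j \o e)],
    by exactness in the other direction. *)
Lemma col_to_row T' T j i :
  @cyclic_modulo T' T j.+1 i.+1 (@col_boundary j i.+1) ->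
  @cyclic_modulo T' T j.+1 i.+1 (@row_boundary j.+1 i).
Proof.
have B2A (y : 'I_(n i.+1) -> E j.+1) : col_boundary y -> row_boundary y.
  case=> b /injective_rows[e ->] ->; exists (d j \o e).
    by move=> k; exact: rres_diff2.
  by rewrite mxact_lin.
case=> eta [ceta gen ann' ann]; exists eta; split=> // [y cy|c /ann'/B2A|c [a da aE]] //.
  by have [c /B2A] := gen y cy; exists c.
have [e eE] := resolution_lift da; apply: ann; exists (mxact (D i) e).
  exact: mxactDD.
by rewrite aE eE mxact_lin.
Qed.

Lemma row_to_col0 T' T i j :
  @cyclic_modulo T' T j i.+1 (@row_boundary j i) ->
  @cyclic_modulo T' T (i + j).+1 0 (@col_boundary (i + j) 0).
Proof.
elim: i => [|i IHi] in j *; first exact: row_to_col.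
move=> /row_to_col/col_to_row/IHi; by rewrite addnS.
Qed.

Section Interface.
Variables (S : comNzRingType) (p : {rmorphism P -> S}).
Variable g : nat.
Hypothesis n0 : n 0 = 1%N.
Hypothesis Dp : forall v : 'rV_(n 0),
  (forall i, p (v 0 i) = 0) <-> exists u, v = u *m D 0.
Hypothesis dualD : forall i, (i <= g)%N -> dual_exact D P^o i.
Hypothesis ng : n g.+1 = 1%N.
Hypothesis n_gt : forall i, (g.+1 < i)%N -> n i = 0%N.

(** The last module has rank 1, so its dual is [P], generated by 1. If [c] is hit by the last dual
    differential, multiplication by [c] is null-homotopic in the top degree, and descending to
    degree 0 gives [p c = 0]. *)
Lemma cyclic_top :
  @cyclic_modulo (fun=> False) (fun c => p c = 0) 0 g.+1 (@row_boundary 0 g).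
Proof.
have [k0 k0E] := ord_eq1 ng.
have Dtop (y : 'I_(n g.+1) -> E 0%N) : mxact (D g.+1) y = 0.
  by apply: funext => -[k kn]; exfalso; move: kn; rewrite n_gt.
exists (fun=> rres_aug E 1); split.
- by split=> // k; exact: rres_diff_aug.
- move=> y [_ dy]; have [q qE] := (@rres_exact0 _ _ E (y k0)).1 (dy k0).
  exists q, 0 => [k|]; first by rewrite linear0.
  rewrite linear0; apply: funext => k; rewrite !fctE (k0E k) -qE -linearZ /=.
  by rewrite -[_ *: _]/(q * 1) mulr1 subrr.
- by [].
move=> c [a da aE].
have [q qE] := choice (fun k => (@rres_exact0 _ _ E (a k)).1 (da k)).
have cE : c = \sum_j D g k0 j * q j.
  apply: (@rres_inj _ _ E); have /(congr1 (@^~ k0)) := aE.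
  rewrite !fctE -linearZ -[_ *: 1]/(c * 1) mulr1 => ->.
  rewrite linear_sum; apply: eq_bigr => j _.
  by rewrite -qE -linearZ.
have [|||t tE] := @null_homotopic_down P n D c g 0 (\matrix_(j, k) q j).
- exact: dualD.
- by move=> i; exact: (mx_exact0 (@Dexact i)).
- rewrite mul0mx add0r; apply/matrixP => k k'.
  rewrite (k0E k) (k0E k') !mxE eqxx mulr1n cE; apply: eq_bigr => j _.
  by rewrite !mxE.
have [l0 _] := ord_eq1 n0.
have /Dp/(_ l0) : exists u, row l0 (c%:M : 'M_(n 0)) = u *m D 0.
  by exists (row l0 t); rewrite tE row_mul.
by rewrite !mxE eqxx mulr1n.
Qed.

Lemma vanishing_top i : (g < i)%N ->
  @cyclic_modulo (fun=> True) (fun=> True) 0 i.+1 (@row_boundary 0 i).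
Proof.
move=> gi; have y0 (y : 'I_(n i.+1) -> E 0%N) : y = 0.
  by apply: funext => -[k kn]; exfalso; move: kn; rewrite n_gt.
have bd0 (y : 'I_(n i.+1) -> E 0%N) : row_boundary y.
  by exists 0 => [k|]; [rewrite linear0 | rewrite [LHS]y0 linear0].
exists 0; split=> // [|y _]; last by exists 0.
by split=> [|k]; rewrite ?linear0.
Qed.

Lemma killed_rows (V : lmodType P) (x : V) :
  killed p (fun _ : unit => x) <-> mxact (D 0) (fun=> x) = 0.
Proof.
have [l0 l0E] := ord_eq1 n0.
have actE a (M : 'M_(a, n 0)) i : mxact M (fun=> x) i = M i l0 *: x.
  rewrite /mxact (bigD1 l0) //= big1 ?addr0 // => j.
  by rewrite (l0E j) eqxx.
split=> [xK|Dx k pk _].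
  apply: funext => i; rewrite actE; apply: xK; last exact: tt.
  have /Dp/(_ l0) : exists u, row i (D 0) = u *m D 0.
    by exists (delta_mx 0 i); rewrite rowE.
  by rewrite mxE.
have /Dp[u uE] : forall i, p ((const_mx k : 'rV_(n 0)) 0 i) = 0 by move=> i; rewrite mxE.
have := actE _ (const_mx k : 'rV_(n 0)) 0; rewrite mxE => <-.
by rewrite uE mxactM Dx linear0.
Qed.

(** The class of [theta] corresponds to 1 under the isomorphism of [S] with [Ext^(g+1)(S, P)],
    computed by the elements of [E] that [ker p] kills. *)
Lemma dualizing_class : exists theta : E g.+1,
  [/\ killed p (fun _ : unit => theta), d g.+1 theta = 0,
    forall eta : E g.+1, killed p (fun _ : unit => eta) -> d g.+1 eta = 0 ->
      exists (c : P) (b : E g), killed p (fun _ : unit => b) /\ eta = c *: theta + d g b &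
    forall (c : P) (b : E g), killed p (fun _ : unit => b) ->
      c *: theta = d g b -> p c = 0].
Proof.
have [l0 l0E] := ord_eq1 n0.
have cst (V : Type) (f : 'I_(n 0) -> V) : f = fun=> f l0.
  by apply: funext => l; rewrite (l0E l).
have := row_to_col0 cyclic_top; rewrite addn0 => -[th [[Dth dth] gen _ ann]].
exists (th l0); split=> //.
- by apply/killed_rows; rewrite -cst.
- move=> eta /killed_rows Deta deta; have [|c [b Db bE]] := gen (fun=> eta) => //.
  exists c, (b l0); split; first by apply/killed_rows; rewrite -cst.
  have E' : eta - c *: th l0 = d g (b l0) := congr1 (@^~ l0) bE.
  by rewrite -E' addrC subrK.
move=> c b /killed_rows Db cE; apply: ann; exists (fun=> b) => //.
by rewrite [th]cst; apply: funext => l; rewrite !fctE.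
Qed.

(** Vanishing of [Ext(S, P)] above the length [g.+1] of [D], moved to the injective side. *)
Lemma annihilated_exact j (eta : E j.+1) : (g < j)%N ->
  killed p (fun _ : unit => eta) -> d j.+1 eta = 0 ->
  exists2 b : E j, killed p (fun _ : unit => b) & eta = d j b.
Proof.
have [l0 l0E] := ord_eq1 n0.
have cst (V : Type) (f : 'I_(n 0) -> V) : f = fun=> f l0.
  by apply: funext => l; rewrite (l0E l).
move=> gj /killed_rows Deta deta.
have := row_to_col0 (vanishing_top gj); rewrite addn0 => -[th [_ gen bd _]].
have [|c [b Db bE]] := gen (fun=> eta) => //.
have [b' Db' bE'] := bd c I; exists (b l0 + b' l0).
  apply/killed_rows; have -> : (fun=> b l0 + b' l0) = b + b'.
    by rewrite [b in RHS]cst [b' in RHS]cst.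
  by rewrite linearD /= Db Db' addr0.
rewrite linearD -[eta](subrK (c *: th l0)).
have E1 : eta - c *: th l0 = d j (b l0) := congr1 (@^~ l0) bE.
have E2 : c *: th l0 = d j (b' l0) := congr1 (@^~ l0) bE'.
by rewrite -E1 -E2.
Qed.

End Interface.
End Balancing.

Section Killed.
Variables (A B : comNzRingType) (p : {rmorphism A -> B}).

Lemma killedB (V : lmodType A) T (v w : T -> V) :
  killed p v -> killed p w -> killed p (v - w).
Proof.
move=> vK wK k pk t; rewrite -[(v - w) t]/(v t - w t) scalerBr.
by rewrite vK ?wK ?subr0.
Qed.

Lemma killed_comp (V W : lmodType A) T (f : {linear V -> W}) (v : T -> V) :
  killed p v -> killed p (f \o v).
Proof. by move=> vK k pk t; rewrite /= -linearZ vK ?linear0. Qed.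

Lemma killed_mxact (V : lmodType A) a b (D : 'M[A]_(a, b)) (v : 'I_b -> V) :
  killed p v -> killed p (mxact D v).
Proof.
move=> vK k pk i; rewrite /mxact scaler_sumr big1 // => j _.
by rewrite scalerA mulrC -scalerA vK ?scaler0.
Qed.

Lemma mxact_killed0 (V : lmodType A) a b (D : 'M[A]_(a, b)) (v : 'I_b -> V) :
  map_mx p D = 0 -> killed p v -> mxact D v = 0.
Proof.
move=> pD vK; apply: funext => i; apply: big1 => j _; apply: vK.
by have /matrixP/(_ i j) := pD; rewrite !mxE.
Qed.

Lemma killed_unit (V : lmodType A) T (v : T -> V) t :
  killed p v -> killed p (fun _ : unit => v t).
Proof. by move=> vK k pk _; apply: vK. Qed.

End Killed.

(** * Acyclic complexes over [S] have acyclic duals *)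

Section DualWindow.
Variables (P S : comNzRingType) (p : {rmorphism P -> S}).
Hypothesis p_surj : Defs.surjective p.
Variables (E : right_resolution P^o) (m g : nat).
Hypothesis injE : forall j, injective_mod (E j).
Hypothesis vanE : vanishes_above E m.
Local Notation d j := (rres_diff E j).

Hypothesis ann_exact : forall j (eta : E j.+1), (g < j)%N ->
  killed p (fun _ : unit => eta) -> d j.+1 eta = 0 ->
  exists2 b : E j, killed p (fun _ : unit => b) & eta = d j b.

Variable theta : E g.+1.
Hypothesis thetaK : killed p (fun _ : unit => theta).
Hypothesis dtheta : d g.+1 theta = 0.
Hypothesis theta_gen : forall eta : E g.+1,
  killed p (fun _ : unit => eta) -> d g.+1 eta = 0 ->
  exists (c : P) (b : E g), killed p (fun _ : unit => b) /\ eta = c *: theta + d g b.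
Hypothesis theta_ann : forall (c : P) (b : E g),
  killed p (fun _ : unit => b) -> c *: theta = d g b -> p c = 0.

Variables (q : nat -> nat) (M : forall i, 'M[P]_(q i.+1, q i)).
Hypothesis Mexact : forall i, mx_exact (map_mx p (M i.+1)) (map_mx p (M i)).

Lemma killedMM (V : lmodType P) i (v : 'I_(q i) -> V) :
  killed p v -> mxact (M i.+1) (mxact (M i) v) = 0.
Proof.
move=> vK; rewrite -mxactM; apply: mxact_killed0 vK.
by rewrite map_mxM (mx_exact0 (@Mexact i)).
Qed.

Lemma ann_exact_vec j T (y : T -> E j.+1) : (g < j)%N ->
  killed p y -> d j.+1 \o y = 0 ->
  exists2 b : T -> E j, killed p b & y = d j \o b.
Proof.
move=> gj yK dy.
have key t : exists b, killed p (fun _ : unit => b) /\ y t = d j b.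
  by have [b] := ann_exact gj (killed_unit t yK) (congr1 (@^~ t) dy); exists b.
have [b bP] := choice key.
exists b; first by move=> k pk t; apply: (bP t).1 => //; exact: tt.
by apply: funext => t; exact: (bP t).2.
Qed.

Lemma injective_window j i (y : 'I_(q i.+1) -> E j) :
  killed p y -> mxact (M i.+1) y = 0 ->
  exists2 u : 'I_(q i) -> E j, killed p u & y = mxact (M i) u.
Proof. exact: (injective_mx p_surj (@injE j) (@Mexact i)). Qed.

Lemma diff2_comp j T (w : T -> E j) : d j.+1 \o (d j \o w) = 0.
Proof. by apply: funext => t; exact: rres_diff2. Qed.

(** Each step lowers the index of [M] and raises that of [E], until [E] is zero above [m]. On the
    way back, [w] is corrected by [mxact (M k.+1) b'] to become a cycle of [d], and [ann_exact]
    applies. *)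
Lemma dual_zigzag k j (w : 'I_(q k.+1) -> E j.+1) (u : 'I_(q k) -> E j.+2) :
  (g < j)%N -> (m <= k + j)%N -> killed p w -> killed p u ->
  d j.+1 \o w = mxact (M k) u ->
  exists (a : 'I_(q k) -> E j.+1) (b : 'I_(q k.+1) -> E j),
    [/\ killed p a, killed p b & w = mxact (M k) a + (d j \o b)].
Proof.
elim: k => [|k IHk] in j w u *; move=> gj mj wK uK dw.
  exists 0, 0; split=> [c _ t|c _ t|]; rewrite ?scaler0 //.
  rewrite linear0 add0r; apply: funext => t; rewrite /= linear0.
  exact: (vanE (i := j.+1)).
have [||u' u'K du] := @injective_window _ _ (d j.+2 \o u).
- exact: killed_comp.
- by rewrite -mxact_lin -dw diff2_comp.
have [||a' [b' [a'K b'K uE]]] := IHk j.+1 u u' _ _ uK u'K du.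
- exact: leqW.
- by rewrite addnS -addSn.
have [|||b bK bE] := @ann_exact_vec j _ (w - mxact (M k.+1) b').
- by [].
- by apply: killedB => //; apply: killed_mxact.
- apply: funext => t.
  have E' : d j.+1 (w t - mxact (M k.+1) b' t) = 0.
    rewrite linearB; have -> : d j.+1 (w t) = mxact (M k.+1) u t := congr1 (@^~ t) dw.
    have -> : d j.+1 (mxact (M k.+1) b' t) = mxact (M k.+1) (d j.+1 \o b') t.
      exact: (congr1 (@^~ t) (mxact_lin _ _ _)).
    by rewrite uE linearD /= killedMM // add0r subrr.
  exact: E'.
exists b', b; split=> //.
by rewrite -bE addrC subrK.
Qed.

(* The modules [{x in E j | ker p kills x}] form an injective resolution of [S]
   shifted by [g.+1], up to exact low degrees; dimension shifting along it is
   carried out by [dual_zigzag]. *)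
Lemma dual_window :
  mx_exact (map_mx p (M m.+2))^T (map_mx p (M m.+3))^T.
Proof.
move=> v; split=> [vM|[u ->]]; last first.
  by rewrite -mulmxA -trmx_mul (mx_exact0 (@Mexact m.+2)) trmx0 mulmx0.
have [x xE] := mx_lift p_surj v; rewrite -xE in vM *.
(* The row [v] becomes a tuple of multiples of [theta], which stands for 1 in [S]. It remains to
   replace [w] by multiples of [theta], up to terms that [M m.+2] kills and boundaries of [d g]. *)
have [||w wK wE] := @injective_window g.+1 m.+2 (fun i => x 0 i *: theta).
- move=> k pk i; rewrite scalerA mulrC -scalerA thetaK ?scaler0 //; exact: tt.
- apply: funext => i; rewrite /mxact.
  under eq_bigr do rewrite scalerA; rewrite -scaler_suml.
  apply: thetaK; last exact: tt.
  have := congr1 (fun y : 'rV_(q m.+4) => y 0 i) vM; rewrite !mxE => E'.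
  rewrite -[RHS]E' rmorph_sum; apply: eq_bigr => j _.
  by rewrite !mxE rmorphM mulrC.
have [||u uK uE] := @injective_window g.+2 m.+1 (d g.+1 \o w).
- exact: killed_comp.
- rewrite -mxact_lin -wE; apply: funext => i.
  by rewrite /= linearZ /= dtheta scaler0.
have [||u' u'K u'E] := @injective_window g.+3 m (d g.+2 \o u).
- exact: killed_comp.
- by rewrite -mxact_lin -uE diff2_comp.
(* Index [m] leaves enough room for the zigzag to reach the zero modules of [E]. *)
have [||a [b [aK bK uE']]] := dual_zigzag _ _ uK u'K u'E; rewrite ?ltnSn //.
  exact: leq_addr.
have key t : exists cb : P * E g, killed p (fun _ : unit => cb.2) /\
    w t - mxact (M m.+1) b t = cb.1 *: theta + d g cb.2.
  have [||c [b' [b'K E']]] := theta_gen (eta := w t - mxact (M m.+1) b t).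
  - apply: (@killed_unit _ _ p _ _ (w - mxact (M m.+1) b) t).
    by apply: killedB => //; apply: killed_mxact.
  - rewrite linearB.
    have -> : d g.+1 (w t) = mxact (M m.+1) u t := congr1 (@^~ t) uE.
    have -> : d g.+1 (mxact (M m.+1) b t) = mxact (M m.+1) (d g.+1 \o b) t.
      exact: (congr1 (@^~ t) (mxact_lin _ _ _)).
    by rewrite uE' linearD /= killedMM // add0r subrr.
  by exists (c, b').
have [f fP] := choice key.
exists (map_mx p (\row_t (f t).1)); apply/rowP => i.
pose b' t := (f t).2.
have b'K : killed p b' by move=> k pk t; apply: (fP t).1 => //; exact: tt.
(* The multiple of [theta] by this error is a boundary of a killed element, so [theta_ann] places
   [c] in [ker p]. *)
pose c := x 0 i - \sum_t M m.+2 i t * (f t).1.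
have : p c = 0.
  apply: (theta_ann (b := mxact (M m.+2) b' i)).
    exact: (killed_unit i (killed_mxact (M m.+2) b'K)).
  have -> : d g (mxact (M m.+2) b' i) = mxact (M m.+2) (d g \o b') i.
    exact: (congr1 (@^~ i) (mxact_lin _ _ _)).
  have -> : d g \o b' = w - mxact (M m.+1) b - (fun t => (f t).1 *: theta).
    apply: funext => t; rewrite -[RHS]/(w t - mxact (M m.+1) b t - (f t).1 *: theta).
    by rewrite (fP t).2 addrC addKr.
  rewrite !linearB /= killedMM // -wE subr0 /c scalerBl scaler_suml.
  congr (_ - _); apply: eq_bigr => t _; exact: esym (scalerA _ _ _).
move/eqP; rewrite rmorphB subr_eq0 => /eqP E'; rewrite !mxE E' rmorph_sum.
by apply: eq_bigr => t _; rewrite !mxE rmorphM mulrC.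
Qed.

End DualWindow.

Section ModKillsub.
Variables (A B : comNzRingType) (p : {rmorphism A -> B}).

Lemma killsub_lin (V W : lmodType A) (f : {linear V -> W}) x :
  x \in killsub p V -> f x \in killsub p W.
Proof.
apply: (killsub_ind (U := fun x => f x \in killsub p W)).
  split=> [|a u v uK vK]; first by rewrite linear0 rpred0.
  by rewrite linearP rpredD ?rpredZ.
by move=> k l pk; rewrite linearZ killsub_mem.
Qed.

Lemma killsub_mxact (V : lmodType A) a b (D : 'M[A]_(a, b)) (v : 'I_b -> V) :
  (forall i, v i \in killsub p V) -> forall i, mxact D v i \in killsub p V.
Proof. by move=> vK i; apply: rpred_sum => j _; rewrite rpredZ. Qed.

Lemma killsub_mxact0 (V : lmodType A) a b (D : 'M[A]_(a, b)) (v : 'I_b -> V) :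
  map_mx p D = 0 -> forall i, mxact D v i \in killsub p V.
Proof.
move=> pD i; apply: rpred_sum => j _; apply: killsub_mem.
by have /matrixP/(_ i j) := pD; rewrite !mxE.
Qed.

End ModKillsub.

Lemma killsub_id (A : comNzRingType) (V : lmodType A) (x : V) :
  x \in killsub (idfun : {rmorphism A -> A}) V -> x = 0.
Proof.
apply: (killsub_ind (U := fun x => x = 0)).
  by split=> // a u v -> ->; rewrite scaler0 addr0.
by move=> k l /= ->; rewrite scale0r.
Qed.

(** * Acyclic complexes over [S] stay acyclic over [R] *)

Section TensorWindow.
Variables (P Q R S : comNzRingType).
Variables (phi : {rmorphism Q -> R}) (psi : {rmorphism P -> Q}) (p : {rmorphism P -> S}).
Hypotheses (phi_surj : Defs.surjective phi) (p_surj : Defs.surjective p).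
Variables (L : left_resolution (restr_scalars psi Q^o)) (m : nat).
Hypotheses (flatL : forall j, flat (L j)) (vanL : vanishes_above L m).
Local Notation d j := (lres_diff L j).
Local Notation aug := (lres_aug L).

Section Rows.
Variables (n : nat -> nat) (D : forall i, 'M[P]_(n i.+1, n i)).
Hypothesis n0 : n 0 = 1%N.
Hypothesis Dp : forall v : 'rV_(n 0),
  (forall i, p (v 0 i) = 0) <-> exists u, v = u *m D 0.
Hypothesis Dexact : forall i, mx_exact (D i.+1) (D i).
Hypothesis DexactQ : forall i, mx_exact (map_mx psi (D i.+1)) (map_mx psi (D i)).
Hypothesis Dphi : forall v : 'rV[Q]_(n 0),
  (forall i, phi (v 0 i) = 0) <-> exists u, v = u *m map_mx psi (D 0).

Lemma flat_rows j i (l : 'I_(n i.+1) -> L j) :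
  mxact (D i)^T l = 0 -> exists l', l = mxact (D i.+1)^T l'.
Proof.
move=> Dl; pose id_P : {rmorphism P -> P} := idfun.
have ex : mx_exact (map_mx id_P (D i.+1)) (map_mx id_P (D i)).
  by rewrite !map_mx_id.
have [|k|l' lE] := flat_mx (p := id_P) (l := l) _ (@flatL j) ex.
- by move=> x; exists x.
- by rewrite Dl rpred0.
exists l'; apply: funext => k; apply/eqP; rewrite -subr_eq0; apply/eqP.
exact: (killsub_id (lE k)).
Qed.

Lemma target_rows i (l : 'I_(n i.+1) -> restr_scalars psi Q^o) :
  mxact (D i)^T l = 0 -> exists l', l = mxact (D i.+1)^T l'.
Proof.
move=> Dl; have /DexactQ[u uE] : (\row_k (l k : Q)) *m map_mx psi (D i) = 0.
  apply/rowP => k; transitivity (mxact (D i)^T l k); last by rewrite Dl mxE.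
  by rewrite mxE; apply: eq_bigr => t _; rewrite !mxE mulrC.
exists (fun k => u 0 k); apply: funext => k.
have := congr1 (fun v : 'rV_(n i.+1) => v 0 k) uE; rewrite !mxE => ->.
by apply: eq_bigr => t _; rewrite !mxE mulrC.
Qed.

Lemma kernel_lift (T : Type) j (y : T -> L j.+1) :
  d j \o y = 0 -> exists w : T -> L j.+2, y = d j.+1 \o w.
Proof.
move=> dy; have [w wP] := choice (fun t => (@lres_exactS _ _ L j (y t)).1 (congr1 (@^~ t) dy)).
by exists w; apply: funext => t; rewrite /= wP.
Qed.

Lemma row_zigzag0 i (l : 'I_(n i) -> L 0) (l' : 'I_(n i.+1) -> restr_scalars psi Q^o) :
  aug \o l = mxact (D i)^T l' ->
  exists (w : 'I_(n i) -> L 1) (w' : 'I_(n i.+1) -> L 0),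
    l = (d 0 \o w) + mxact (D i)^T w'.
Proof.
move=> lE; have [w' w'E] := choice (fun k => @lres_surj _ _ L (l' k)).
have dl k : aug (l k - mxact (D i)^T w' k) = 0.
  rewrite linearB; have -> : aug (l k) = mxact (D i)^T l' k := congr1 (@^~ k) lE.
  have -> : aug (mxact (D i)^T w' k) = mxact (D i)^T (aug \o w') k.
    exact: (congr1 (@^~ k) (mxact_lin _ _ _)).
  have -> : aug \o w' = l' by apply: funext => t; exact: w'E.
  exact: subrr.
have [w wE] := choice (fun k => (@lres_exact0 _ _ L _).1 (dl k)).
exists w, w'; apply: funext => k.
by rewrite -[RHS]/(d 0 (w k) + mxact (D i)^T w' k) wE subrK.
Qed.

(** Walks through the double complex of [L] and [D] down to the augmentation. Flatness makes the
    rows over [L] exact, and the row over [Q] is exact by [DexactQ]. *)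
Lemma row_zigzag j i (l : 'I_(n i) -> L j.+1) (l' : 'I_(n i.+1) -> L j) :
  d j \o l = mxact (D i)^T l' ->
  exists (w : 'I_(n i) -> L j.+2) (w' : 'I_(n i.+1) -> L j.+1),
    l = (d j.+1 \o w) + mxact (D i)^T w'.
Proof.
elim: j => [|j IHj] in i l l' *; move=> lE.
- have aug_d (x : 'I_(n i) -> L 1) : aug \o (d 0 \o x) = 0.
    by apply: funext => t; exact: lres_aug_diff.
  have [|l'' l''E] := @target_rows i (aug \o l').
    by rewrite -mxact_lin -lE aug_d.
  have [w [w' wE]] := row_zigzag0 l''E.
  have [|b bE] := @kernel_lift _ 0 (l - mxact (D i)^T w).
    apply: funext => k; have E' : d 0 (l k - mxact (D i)^T w k) = 0.
      rewrite linearB; have -> : d 0 (l k) = mxact (D i)^T l' k := congr1 (@^~ k) lE.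
      have -> : d 0 (mxact (D i)^T w k) = mxact (D i)^T (d 0 \o w) k.
        exact: (congr1 (@^~ k) (mxact_lin _ _ _)).
      rewrite wE linearD /= -mxactM -trmx_mul (mx_exact0 (@Dexact i)) trmx0 mxact0l.
      by rewrite addr0 subrr.
    exact: E'.
  by exists b, w; rewrite -bE subrK.
have d_d (x : 'I_(n i) -> L j.+2) : d j \o (d j.+1 \o x) = 0.
  by apply: funext => t; exact: lres_diff2.
have [|l'' l''E] := @flat_rows j i (d j \o l').
  by rewrite -mxact_lin -lE d_d.
have [w [w' wE]] := IHj _ _ _ l''E.
have [|b bE] := @kernel_lift _ j.+1 (l - mxact (D i)^T w).
  apply: funext => k; have E' : d j.+1 (l k - mxact (D i)^T w k) = 0.
    rewrite linearB; have -> : d j.+1 (l k) = mxact (D i)^T l' k := congr1 (@^~ k) lE.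
    have -> : d j.+1 (mxact (D i)^T w k) = mxact (D i)^T (d j.+1 \o w) k.
      exact: (congr1 (@^~ k) (mxact_lin _ _ _)).
    rewrite wE linearD /= -mxactM -trmx_mul (mx_exact0 (@Dexact i)) trmx0 mxact0l.
    by rewrite addr0 subrr.
  exact: E'.
by exists b, w; rewrite -bE subrK.
Qed.

Lemma killsub_rows j (x : L j) l0 :
  x \in killsub p (L j) <-> exists l', x = mxact (D 0)^T l' l0.
Proof.
have [l1 l1E] := ord_eq1 n0; rewrite (l1E l0).
split=> [|[l' ->]]; last first.
  apply: rpred_sum => k _; apply: killsub_mem; rewrite mxE.
  have /Dp/(_ l1) : exists u, row k (D 0) = u *m D 0.
    by exists (delta_mx 0 k); rewrite rowE.
  by rewrite mxE.
apply: (killsub_ind (U := fun x => exists l', x = mxact (D 0)^T l' l1)).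
  split=> [|a _ _ [u ->] [v ->]]; first by exists 0; rewrite linear0.
  by exists (a *: u + v); rewrite linearP.
move=> k l pk; have /Dp[u uE] : forall i, p ((const_mx k : 'rV_(n 0)) 0 i) = 0.
  by move=> i; rewrite mxE.
exists (fun t => u 0 t *: l); have := congr1 (fun v : 'rV_(n 0) => v 0 l1) uE.
rewrite !mxE => ->; rewrite scaler_suml; apply: eq_bigr => t _.
by rewrite scalerA mxE mulrC.
Qed.

(** Vanishing of [Tor(Q, S)] in positive degrees, read on the side of the flat resolution. *)
Lemma killsub_exactS j (x : L j.+1) : d j x \in killsub p (L j) ->
  exists y, x - d j.+1 y \in killsub p (L j.+1).
Proof.
have [l0 l0E] := ord_eq1 n0; move=> /(killsub_rows _ l0)[l' xE].
have [|w [w' wE]] := @row_zigzag j 0 (fun=> x) l'.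
  by apply: funext => l; rewrite (l0E l).
exists (w l0); apply/(killsub_rows _ l0); exists w'.
have -> : x = d j.+1 (w l0) + mxact (D 0)^T w' l0 := congr1 (@^~ l0) wE.
by rewrite addrC addKr.
Qed.

Lemma killsub_exact0 (x : L 0) : phi (aug x) = 0 ->
  exists y, x - d 0 y \in killsub p (L 0).
Proof.
have [l0 l0E] := ord_eq1 n0; move=> phix.
have /Dphi[u uE] : forall i, phi ((const_mx (aug x : Q) : 'rV_(n 0)) 0 i) = 0.
  by move=> i; rewrite mxE.
have [|w [w' wE]] := @row_zigzag0 0 (fun=> x) (fun k => u 0 k).
  apply: funext => l; have := congr1 (fun v : 'rV_(n 0) => v 0 l) uE.
  rewrite !mxE /= => ->; apply: eq_bigr => t _.
  by rewrite !mxE mulrC.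
exists (w l0); apply/(killsub_rows _ l0); exists w'.
have -> : x = d 0 (w l0) + mxact (D 0)^T w' l0 := congr1 (@^~ l0) wE.
by rewrite addrC addKr.
Qed.

End Rows.

Hypothesis killsub_exactS' : forall j (x : L j.+1), d j x \in killsub p (L j) ->
  exists y, x - d j.+1 y \in killsub p (L j.+1).
Hypothesis killsub_exact0' : forall x : L 0, phi (aug x) = 0 ->
  exists y, x - d 0 y \in killsub p (L 0).
Hypothesis phi_p : forall k, p k = 0 -> phi (psi k) = 0.

Variables (q : nat -> nat) (M : forall i, 'M[P]_(q i.+1, q i)).
Hypothesis Mexact : forall i, mx_exact (map_mx p (M i.+1)) (map_mx p (M i)).

(** The index of [M] falls while that of [L] rises, until [L] is zero above [m]; on the way back
    [flat_mx] solves each equation modulo [killsub]. *)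
Lemma tensor_zigzag i j (y : 'I_(q i.+1) -> L j) (y' : 'I_(q i) -> L j.+1) :
  (m < i + j)%N ->
  (forall t, mxact (M i)^T y t - d j (y' t) \in killsub p (L j)) ->
  exists (w : 'I_(q i.+2) -> L j) (w' : 'I_(q i.+1) -> L j.+1),
    forall t, y t - mxact (M i.+1)^T w t - d j (w' t) \in killsub p (L j).
Proof.
elim: i => [|i IHi] in j y y' *; move=> mij yy'.
  by exists 0, 0 => t; rewrite (vanL mij (_ - _)) rpred0.
have key t : exists z : L j.+2,
    mxact (M i)^T y' t - d j.+1 z \in killsub p (L j.+1).
  apply: killsub_exactS'.
  have -> : d j (mxact (M i)^T y' t) =
      mxact (M i)^T (mxact (M i.+1)^T y) t
      - mxact (M i)^T (fun t => mxact (M i.+1)^T y t - d j (y' t)) t.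
    have -> : d j (mxact (M i)^T y' t) = mxact (M i)^T (d j \o y') t.
      exact: (congr1 (@^~ t) (mxact_lin _ _ _)).
    rewrite -[RHS]/((mxact (M i)^T (mxact (M i.+1)^T y)
      - mxact (M i)^T (mxact (M i.+1)^T y - (d j \o y'))) t).
    by rewrite -linearB opprB addrC subrK.
  rewrite rpredB //; last exact: killsub_mxact.
  rewrite -mxactM -trmx_mul; apply: killsub_mxact0.
  by rewrite -map_trmx map_mxM (mx_exact0 (@Mexact i)) trmx0.
have [y'' y''E] := choice key.
have [|w [w' wE]] := IHi j.+1 y' y'' _ y''E; first by rewrite addnS -addSn.
have [t|w'' w''E] := flat_mx (p := p) (l := y - (d j \o w)) p_surj (@flatL j) (@Mexact i.+1).
  have -> : mxact (M i.+1)^T (y - (d j \o w)) t =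
      (mxact (M i.+1)^T y t - d j (y' t)) +
      d j (y' t - mxact (M i.+1)^T w t - d j.+1 (w' t)).
    rewrite !linearB lres_diff2 subr0.
    have -> : d j (mxact (M i.+1)^T w t) = mxact (M i.+1)^T (d j \o w) t.
      exact: (congr1 (@^~ t) (mxact_lin _ _ _)).
    by rewrite addrA subrK.
  by rewrite rpredD // killsub_lin.
exists w'', w => t; have := w''E t.
by rewrite -[(y - _) t]/(y t - d j (w t)) addrAC.
Qed.

(* The quotients [L j / killsub p (L j)] form a flat resolution of [R] over [S];
   dimension shifting along it is carried out by [tensor_zigzag]. *)
Lemma tensor_window :
  let f k : R := phi (psi k) in
  mx_exact (map_mx phi (map_mx psi (M m.+2))) (map_mx phi (map_mx psi (M m.+1))).
Proof.
move=> f v; split=> [vM|[u ->]]; last first.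
  rewrite -mulmxA -!map_mxM; apply/rowP => i; rewrite !mxE; apply: big1 => j _.
  rewrite [X in _ * X]mxE [X in phi X]mxE phi_p ?mulr0 //.
  by have /matrixP/(_ j i) := mx_exact0 (@Mexact m.+1); rewrite -map_mxM !mxE.
pose F x : R := phi (aug x).
have FD x y : F (x + y) = F x + F y by rewrite /F linearD rmorphD.
have FZ k x : F (k *: x) = phi (psi k) * F x by rewrite /F linearZ rmorphM.
have F0 : F 0 = 0 by rewrite /F linear0 rmorph0.
have FB x y : F (x - y) = F x - F y.
  by rewrite -[y in LHS](opprK y) opprK FD -scaleN1r FZ !rmorphN !rmorph1 mulN1r.
have Fsum (I : finType) (x : I -> L 0) : F (\sum_i x i) = \sum_i F (x i).
  exact: (big_morph F FD F0).
have FK x : x \in killsub p (L 0) -> F x = 0.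
  apply: (killsub_ind (U := fun x => F x = 0)).
    by split=> // a x' y' xE yE; rewrite FD FZ xE yE mulr0 addr0.
  by move=> k l pk; rewrite FZ phi_p // mul0r.
have Fsurj r : exists x, F x = r.
  have [a aE] := phi_surj r; have [x xE] := @lres_surj _ _ L a.
  by exists x; rewrite /F xE.
have [y yE] := choice (fun t => Fsurj (v 0 t)).
have Fmx a b (N : 'M[P]_(a, b)) (x : 'I_a -> L 0) t :
    F (mxact N^T x t) = ((\row_k F (x k)) *m map_mx phi (map_mx psi N)) 0 t.
  rewrite /mxact Fsum mxE; apply: eq_bigr => k _.
  by rewrite FZ !mxE mulrC.
have vE : v = \row_k F (y k) by apply/rowP => t; rewrite mxE yE.
have key t : exists y', mxact (M m.+1)^T y t - d 0 y' \in killsub p (L 0).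
  apply: killsub_exact0'; rewrite -[LHS]/(F (mxact (M m.+1)^T y t)) Fmx -vE vM.
  by rewrite mxE.
have [y' y'E] := choice key.
have [|w [w' wE]] := tensor_zigzag _ y'E; first by rewrite addn0.
exists (\row_k F (w k)); apply/rowP => t; rewrite -Fmx -yE.
apply/eqP; rewrite -subr_eq0 -FB; apply/eqP.
have Fd x : F (d 0 x) = 0 by rewrite /F lres_aug_diff rmorph0.
by have E1 := FK _ (wE t); rewrite [LHS]FB Fd subr0 in E1.
Qed.

End TensorWindow.

(** * The ring [S] and transfer along surjections *)

Section QuotientRing.
Variables (A : comNzRingType) (I : submodClosed A^o).
Hypothesis I1 : (1 : A^o) \notin I.

Let J : A -> bool := fun x => (x : A^o) \in I.

Lemma quotient_zmod_closed : zmod_closed J.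
Proof.
split=> [|x y xI yI]; first exact: rpred0.
have [_ IL] := is_submodule_mem I; rewrite addrC -[- y]mulN1r.
exact: (IL (-1) y x).
Qed.

Lemma quotient_proper : ring_quotient.proper_ideal J.
Proof. by split=> // a x; exact: (rpredZ a). Qed.

Lemma quotient_ring : exists (S : comNzRingType) (p : {rmorphism A -> S}),
  Defs.surjective p /\ forall x, p x = 0 <-> (x : A^o) \in I.
Proof.
pose Jz := GRing.isZmodClosed.Build A J quotient_zmod_closed.
pose Jp := isProperIdeal.Build A J quotient_proper.
pose K : idealr A := HB.pack J Jz Jp.
exists {ideal_quot K}, (\pi_{ideal_quot K})%qT; split=> [y|x].
  by exists (repr y); exact: reprK.
have E := Quotient.idealrBE K x 0; rewrite subr0 in E.
rewrite -[_ \in I]/(x \in K) E raddf0.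
by split=> /eqP.
Qed.

End QuotientRing.

Section Surjection.
Variables (A B : comNzRingType) (p : {rmorphism A -> B}).
Hypothesis p_surj : Defs.surjective p.

Lemma row_noetherian_surj : row_noetherian A -> row_noetherian B.
Proof.
move=> noethA n U HU.
have HV : is_submodule (fun v : 'rV[A]_n => U (map_mx p v)).
  case: HU => U0 UL; split=> [|a u v Uu Uv]; first by rewrite map_mx0.
  by rewrite map_mxD map_mxZ; apply: UL.
have [c [D DE]] := noethA _ _ HV; exists c, (map_mx p D) => v.
have [w <-] := mx_lift p_surj v; split=> [/DE[u ->]|[u uE]].
  by exists (map_mx p u); rewrite map_mxM.
have [u' u'E] := mx_lift p_surj u; rewrite uE -u'E -map_mxM.
by apply/DE; exists u'.
Qed.

Lemma local_at_surj (m : A -> Prop) :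
  local_at m -> (forall x, p x = 0 -> m x) ->
  local_at (fun y => exists2 x, m x & p x = y).
Proof.
case=> mS m1 mU pm; split.
- split=> [|b _ _ [u mu <-] [v mv <-]]; first by exists 0; [case: mS | rewrite rmorph0].
  have [a <-] := p_surj b; exists (a * u + v); last by rewrite rmorphD rmorphM.
  by case: mS => _; apply.
- case=> x mx px1; apply: m1; rewrite -[1](subrK x).
  apply: (@is_submoduleD A A^o m _ _ mS) => //; apply: pm.
  by rewrite rmorphB px1 rmorph1 subrr.
- move=> y; have [x <-] := p_surj y; move=> nm.
  have /mU[z xz] : ~ m x by move=> mx; apply: nm; exists x.
  by exists (p z); rewrite -rmorphM xz rmorph1.
Qed.

End Surjection.

(** * The residue field of a singular ring has infinite projective dimension *)

(** The terms with [a < b] cancel those with [b < a]. Vanishing on the diagonal is a separate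
    assumption because antisymmetry does not give it in characteristic 2. *)
Lemma antisym_sum (V : zmodType) e (F : 'I_e -> 'I_e -> V) :
  (forall a, F a a = 0) -> (forall a b, a != b -> F a b = - F b a) ->
  \sum_a \sum_b F a b = 0.
Proof.
move=> F0 FN.
have E : \sum_a \sum_b F a b = \sum_(a : 'I_e) \sum_(b : 'I_e | (a < b)%N) F a b
    + \sum_(a : 'I_e) \sum_(b : 'I_e | (b < a)%N) F a b.
  rewrite -big_split; apply: eq_bigr => a _ /=.
  rewrite (bigID (fun b : 'I_e => (a < b)%N)) /=; congr (_ + _).
  rewrite (bigID (fun b : 'I_e => (b < a)%N)) /= [X in _ + X]big1 ?addr0.
    by apply: eq_bigl => b; case: ltngtP.
  by move=> b; rewrite -!leqNgt -eqn_leq => /eqP/val_inj ->.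
rewrite E [X in _ + X](exchange_big_dep xpredT) //= -big_split /=; apply: big1 => a _.
rewrite -big_split; apply: big1 => b /= ab.
by rewrite FN ?addNr // neq_ltn ab.
Qed.

(** * The Koszul complex *)

Section Koszul.
Variables (A : comNzRingType) (e : nat) (x : 'I_e -> A).

(* The Koszul complex on [x], as the exterior algebra on ['I_e]: a function on
   [{set 'I_e}] gives the coefficients on the standard basis. *)
Local Notation K := ({set 'I_e} -> A^o).

(** The sign of moving [e_a] into its place in the ordered product over [B]. *)
Definition kos_sign (a : 'I_e) (B : {set 'I_e}) : A :=
  (-1) ^+ #|[set b in B | (b < a)%N]|.

Lemma kos_signK a B : kos_sign a B * kos_sign a B = 1.
Proof. by rewrite /kos_sign -expr2 sqrr_sign. Qed.

Lemma kos_sign_add a b (B : {set 'I_e}) : a \notin B ->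
  kos_sign b (a |: B) = (-1) ^+ (a < b)%N * kos_sign b B.
Proof.
move=> aB; rewrite /kos_sign -exprD; congr (_ ^+ _).
have [ab|ab] := boolP (a < b)%N.
  have -> : [set c in a |: B | (c < b)%N] = a |: [set c in B | (c < b)%N].
    by apply/setP => c; rewrite !inE; case: eqP => //= ->; rewrite ab.
  by rewrite cardsU1 inE (negbTE aB).
have -> : [set c in a |: B | (c < b)%N] = [set c in B | (c < b)%N] => //.
by apply/setP => c; rewrite !inE; case: eqP => //= ->; rewrite (negbTE ab) andbF.
Qed.

Lemma kos_signC a b (B : {set 'I_e}) : a != b -> a \notin B -> b \notin B ->
  kos_sign a B * kos_sign b (a |: B) = - (kos_sign b B * kos_sign a (b |: B)).
Proof.
move=> ab aB bB; rewrite !kos_sign_add //.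
rewrite mulrCA [in RHS]mulrCA [kos_sign b B * _]mulrC -mulNr; congr (_ * _).
have := ab; rewrite neq_ltn => /orP[] lt; rewrite lt ltnNge ltnW //=.
by rewrite expr1 expr0 opprK.
Qed.

Lemma kos_sign_swap a b (B : {set 'I_e}) : a != b -> a \notin B -> b \notin B ->
  kos_sign b (a |: B) * kos_sign a (b |: B) = - (kos_sign a B * kos_sign b B).
Proof.
move=> ab aB bB; rewrite !kos_sign_add // mulrACA [kos_sign b B * _]mulrC -[RHS]mulN1r.
congr (_ * _); have := ab; rewrite neq_ltn => /orP[] lt; rewrite lt ltnNge ltnW //=.
  by rewrite expr1 expr0 mulr1.
by rewrite expr1 expr0 mul1r.
Qed.

Definition kos (v : K) : K :=
  fun B => \sum_(a | a \notin B) kos_sign a B * x a * v (a |: B).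

Lemma kos_set0 v : kos v set0 = \sum_a x a * v [set a].
Proof.
rewrite /kos; apply: eq_big => a; first by rewrite inE.
move=> _; rewrite setU0 /kos_sign.
have -> : [set b : 'I_e in set0 | (b < a)%N] = set0 by apply/setP => b; rewrite !inE.
by rewrite cards0 expr0 mul1r.
Qed.

Lemma kos_linear : linear kos.
Proof.
move=> k u v; apply: funext => B; rewrite !fctE /kos scaler_sumr -big_split.
apply: eq_bigr => a _ /=; rewrite mulrDr; congr (_ + _).
by rewrite -[k *: u _]/(k * u _) -[k *: (_ * _)]/(k * _) mulrCA.
Qed.

HB.instance Definition _ := GRing.isLinear.Build A K K *:%R kos kos_linear.

Definition graded l (v : K) := forall B : {set 'I_e}, #|B| != l -> v B = 0.

Lemma graded0 l : graded l 0. Proof. by []. Qed.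

Lemma gradedB l u v : graded l u -> graded l v -> graded l (u - v).
Proof.
by move=> gu gv B Bl; rewrite -[(u - v) B]/(u B - v B) gu ?gv ?subrr.
Qed.

Lemma graded_sum l (I : finType) (c : I -> A) (v : I -> K) :
  (forall i, graded l (v i)) -> graded l (\sum_i c i *: v i).
Proof.
move=> gv B Bl; rewrite fct_sumE; apply: big1 => i _.
by rewrite -[LHS]/(c i * v i B) gv ?mulr0.
Qed.

Lemma graded_kos l v : graded l.+1 v -> graded l (kos v).
Proof.
move=> gv B Bl; apply: big1 => a aB; rewrite gv ?mulr0 //.
by rewrite cardsU1 aB add1n eqSS.
Qed.

Lemma graded_big l v : (e < l)%N -> graded l v -> v = 0.
Proof.
move=> el gv; apply: funext => B; apply: gv.
by rewrite neq_ltn (leq_ltn_trans (max_card _)) // card_ord.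
Qed.

Definition kos_basis (B : {set 'I_e}) : K := fun C => (C == B)%:R.

Lemma graded_basis (B : {set 'I_e}) : graded #|B| (kos_basis B).
Proof. by move=> C CB; rewrite /kos_basis; case: eqP => // CE; rewrite CE eqxx in CB. Qed.

Lemma kos_basis_sum (v : K) : v = \sum_B v B *: kos_basis B.
Proof.
apply: funext => C; rewrite fct_sumE (bigD1 C) //= big1 => [|B BC].
  by rewrite addr0 -[RHS]/(v C * (C == C)%:R) eqxx mulr1.
by rewrite -[LHS]/(v B * (C == B)%:R) eq_sym (negbTE BC) mulr0.
Qed.

Lemma kos_kos v : kos (kos v) = 0.
Proof.
apply: funext => B; rewrite /kos -[RHS]/0.
pose F a b : A := if (a \notin B) && (b \notin a |: B) then
  kos_sign a B * x a * (kos_sign b (a |: B) * x b * v (b |: (a |: B))) else 0.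
rewrite -[RHS](@antisym_sum _ _ F).
- rewrite big_mkcond; apply: eq_bigr => a _ /=; rewrite /F.
  case: ifP => aB; last by rewrite big1.
  by rewrite mulr_sumr big_mkcond.
- by move=> a; rewrite /F !inE eqxx andbF.
move=> a b ab; rewrite /F !inE !negb_or [b == a]eq_sym ab /=.
rewrite [(b \notin B) && _]andbC; case: ifP => [/andP[aB bB]|]; last by rewrite oppr0.
rewrite [a |: (b |: B)]setUCA; set w : A := v _.
have E := kos_signC ab aB bB.
transitivity (kos_sign a B * kos_sign b (a |: B) * (x a * x b * w)); first by ring.
by rewrite E; ring.
Qed.

Definition kos_wedge (a : 'I_e) (v : K) : K :=
  fun B => if a \in B then kos_sign a (B :\ a) * v (B :\ a) else 0.

Lemma graded_wedge a l v : graded l v -> graded l.+1 (kos_wedge a v).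
Proof.
move=> gv B Bl; rewrite /kos_wedge; case: ifP => // aB; rewrite gv ?mulr0 //.
by apply: contraNneq Bl => <-; rewrite (cardsD1 a B) aB.
Qed.

(** Wedging with [e_a] contracts multiplication by [x a]. At a set without [a] only the index [a]
    contributes; at a set containing [a] the other indices cancel by [kos_sign_swap]. *)
Lemma kos_homotopy a v : kos (kos_wedge a v) + kos_wedge a (kos v) = x a *: v.
Proof.
apply: funext => B; rewrite -[LHS]/(kos (kos_wedge a v) B + kos_wedge a (kos v) B).
rewrite -[RHS]/(x a * v B) /kos_wedge; have [aB|aB] := boolP (a \in B); last first.
  rewrite addr0 /kos (bigD1 a) //= big1 ?addr0 => [|b /andP[bB ba]].
    rewrite setU11 setU1K // mulrA; congr (_ * _).
    by rewrite mulrAC kos_signK mul1r.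
  by rewrite !inE eq_sym (negbTE ba) (negbTE aB) mulr0.
set C := B :\ a; have aC : a \notin C by rewrite !inE eqxx.
have BE : B = a |: C by rewrite setD1K.
rewrite [kos v C](bigD1 a) //= mulrDr.
rewrite -BE [X in _ + (X + _)]mulrA mulrA kos_signK mul1r addrCA -[RHS]addr0.
congr (_ + _); rewrite mulr_sumr /kos.
rewrite [X in _ + X](eq_bigl (fun b => b \notin B)) => [|b]; last first.
  by rewrite BE in_setU1 negb_or andbC.
rewrite -big_split; apply: big1 => b bB /=.
have ba : b != a by apply: contraNneq bB => ->.
have bC : b \notin C by apply: contra bB; rewrite !inE => /andP[].
have -> : (b |: B) :\ a = b |: C.
  by apply/setP => c; rewrite !inE; case: (eqVneq c b) => [->|]; rewrite ?ba.
rewrite !inE aB orbT {1}BE !mulrA -mulrDl.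
have -> : kos_sign b (a |: C) * x b * kos_sign a (b |: C) =
    kos_sign b (a |: C) * kos_sign a (b |: C) * x b by rewrite mulrAC.
by rewrite kos_sign_swap 1?eq_sym // mulNr addNr mul0r.
Qed.

End Koszul.

(** * Serre's embedding of the Koszul complex *)

Section ResidueFieldResolution.
Variables (A : comNzRingType) (m : A -> Prop).
Hypothesis locm : local_at m.
Variables (e : nat) (r : nat -> nat).
Local Notation n := (ranks e 1 r).
Variable D : forall i, 'M[A]_(n i.+1, n i).
Hypothesis Dexact : forall i, mx_exact (D i.+1) (D i).
Hypothesis Dmin : forall i, minimal_rows m (D i).
Hypothesis Dm : forall i j k, m (D i j k).
Hypothesis mgen : forall y, m y -> exists u : 'rV_e, y = (u *m (D 0 : 'M_(e, 1))) 0 0.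

Let x (a : 'I_e) : A := (D 0 : 'M_(e, 1)) a 0.
Local Notation K := ({set 'I_e} -> A^o).
Local Notation kos := (kos x).

Let msub : is_submodule (m : A^o -> Prop). Proof. by case: locm. Qed.
Let m1 : ~ m 1. Proof. by case: locm. Qed.
Let m0 : m 0. Proof. by case: msub. Qed.
Let mD y z : m y -> m z -> m (y + z).
Proof. exact: (@is_submoduleD A A^o m y z msub). Qed.
Let mM y z : m z -> m (y * z). Proof. exact: is_idealM. Qed.

(* Since the [x a] generate the maximal ideal, this is its square. *)
Definition msq (y : A) := exists2 u : 'I_e -> A, forall a, m (u a) & y = \sum_a u a * x a.

Lemma xm a : m (x a). Proof. exact: (@Dm 0%N a (0 : 'I_1)). Qed.

Lemma msq0 : msq 0.
Proof. by exists (fun=> 0) => //; rewrite big1 // => a _; rewrite mul0r. Qed.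

Lemma msqD y z : msq y -> msq z -> msq (y + z).
Proof.
case=> u um -> [v vm ->]; exists (fun a => u a + v a) => [a|]; first exact: mD.
by rewrite -big_split; apply: eq_bigr => a _; rewrite mulrDl.
Qed.

Lemma msq_sum (I : finType) (F : I -> A) : (forall i, msq (F i)) -> msq (\sum_i F i).
Proof. by move=> FP; apply: (big_ind msq) => //; [exact: msq0 | exact: msqD]. Qed.

Lemma mgen_fun y : m y -> exists u : 'I_e -> A, y = \sum_a u a * x a.
Proof. by move=> /mgen[u ->]; exists (fun a => u 0 a); rewrite mxE. Qed.

Lemma msqM y z : m y -> m z -> msq (y * z).
Proof.
move=> /mgen_fun[u ->] mz; exists (fun a => u a * z) => [a|]; first exact: mM.
by rewrite mulr_suml; apply: eq_bigr => a _; rewrite mulrAC.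
Qed.

Lemma msq_m y : msq y -> m y.
Proof.
case=> u _ ->; apply: (big_ind m) => // a _; apply: mM; exact: xm.
Qed.

(** The difference of the two expressions is a relation among minimal generators, so its
    coefficients are in [m]. *)
Lemma msq_coef (c : 'I_e -> A) : msq (\sum_a c a * x a) -> forall a, m (c a).
Proof.
case=> u um cu a; pose v : 'rV_e := \row_b (c b - u b).
have v0 : v *m (D 0 : 'M_(e, 1)) = 0.
  apply/rowP => k; rewrite ord1 !mxE.
  transitivity (\sum_b (c b * x b - u b * x b)).
    by apply: eq_bigr => b _; rewrite !mxE mulrBl.
  by rewrite sumrB cu subrr.
have := @Dmin 0%N v v0 a.
by rewrite mxE => /mD/(_ (um a)); rewrite subrK.
Qed.

(** For [a] in [C], the coefficient of [x a] in [kos v] at [C] without [a] is [v C] up to sign, so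
    [msq_coef] applies. *)
Lemma kos_msq l v : graded l.+1 v -> (forall B, msq (kos v B)) -> forall C, m (v C).
Proof.
move=> gv kv C; have [Cl|/gv-> //] := eqVneq #|C| l.+1.
have [a aC] : exists a, a \in C by apply/card_gt0P; rewrite Cl.
pose B := C :\ a; have aB : a \notin B by rewrite !inE eqxx.
pose c b : A := if b \notin B then @kos_sign A e b B * v (b |: B) else 0.
have /msq_coef/(_ a) : msq (\sum_b c b * x b).
  have := kv B; rewrite /kos big_mkcond; congr msq; apply: eq_bigr => b _.
  by rewrite /c; case: ifP => _; rewrite ?mul0r // mulrAC.
rewrite /c aB setD1K // => /(mM (@kos_sign A e a B)).
by rewrite mulrA kos_signK mul1r.
Qed.

Section Serre.
Variables (i : nat) (f : {set 'I_e} -> 'rV[A]_(n i)).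
Let F (v : K) : 'rV[A]_(n i) := \sum_B (v B : A) *: f B.

Lemma serre_linear : linear F.
Proof.
move=> k u v; rewrite /F scaler_sumr -big_split; apply: eq_bigr => B _ /=.
by rewrite -[(k *: u + v) B]/(k * u B + v B) scalerDl scalerA.
Qed.

Hypothesis Finj : forall v, graded i v -> (forall k, m (F v 0 k)) -> forall B, m (v B).

(** Injectivity modulo [m] lifts to the square: [v] is a sum of [x a *: w a], and [msq_coef] forces
    the images of the [w a], hence the [w a] themselves, into [m]. *)
Lemma serre_msq v : graded i v -> (forall k, msq (F v 0 k)) -> forall B, msq (v B).
Proof.
move=> gv Fv.
have vm := Finj gv (fun k => msq_m (Fv k)).
have [u uE] := choice (fun B => mgen_fun (vm B)).
pose w a : K := fun B => if #|B| == i then u B a else 0.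
have wg a : graded i (w a) by move=> B; rewrite /w => /negbTE->.
have vE : v = \sum_a x a *: w a.
  apply: funext => B; rewrite fct_sumE; have [Bi|Bi] := eqVneq #|B| i; last first.
    by rewrite gv // big1 // => a _; rewrite -[LHS]/(x a * w a B) wg ?mulr0.
  rewrite [LHS]uE; apply: eq_bigr => a _.
  by rewrite -[RHS]/(x a * w a B) /w Bi eqxx mulrC.
have FE : F v = \sum_a x a *: F (w a).
  pose G := lin_of serre_linear; rewrite vE -[LHS]/(G _) linear_sum.
  by apply: eq_bigr => a _; rewrite linearZ.
have wm a B : m (w a B).
  apply: Finj => // k; move: a; apply: msq_coef.
  have := Fv k; rewrite FE summxE; congr msq; apply: eq_bigr => a _.
  by rewrite mxE mulrC.
move=> B; rewrite vE fct_sumE; apply: msq_sum => a.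
rewrite -[msq _]/(msq (x a * w a B)); apply: msqM => //; exact: xm.
Qed.

End Serre.

(* Serre: the comparison map from the Koszul complex to the minimal resolution of
   the residue field is injective modulo [m], because [kos v] in [m^2 K] forces
   [v] in [m K]. *)
Lemma serre_embedding i : exists f : {set 'I_e} -> 'rV[A]_(n i),
  let F (v : K) := \sum_B (v B : A) *: f B in
  (forall v, graded i v -> (forall k, m (F v 0 k)) -> forall B, m (v B)) /\
  (forall v, graded i.+1 v -> exists u, F (kos v) = u *m D i).
Proof.
elim: i => [|i [f [Finj Flift]]].
  exists (fun=> const_mx 1); split=> [v gv Fv B|v gv].
    have [/eqP|Bn] := eqVneq #|B| 0%N; last by rewrite gv.
    rewrite cards_eq0 => /eqP->; have := Fv 0; rewrite summxE (bigD1 set0) //=.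
    rewrite big1 => [|C C0]; first by rewrite !mxE addr0 mulr1.
    by rewrite gv ?scale0r ?mxE // cards_eq0.
  exists (\row_a (v [set a] : A)); apply/rowP => k; rewrite ord1 summxE (bigD1 set0) //=.
  rewrite big1 => [|C C0]; last first.
    by rewrite (graded_kos x gv) ?scale0r ?mxE // cards_eq0.
  rewrite addr0 !mxE mulr1 kos_set0; apply: eq_bigr => a _.
  by rewrite mxE mulrC.
pose F (v : K) := \sum_B (v B : A) *: f B.
pose G : {linear K -> 'rV[A]_(n i)} := lin_of (serre_linear f).
have step (B : {set 'I_e}) : exists u : 'rV[A]_(n i.+1),
    (#|B| == i.+1 -> u *m D i = G (kos (kos_basis A B))) /\ (#|B| != i.+1 -> u = 0).
  have [/eqP Bi|Bi] := boolP (#|B| == i.+1); last by exists 0.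
  have [|u uE] := Flift (kos_basis A B); first by rewrite -Bi; exact: graded_basis.
  by exists u; split=> // _; exact: esym uE.
have [f' f'P] := choice step; exists f'.
pose F' (v : K) := \sum_B (v B : A) *: f' B.
have F'D v : graded i.+1 v -> F' v *m D i = G (kos v).
  move=> gv; rewrite [v in RHS]kos_basis_sum !linear_sum mulmx_suml.
  apply: eq_bigr => B _; rewrite !linearZ -scalemxAl.
  have [/eqP Bi|Bi] := boolP (#|B| == i.+1); first by rewrite (f'P B).1 ?Bi.
  by rewrite gv // scale0r; exact: esym (scale0r _).
split=> v gv => [F'v|].
  apply: (kos_msq gv); apply: (serre_msq Finj); first exact: graded_kos.
  have -> : \sum_B (kos v B : A) *: f B = F' v *m D i by rewrite F'D.
  move=> k; rewrite mxE.
  by apply: msq_sum => j; apply: msqM; [exact: F'v | exact: Dm].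
have /Dexact[u uE] : F' (kos v) *m D i = 0.
  by rewrite F'D ?kos_kos ?linear0 //; exact: graded_kos.
by exists u.
Qed.

(** The top Koszul basis vector has the coefficient 1 outside [m], which a map to a zero module
    could not detect. *)
Lemma resolution_koszul_rank : n e != 0%N.
Proof.
apply/eqP => ne0; have [f [Finj _]] := serre_embedding e.
apply: m1; have := Finj (kos_basis A setT) _ _ setT.
rewrite /kos_basis eqxx; apply.
  have := @graded_basis A e [set: 'I_e]; rewrite cardsT card_ord; exact.
by move=> k; exfalso; case: k => k; rewrite ne0.
Qed.

Lemma minimal_rank0 i : n i = 0%N -> n i.+1 = 0%N.
Proof.
move=> ni; apply/eqP; rewrite -leqn0 leqNgt; apply/negP => lt0.
pose k := Ordinal lt0; apply: m1.
have k0 : (delta_mx 0 k : 'rV_(n i.+1)) *m D i = 0.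
  by apply/rowP => -[j jn]; exfalso; move: jn; rewrite ni.
by have := @Dmin i _ k0 k; rewrite mxE !eqxx.
Qed.

(** An element of [m] kills the residue field, so multiplication by it on the resolution is
    null-homotopic; the homotopy is built upwards. *)
Lemma null_homotopic_up y i : m y ->
  exists s : 'M_(n i, n i.+1),
  match i return 'M[A]_(n i, n i.+1) -> Prop with
  | 0%N => fun s => y%:M = s *m D 0
  | j.+1 => fun s => exists s' : 'M_(n j, n j.+1), y%:M = s *m D j.+1 + D j *m s'
  end s.
Proof.
move=> my; elim: i => [|i [s sE]].
  have [u uE] := mgen my; exists u; apply/rowP => k.
  by rewrite (ord1 k) -uE !mxE eqxx mulr1n.
case: i => [|i] in s sE *.
  have [|s' s'E] := mx_exact_lift (N := y%:M - D 0 *m s) (@Dexact 0).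
    by rewrite mulmxBl -scalar_mxC -mulmxA -sE subrr.
  by exists s', s; rewrite -s'E subrK.
case: sE => s'' sE; have [|s' s'E] := mx_exact_lift (N := y%:M - D i.+1 *m s) (@Dexact i.+1).
  rewrite mulmxBl -scalar_mxC -mulmxA.
  have -> : s *m D i.+1 = y%:M - D i *m s'' by rewrite sE addrK.
  by rewrite mulmxBr mulmxA (mx_exact0 (@Dexact i)) mul0mx subr0 subrr.
by exists s', s; rewrite -s'E subrK.
Qed.

End ResidueFieldResolution.

(** * Depth, and acyclicity of the Koszul complex *)

Section InfiniteResolution.
Variables (A : comNzRingType) (m : A -> Prop).
Hypothesis locm : local_at m.
Variables (e : nat) (r : nat -> nat).
Local Notation n := (ranks e 1 r).
Variable D : forall i, 'M[A]_(n i.+1, n i).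
Hypothesis Dexact : forall i, mx_exact (D i.+1) (D i).
Hypothesis Dmin : forall i, minimal_rows m (D i).
Hypothesis Dm : forall i j k, m (D i j k).
Hypothesis mgen : forall y, m y -> exists u : 'rV_e, y = (u *m (D 0 : 'M_(e, 1))) 0 0.

Let x (a : 'I_e) : A := (D 0 : 'M_(e, 1)) a 0.
Local Notation K := ({set 'I_e} -> A^o).
Local Notation kos := (kos x).

Definition mx_coboundary j : forall l, 'M[A]_(n j, l) -> Prop :=
  match j return forall l, 'M[A]_(n j, l) -> Prop with
  | 0%N => fun l h => h = 0
  | j'.+1 => fun l h => exists W, h = D j' *m W
  end.

Lemma mx_coboundary_ker j l (h : 'M_(n j, l)) : mx_coboundary h -> D j *m h = 0.
Proof.
case: j => [|j] in h *; first by move=> ->; rewrite mulmx0.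
by case=> W ->; rewrite mulmxA (mx_exact0 (@Dexact j)) mul0mx.
Qed.

Lemma mx_coboundary_exact j l (h : 'M_(n j, l)) :
  dual_exact D A^o j -> D j *m h = 0 -> mx_coboundary h.
Proof.
by move=> ex Dh; have := dual_exact_cols ex Dh; case: j {ex Dh} h.
Qed.

Lemma mx_coboundary_mulr j l k (h : 'M_(n j, l)) (N : 'M_(l, k)) :
  mx_coboundary h -> mx_coboundary (h *m N).
Proof.
case: j => [|j] in h *; first by move=> ->; rewrite /= mul0mx.
by case=> W ->; exists (W *m N); rewrite mulmxA.
Qed.

Section Depth.
Variables (t c : nat).
Hypothesis dual_lt : forall j, (j < t)%N -> dual_exact D A^o j.

(** Descends the diagonal of the double complex [Hom(G_j, G_l)] to [j = 0], using exactness of the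
    dual below [t] in the first index and of the resolution in the second. *)
Lemma hom_zigzag j (h : 'M_(n j, n (j + c).+1)) : (j <= t)%N ->
  mx_coboundary (h *m D (j + c)) ->
  exists g : 'M_(n j, n (j + c).+2), mx_coboundary (h - g *m D (j + c).+1).
Proof.
elim: j => [|j IHj] in h *; move=> jt.
  by move=> /(mx_exact_lift (@Dexact c))[g gE]; exists g; rewrite /= -gE subrr.
case=> h' hE.
have [||g' g'c] := IHj h'; first exact: ltnW.
  apply: mx_coboundary_exact (dual_lt jt) _.
  by rewrite mulmxA -hE -mulmxA (mx_exact0 (@Dexact (j + c))) mulmx0.
have [|g gE] := mx_exact_lift (N := h - D j *m g') (@Dexact (j + c).+1).
  rewrite mulmxBl [X in X - _]hE -mulmxA -mulmxBr.
  exact: (mx_coboundary_ker g'c).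
by exists g, g'; rewrite /= -gE opprB addrC subrK.
Qed.

(** Applying the null-homotopy of [y] to a cocycle: [m] annihilates [Ext(k, A)], with [k] the
    residue field. *)
Lemma coboundary_smul y (f : 'cV_(n t)) : m y -> D t *m f = 0 ->
  mx_coboundary (y *: f).
Proof.
move=> my Df; have [s sE] := null_homotopic_up Dexact mgen t my.
case: t dual_lt f Df s sE => [|t'] _ f Df s /=.
  by move=> sE; rewrite -mul_scalar_mx sE -mulmxA Df mulmx0.
case=> s' sE; exists (s' *m f).
by rewrite -mul_scalar_mx sE mulmxDl -mulmxA Df mulmx0 add0r mulmxA.
Qed.

Lemma coboundary_outer l (f : 'cV_(n t)) (w : 'rV_l) : D t *m f = 0 ->
  (forall k, m (w 0 k)) -> mx_coboundary (f *m w).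
Proof.
move=> Df wm; have cb k := coboundary_smul (wm k) Df.
case: t dual_lt f Df cb => [|t'] _ f Df /= cb.
  by apply/matrixP => i k; have /matrixP/(_ i 0) := cb k; rewrite !mxE big_ord1 mulrC.
have [W WE] := choice cb; exists (\matrix_(i, k) W k i 0); apply/matrixP => i k.
have /matrixP/(_ i 0) := WE k; rewrite !mxE big_ord1 mulrC => ->.
by apply: eq_bigr => j _; rewrite !mxE.
Qed.

(* Auslander-Buchsbaum: for a cocycle [f] of degree [t] and a basis vector [u] of
   the last module of the resolution, the composite of [f *m u] with the last
   differential, whose entries lie in [m], is a coboundary; by [hom_zigzag], so is
   [f *m u]. *)
Lemma dual_exact_below : n (t + c).+1 != 0%N -> n (t + c).+2 = 0%N ->
  dual_exact D A^o t.
Proof.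
rewrite -lt0n => n_gt0 n0; pose k0 := Ordinal n_gt0.
suff cb (f : 'cV_(n t)) : D t *m f = 0 -> mx_coboundary f.
  have cb' (v : 'I_(n t) -> A^o) : mxact (D t) v = 0 -> mx_coboundary (\col_i (v i : A)).
    move=> Dv; apply: cb; apply/colP => i.
    transitivity (mxact (D t) v i); last by rewrite Dv mxE.
    by rewrite mxE; apply: eq_bigr => j _; rewrite mxE.
  case: t cb' => [|t'] cb' v /cb' /=.
    by move=> vE; apply: funext => i; have /colP/(_ i) := vE; rewrite !mxE.
  case=> W vE; exists (fun j => W j 0); apply: funext => i.
  by have /colP/(_ i) := vE; rewrite !mxE.
move=> Df; pose u : 'rV[A]_(n (t + c).+1) := delta_mx 0 k0.
have [|g] := @hom_zigzag t (f *m u) (leqnn t).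
  rewrite -mulmxA -rowE; apply: coboundary_outer => // k.
  by rewrite mxE.
have -> : g *m D (t + c).+1 = 0.
  apply/matrixP => i k; rewrite !mxE; apply: big1 => j _; exfalso.
  by case: j => j; rewrite n0.
have fE : f = f *m u *m delta_mx k0 0.
  by rewrite -mulmxA mul_delta_mx; apply/colP => i; rewrite mxE big_ord1 mxE !eqxx mulr1.
rewrite subr0 => hc.
by rewrite fE; apply: mx_coboundary_mulr.
Qed.

End Depth.

Section KoszulAcyclic.
Hypothesis dual_lt : forall j, (j < e)%N -> dual_exact D A^o j.
Variable s : nat.
Hypothesis s_gt0 : (0 < s)%N.
Hypothesis kos_exact_gt : forall l z, (s < l)%N -> graded l z -> kos z = 0 ->
  exists2 w, graded l.+1 w & z = kos w.

Definition kos_coboundary l j : ('I_(n j) -> K) -> Prop :=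
  match j return ('I_(n j) -> K) -> Prop with
  | 0%N => fun y => y = 0
  | j'.+1 => fun y => exists2 b : 'I_(n j') -> K,
      forall i, graded l (b i) & y = mxact (D j') b
  end.

(** Dual exactness is applied to each coefficient; choosing 0 off degree [l] keeps the solution
    homogeneous. *)
Lemma kos_dual_exact l j (y : 'I_(n j) -> K) : (j < e)%N ->
  (forall i, graded l (y i)) -> mxact (D j) y = 0 -> kos_coboundary l y.
Proof.
move=> je gy Dy.
have DyB B : mxact (D j) (fun i => y i B) = 0.
  apply: funext => i; have := congr1 (fun f : 'I_(n j.+1) -> K => f i B) Dy.
  by rewrite /mxact fct_sumE.
have := dual_lt je; case: j {je} => [|j] in y gy Dy DyB * => ex /=.
  apply: funext => i; apply: funext => B.
  exact: (congr1 (@^~ i) (ex _ (DyB B))).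
have key (B : {set 'I_e}) : exists b, (#|B| != l -> b = 0) /\ (fun i => y i B) = mxact (D j) b.
  have [Bl|Bl] := boolP (#|B| == l); first by have [b bE] := ex _ (DyB B); exists b.
  by exists 0; split=> //; rewrite linear0; apply: funext => i; exact: gy.
have [b bE] := choice key; exists (fun i B => b B i).
  by move=> i B /(bE B).1 ->.
apply: funext => i; apply: funext => B; rewrite /mxact fct_sumE.
exact: (congr1 (@^~ i) (bE B).2).
Qed.

(** The index [j] climbs until it reaches [e], where the Koszul degree [j + s] exceeds [e] because
    [s] is positive and everything is zero. Each climb uses Koszul exactness in a degree above [s];
    each return uses [kos_dual_exact]. *)
Lemma kos_zigzag k j (y y' : _ -> K) : (e <= j + k)%N ->
  (forall i : 'I_(n j), graded (j + s) (y i)) ->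
  (forall i : 'I_(n j.+1), graded (j + s).+1 (y' i)) ->
  mxact (D j) y = kos \o y' ->
  exists2 w : 'I_(n j) -> K, forall i, graded (j + s).+1 (w i) &
    kos_coboundary (j + s) (y - (kos \o w)).
Proof.
have trivial_case j0 (y0 : 'I_(n j0) -> K) : (e <= j0)%N ->
    (forall i, graded (j0 + s) (y0 i)) -> exists2 w : 'I_(n j0) -> K,
    forall i, graded (j0 + s).+1 (w i) & kos_coboundary (j0 + s) (y0 - (kos \o w)).
  move=> ej gy; exists 0; first by move=> i; exact: graded0.
  have -> : y0 - (kos \o 0) = 0.
    apply: funext => i; have y0i : y0 i = 0.
      apply: (graded_big _ (gy i)); apply: leq_ltn_trans ej _.
      by rewrite -[X in (X < _)%N]addn0 ltn_add2l.
    by rewrite -[LHS]/(y0 i - kos 0) linear0 y0i subr0.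
  case: j0 {ej gy y0} => [|j0] //=; exists 0; first by move=> i; exact: graded0.
  by rewrite linear0.
elim: k => [|k IHk] in j y y' *; move=> ejk gy gy' Dy.
  by apply: trivial_case => //; rewrite -[j]addn0.
have [/trivial_case|je] := leqP e j; first exact.
have kosDy : forall i, exists2 w, graded (j + s).+2 w & mxact (D j.+1) y' i = kos w.
  move=> i; apply: kos_exact_gt.
  - by rewrite ltnS leq_addl.
  - exact: graded_sum.
  have -> : kos (mxact (D j.+1) y' i) = mxact (D j.+1) (kos \o y') i.
    exact: (congr1 (@^~ i) (mxact_lin _ _ _)).
  by rewrite -Dy -mxactM (mx_exact0 (@Dexact j)) mxact0l.
have [y'' y''E] : exists y'' : 'I_(n j.+2) -> K, forall i,
    graded (j + s).+2 (y'' i) /\ mxact (D j.+1) y' i = kos (y'' i).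
  have key i : exists w, graded (j + s).+2 w /\ mxact (D j.+1) y' i = kos w.
    by have [w] := kosDy i; exists w.
  by have [w wE] := choice key; exists w.
have [|i|||w' gw' [b gb bE]] := IHk j.+1 y' y''.
- by rewrite addSnnS.
- exact: gy'.
- by move=> i; exact: (y''E i).1.
- by apply: funext => i; exact: (y''E i).2.
exists b => //; apply: kos_dual_exact => //.
  by move=> i; apply: gradedB => //; apply: graded_kos; exact: gb.
rewrite linearB /= Dy -mxact_lin -bE.
apply: funext => i; rewrite -[LHS]/(kos (y' i) - kos (y' i - kos (w' i))).
have -> : kos (y' i - kos (w' i)) = kos (y' i) by rewrite linearB /= kos_kos subr0.
exact: subrr.
Qed.

(* [x a *: z] is a boundary, so that [z] extends to a chain map from the resolution
   of the residue field to the shifted Koszul complex; it is null-homotopic. *)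
Lemma kos_exact_step z : graded s z -> kos z = 0 -> exists2 w, graded s.+1 w & z = kos w.
Proof.
move=> gz kz.
have [||i||w gw /= wE] := @kos_zigzag e 0 (fun=> z) (fun a => kos_wedge a z).
- by [].
- by move=> _.
- exact: graded_wedge.
- apply: funext => a; have := kos_homotopy x a z; rewrite kz.
  have -> : kos_wedge a (0 : K) = 0.
    by apply: funext => B; rewrite /kos_wedge; case: ifP => // _; rewrite mulr0.
  by rewrite addr0 /= => ->; rewrite /mxact big_ord1.
exists (w ord0); first exact: gw.
have E : z - kos (w ord0) = 0 := congr1 (@^~ ord0) wE.
by apply/eqP; rewrite -subr_eq0 E.
Qed.

End KoszulAcyclic.

Lemma koszul_acyclic : (forall j, (j < e)%N -> dual_exact D A^o j) ->
  forall s z, (0 < s)%N -> graded s z -> kos z = 0 ->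
  exists2 w, graded s.+1 w & z = kos w.
Proof.
(* Descending induction on the degree [s], which starts above [e] where homogeneous elements
   vanish. *)
move=> dual_lt s; have [k] := ubnP (e.+1 - s); elim: k => // k IHk in s *.
move=> esk z s_gt0; have [es|se] := ltnP e s.
  move=> /(graded_big es) -> _; exists 0; first exact: graded0.
  by rewrite linear0.
apply: kos_exact_step => // l z' sl gz' kz'; apply: (IHk l) => //.
  move: esk; rewrite !ltnS => esk; apply: leq_trans esk.
  by rewrite ltn_sub2l // ltnS.
exact: leq_trans sl.
Qed.

Lemma infinite_resolution v : graded 1%N v -> kos v = 0 ->
  (forall w, graded 2%N w -> v != kos w) -> forall i, n i != 0%N.
Proof.
move=> gv kv nv i; apply/negP => /eqP ni.
have exi : exists i, n i == 0%N by exists i; rewrite ni.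
(* As [n 0] is 1, the first vanishing rank has the form [n N.+1], and [N] is the length of the
   resolution. *)
case: (ex_minnP exi) => -[|N] /eqP nN Nmin; first by [].
have n_lt j : (j <= N)%N -> n j != 0%N.
  by move=> jN; apply/negP => /Nmin; rewrite leqNgt ltnS jN.
have eN : (e <= N)%N.
  rewrite leqNgt; apply/negP => Ne.
  have zero k : n (k + N.+1) = 0%N.
    by elim: k => [|k IHk]; [rewrite nN | apply: (minimal_rank0 locm Dmin)].
  have := zero (e - N.+1)%N; rewrite subnK // => ne.
  by have := resolution_koszul_rank locm Dexact Dmin Dm mgen; rewrite ne.
(* Strong induction on [t]: exactness of the dual in lower degrees is what [dual_exact_below]
   requires. *)
have dual_lt t : (t < N)%N -> dual_exact D A^o t.
  have [k] := ubnP t; elim: k => // k IHk in t *; move=> tk tN.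
  have NE : N = (t + (N - t.+1)).+1 by rewrite -addSn subnKC.
  apply: (@dual_exact_below t (N - t.+1)); rewrite -?NE //; last exact: n_lt.
  move=> j jt; apply: IHk; last exact: ltn_trans tN.
  by apply: leq_trans jt _; rewrite -ltnS.
have [w gw vE] := @koszul_acyclic (fun j je => dual_lt j (leq_trans je eN)) 1 v isT gv kv.
by have /eqP := nv w gw; apply.
Qed.

End InfiniteResolution.

(** * Construction of the complex *)

Section MatrixComplex.
Variable A : comNzRingType.
Variables (n : int -> nat) (N : forall i, 'M[A]_(n i, n (i - 1))).
Hypothesis Nexact : forall i, mx_exact (N i) (N (i - 1)).
Hypothesis Ndual : forall i, mx_exact (N (i - 1))^T (N i)^T.
Hypothesis Nmax : forall i j k, N i j k \in max_ideal A.
Hypothesis n_neq0 : exists i, n i != 0%N.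

Lemma mx_complex_diff2 i (x : 'rV_(n i)) : mx_lin (N (i - 1)) (mx_lin (N i) x) = 0.
Proof. by rewrite /mx_lin /= -mulmxA (mx_exact0 (@Nexact i)) mulmx0. Qed.

Definition mx_complex : complex A :=
  @Complex A (fun i => 'rV[A]_(n i)) (fun i => mx_lin (N i)) mx_complex_diff2.

Lemma mx_complex_dual : dual_acyclic mx_complex.
Proof.
move=> i f; split=> [f0|[h <-]]; last first.
  apply/precomp_eq0 => v.
  rewrite -[LHS]/(of_hom h (mx_lin (N (i - 1)) (mx_lin (N i) v))).
  by rewrite mx_complex_diff2 linear0.
pose F : {linear 'rV[A]_(n (i - 1)) -> A^o} := of_hom f.
pose u : 'rV[A]_(n (i - 1)) := \row_k F (delta_mx 0 k).
have FE v : F v = (v *m u^T) 0 0.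
  rewrite {1}[v]row_sum_delta linear_sum mxE; apply: eq_bigr => k _.
  by rewrite linearZ !mxE.
have Fd v : F (v *m N i) = 0.
  by move/precomp_eq0: f0 => /(_ v).
have /Ndual[w wE] : u *m (N i)^T = 0.
  apply: trmx_inj; rewrite trmx_mul trmxK trmx0; apply/colP => k.
  have := Fd (delta_mx 0 k); rewrite FE -rowE -row_mul => E.
  by rewrite [RHS]mxE; move: E; rewrite mxE.
have hL : linear (fun v : 'rV[A]_(n (i - 1 - 1)) => (v *m w^T) 0 0 : A^o).
  by move=> a y z; rewrite mulmxDl -scalemxAl !mxE.
exists (to_hom (lin_of hL)); apply: val_inj; apply: funext => v.
rewrite -[RHS]/(F v) FE wE trmx_mul trmxK mulmxA.
by [].
Qed.

Lemma nontrivial_mx_complex : exists C : complex A, nontrivial_totally_acyclic C.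
Proof.
exists mx_complex; split.
- split=> [i|i v|]; last exact: mx_complex_dual.
    by exists (n i), idfun; exists idfun.
  by rewrite [X in X <-> _](@Nexact i v); split=> -[u uE]; exists u.
- move=> i x; rewrite -[cx_diff _ _ _]/(x *m N i) [x *m N i]row_sum_delta.
  apply: rpred_sum => k _; apply: gensub_mem.
  exists ((x *m N i) 0 k), (delta_mx 0 k); split=> //.
  rewrite mxE; apply: rpred_sum => j _.
  exact: (rpredZ (x 0 j) (@Nmax i j k)).
have [i ni] := n_neq0; exists i => triv.
have k : 'I_(n i) by case: (n i) ni => // l _; exact: ord0.
have := triv (const_mx 1 : 'rV[A]_(n i)) => /rowP/(_ k); rewrite !mxE => /eqP.
by rewrite oner_eq0.
Qed.

End MatrixComplex.

(** * Splicing a dual resolution with a resolution of its kernel *)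

Section Splice.
Variables (S : comNzRingType) (m : S -> Prop).
Hypotheses (noethS : row_noetherian S) (locm : local_at m).
Variables (f : nat -> nat) (D : forall i, 'M[S]_(f i.+1, f i)).
Hypothesis Dm : forall i j k, m (D i j k).
Variable K : nat.
Hypothesis Ddual : forall i, (K <= i)%N -> mx_exact (D i)^T (D i.+1)^T.

(* In degrees [<= -1] the complex is the dual of [D], truncated; in degrees [>= 0]
   it is a minimal resolution of the kernel of the first map. *)
Definition splice_rank c r (i : int) : nat :=
  match i with Posz k => ranks c (f K.+1) r k | Negz k => f (k.+1 + K.+1) end.

Lemma splice : exists (x : int -> nat) (d : forall i j, 'M[S]_(x i, x j)),
  [/\ x 0 = f K.+1, forall i j l, j = i - 1 -> l = j - 1 -> mx_exact (d i j) (d j l) &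
      forall i s t, m (d i (i - 1) s t)].
Proof.
pose D0 := (D K.+1)^T.
have [c [G0 [G0ker G0min]]] := minimal_generators noethS locm (is_submodule_ker D0).
have [r [G [G0E Gex Gmin]]] := minimal_resolution G0 noethS locm.
pose x := splice_rank c r.
(* With two free indices, [i - 1] can be rewritten instead of cast; [conform_mx] returns the default
   0 only when the sizes do not match. *)
pose d i j : 'M[S]_(x i, x j) :=
  match i return 'M[S]_(x i, x j) with
  | Posz 0%N => conform_mx 0 (D K.+1)^T
  | Posz k.+1 => conform_mx 0 (G k)
  | Negz k => conform_mx 0 (D (k.+1 + K.+1))^T
  end.
have m0 : m 0 by case: locm => -[].
have dP k : d k.+1%:Z k%:Z = G k by exact: conform_mx_id.
have d0 : d 0%:Z (Negz 0) = (D K.+1)^T by exact: conform_mx_id.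
have dN k : d (Negz k) (Negz k.+1) = (D (k.+1 + K.+1))^T by exact: conform_mx_id.
have predP k : k.+1%:Z - 1 = k%:Z by rewrite -addn1 PoszD addrK.
have pred0 : 0%:Z - 1 = Negz 0 by [].
have predN k : Negz k - 1 = Negz k.+1 by rewrite !NegzE -opprD -PoszD addn1.
(* Minimality at the joint: the rows of [G0] lie in the kernel of the transpose of [D K.+1], hence
   in the row space of the transpose of [D K], whose entries are in [m]. This is why the truncation
   is one step beyond [K]. *)
have Gm k s t : m (G k s t).
  case: k s t => [|k] s t.
    have [u uE] : exists u, row s G0 = u *m (D K)^T.
      apply/(Ddual (leqnn K)); rewrite -row_mul.
      have -> : G0 *m (D K.+1)^T = 0 by exact: (mx_exact0 G0ker).
      by rewrite row0.
    have -> : G 0%N s t = (u *m (D K)^T) 0 t by rewrite -uE G0E mxE.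
    rewrite mxE; case: locm => msub _ _; apply: (is_ideal_sum msub) => j.
    by rewrite mxE; apply: (is_idealM msub).
  case: k s t => [|k] s t.
    by apply: (minimal_entries (M' := G 0%N)) (mx_exact0 (Gex 0%N)) _ _; rewrite G0E.
  exact: (minimal_entries (Gmin k) (mx_exact0 (Gex k.+1))).
exists x, d; split=> //.
- move=> i j l -> -> {j l}; case: i => [[|[|k]]|k].
  + rewrite pred0 predN d0 dN; exact: Ddual.
  + rewrite !predP pred0 dP d0 G0E; exact: G0ker.
  + rewrite !predP !dP; exact: Gex.
  + rewrite !predN !dN; apply: Ddual; exact: leq_trans (leqnSn K) (leq_addl _ _).
case=> [[|k]|k].
- by rewrite pred0 d0 => s t; rewrite mxE.
- by rewrite predP dP => s t; exact: Gm.
by rewrite predN dN => s t; rewrite mxE.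
Qed.

End Splice.

(** * A nonzero Koszul homology class over [S] *)

Lemma ideal_square (A : comNzRingType) e (D : 'M[A]_(e, 1)) :
  row_space (fun v => v 0 0 \in max_ideal A) D ->
  forall y, y \in ideal_mul (max_ideal A) (max_ideal A) ->
  exists u : 'rV_e, (forall a, u 0 a \in max_ideal A) /\ y = (u *m D) 0 0.
Proof.
move=> Dm y.
have HU : is_submodule (fun y : A^o =>
    exists u : 'rV_e, (forall a, u 0 a \in max_ideal A) /\ y = (u *m D) 0 0).
  split=> [|k _ _ [u [um ->]] [v [vm ->]]].
    by exists 0; split=> [a|]; rewrite ?mul0mx mxE ?rpred0.
  exists (k *: u + v); split=> [a|]; last by rewrite mulmxDl -scalemxAl !mxE.
  by rewrite !mxE rpredD //; exact: (rpredZ k (um a)).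
move=> yI; apply/(submod_ofP HU).
apply: (gensub_min (U := submod_of HU)) yI => _ [a [b [am bm ->]]]; apply/submod_ofP.
have /Dm[w wE] : (const_mx a : 'rV[A]_1) 0 0 \in max_ideal A by rewrite mxE.
exists (b *: w); split=> [k|].
  rewrite mxE mulrC.
  exact: (@is_submoduleZ A A^o _ (w 0 k) b (@max_ideal_submodule A) bm).
by rewrite -scalemxAl -wE !mxE -[LHS]/(a * b) mulrC.
Qed.

(* For [y] in [I] outside of [max_ideal P * I], write [y] as the sum of the
   [u a * D a]; then [u] gives a cycle over [S].  If it were a boundary, [u] would
   agree modulo [I] with a Koszul boundary over [P], and [y] would lie in
   [max_ideal P * I]. *)
Lemma koszul_not_exact (P S : comNzRingType) (p : {rmorphism P -> S})
    (I : submodClosed P^o) e (D : 'M[P]_(e, 1)) :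
  Defs.surjective p -> (forall x, p x = 0 <-> (x : P^o) \in I) ->
  row_noetherian P -> local_at (fun x => x \in max_ideal P) ->
  row_space (fun v => v 0 0 \in max_ideal P) D ->
  (exists2 x : P^o, x \in I & x != 0) ->
  {subset I <= ideal_mul (max_ideal P) (max_ideal P)} ->
  exists v : {set 'I_e} -> S^o, let x a := p (D a 0) in
  [/\ graded 1%N v, kos x v = 0 & forall w, graded 2%N w -> v != kos x w].
Proof.
move=> p_surj pI noethP locm Dm [y0 y0I y0n] Imm.
have HI : is_submodule (fun v : 'rV[P]_1 => (v 0 0 : P^o) \in I).
  split=> [|k u v uI vI]; first by rewrite mxE rpred0.
  rewrite !mxE rpredD //; exact: (rpredZ k uI).
have [c [Y [YI Ymin]]] := minimal_generators noethP locm HI.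
have [k0 _] : exists k : 'I_c, True.
  case: c Y YI {Ymin} => [|c] Y YI; last by exists ord0.
  have /YI[u uE] : (const_mx y0 : 'rV[P]_1) 0 0 \in I by rewrite mxE.
  case/eqP: y0n; have := congr1 (fun v : 'rV_1 => v 0 0) uE.
  by rewrite !mxE big_ord0.
have yI : (row k0 Y) 0 0 \in I by apply/YI; exists (delta_mx 0 k0); rewrite -rowE.
have [u [um uE]] := ideal_square Dm (Imm _ yI).
pose x a := p (D a 0).
pose v : {set 'I_e} -> S^o := \sum_a (p (u 0 a) : S) *: kos_basis S [set a].
have vE a : v [set a] = p (u 0 a).
  rewrite /v fct_sumE (bigD1 a) //= big1 => [|b ba].
    by rewrite addr0 -[LHS]/(p (u 0 a) * ([set a] == [set a])%:R) eqxx mulr1.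
  rewrite -[LHS]/(p (u 0 b) * ([set a] == [set b])%:R) eqEsubset !sub1set !inE.
  by rewrite eq_sym (negbTE ba) mulr0.
have gv : graded 1%N v.
  by apply: graded_sum => a; rewrite -(cards1 a); exact: graded_basis.
exists v; split=> //.
  apply: funext => B; have [/eqP|Bn] := eqVneq #|B| 0%N; last exact: (graded_kos x gv).
  rewrite cards_eq0 => /eqP->; rewrite kos_set0.
  transitivity (p ((row k0 Y) 0 0)); last exact/pI.
  rewrite uE mxE rmorph_sum; apply: eq_bigr => a _.
  by rewrite vE rmorphM mulrC.
move=> w gw; apply/eqP => vw.
have [l lE] := choice (fun B => p_surj (w B)).
pose w' : {set 'I_e} -> P^o := fun B => if #|B| == 2%N then l B else 0.
have pw' B : p (w' B) = w B.
  by rewrite /w'; case: eqP => [//|/eqP Bn]; rewrite gw // rmorph0.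
pose z := kos (fun a => D a 0) w'.
have zI a : u 0 a - z [set a] \in I.
  apply/pI; rewrite rmorphB -vE vw; apply/eqP; rewrite subr_eq0; apply/eqP.
  rewrite /z /kos rmorph_sum; apply: eq_bigr => b _.
  by rewrite !rmorphM pw' /kos_sign rmorphXn rmorphN rmorph1.
(* The Koszul differential squares to zero already over [P], so replacing [u] by [u - z] does not
   change the element of [I] it represents. *)
have z0 : \sum_a D a 0 * z [set a] = 0 by rewrite -kos_set0 kos_kos.
have key a : exists t : 'rV_c, u 0 a - z [set a] = (t *m Y) 0 0.
  have /YI[t tE] : (const_mx (u 0 a - z [set a]) : 'rV[P]_1) 0 0 \in I by rewrite mxE.
  by exists t; rewrite -tE mxE.
have [t tE] := choice key.
(* The chosen generator of [I] becomes a combination of the rows of [Y] with coefficients in the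
   maximal ideal, contradicting minimality of [Y]. *)
pose T := \sum_a D a 0 *: t a.
have YT : (delta_mx 0 k0 - T) *m Y = 0.
  apply/rowP => i; rewrite (ord1 i) mulmxBl -rowE mulmx_suml.
  transitivity ((row k0 Y) 0 0 - \sum_a (D a 0 * (t a *m Y) 0 0)).
    rewrite mxE [X in _ + X]mxE summxE; congr (_ - _); apply: eq_bigr => a _.
    by rewrite -scalemxAl mxE.
  rewrite uE mxE; under [X in _ - X]eq_bigr do rewrite -tE mulrBr.
  rewrite sumrB z0 subr0 mxE; apply/eqP; rewrite subr_eq0; apply/eqP.
  by apply: eq_bigr => a _; rewrite mulrC.
have := Ymin _ YT k0; rewrite !mxE !eqxx summxE => m1.
case: locm => [msub n1 _]; apply: n1.
rewrite -[1](subrK (\sum_a (D a 0 *: t a) 0 k0)).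
apply: (@is_submoduleD P P^o _ _ _ msub) => //.
apply: (is_ideal_sum msub) => a; rewrite mxE mulrC; apply: (is_idealM msub).
have -> : D a 0 = (row a D) 0 0 by rewrite mxE.
by apply/Dm; exists (delta_mx 0 a); rewrite rowE.
Qed.

(** A relation over [S] lifts to one holding modulo the square of the maximal ideal. Subtracting
    coefficients [w] in that ideal makes it exact over [P], where [D] is minimal. *)
Lemma koszul_minimal (P S : comNzRingType) (p : {rmorphism P -> S})
    e (D : 'M[P]_(e, 1)) :
  Defs.surjective p ->
  (forall x, p x = 0 -> x \in ideal_mul (max_ideal P) (max_ideal P)) ->
  row_space (fun v => v 0 0 \in max_ideal P) D ->
  minimal_rows (fun x => x \in max_ideal P) D ->
  minimal_rows (fun y => exists2 x, x \in max_ideal P & p x = y) (map_mx p D).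
Proof.
move=> p_surj pm Dm Dmin v; have [u <-] := mx_lift p_surj v.
rewrite -map_mxM => /rowP/(_ 0); rewrite !mxE => pu0 i.
have [|w [wm wE]] := ideal_square Dm (y := (u *m D) 0 0).
  by apply: pm; rewrite mxE.
have uwD : (u - w) *m D = 0.
  apply/rowP => j; rewrite (ord1 j) mulmxBl mxE wE.
  by rewrite [X in _ + X]mxE subrr mxE.
exists (u 0 i); last by rewrite mxE.
rewrite -[u 0 i](subrK (w 0 i)) rpredD //.
by have := Dmin _ uwD i; rewrite !mxE.
Qed.

Theorem theorem2p4 (P Q R : comNzRingType)
    (phi : {rmorphism Q -> R}) (psi : {rmorphism P -> Q})
    (I : submodClosed P^o) :
  noeth_local Q -> noeth_local R ->
  gorenstein_hom phi ->
  {subset rker phi <= ideal_mul (max_ideal Q) (max_ideal Q)} ->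
  gorenstein_local P ->
  local_hom psi ->
  hom_finite_flat_dim psi ->
  lifting psi (restr_scalars phi R^o) (quotmod I) ->
  (exists2 x : P^o, x \in I & x != 0) ->
  {subset I <= ideal_mul (max_ideal P) (max_ideal P)} ->
  enat_le (grade (quotmod I) (restr_scalars psi Q^o)) (grade (quotmod I) P^o) ->
  exists C : complex R, nontrivial_totally_acyclic C.
Proof.
move=> [_ locQ] _ [phi_surj _ gorJ] _ [[noethP' locP] [K [E [injE vanE]]]] psi_loc.
move=> [T [L [flatL vanL]]] liftS I_neq0 Imm grle.
have locmP := local_ring_at locP; have noethP := noetherian_rows noethP'.
have Im : {subset I <= max_ideal P}.
  move=> y /Imm; apply: (gensub_min (U := max_ideal P)) => _ [b [z [_ zm ->]]].
  exact: (@is_submoduleZ P P^o _ b z (@max_ideal_submodule P) zm).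
have [a [r [D [g [DI Dex DexQ Ddual [ng n_gt]]]]]] :=
  gorenstein_resolution (conj noethP' locP) locQ gorJ psi_loc liftS I_neq0 Im grle.
have I1 : (1 : P^o) \notin I.
  by apply/negP => /Im m1; have := local_max_ideal1 locP; rewrite m1.
have [S [p [p_surj pI]]] := quotient_ring I1.
have Dp (v : 'rV[P]_(ranks a 1 r 0)) :
    (forall i, p (v 0 i) = 0) <-> exists u, v = u *m D 0.
  rewrite -DI -pI; split=> [|v0 i]; first exact.
  by rewrite (ord1 i).
have lift_ker := lifting_kernel liftS DI.
have Dphi (v : 'rV[Q]_(ranks a 1 r 0)) :
    (forall i, phi (v 0 i) = 0) <-> exists u, v = u *m map_mx psi (D 0).
  split=> [/(_ 0) /lift_ker[u uE]|[u ->] i].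
    by exists u; apply/rowP => i; rewrite (ord1 i).
  by rewrite (ord1 i); apply/lift_ker; exists u.
have [theta [thetaK dtheta theta_gen theta_ann]] :=
  dualizing_class injE Dex (erefl : ranks a 1 r 0 = 1%N) Dp Ddual ng n_gt.
have ann_exact := annihilated_exact injE Dex (erefl : ranks a 1 r 0 = 1%N) Dp n_gt.
have dualW := dual_window p_surj injE vanE ann_exact thetaK dtheta theta_gen theta_ann.
have exactS := killsub_exactS flatL (erefl : ranks a 1 r 0 = 1%N) Dp Dex DexQ.
have exact0 := killsub_exact0 (erefl : ranks a 1 r 0 = 1%N) Dp Dphi.
have phi_p k : p k = 0 -> phi (psi k) = 0 by move=> /pI; exact: lifting_ideal.
have tensorW := tensor_window phi_surj p_surj flatL vanL exactS (exact0 L) phi_p.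
pose m y := exists2 x, x \in max_ideal P & p x = y.
have locm : local_at m by apply: local_at_surj => // y /pI/Im.
have noethS := row_noetherian_surj p_surj noethP.
have HmP : is_submodule (fun v : 'rV[P]_1 => v 0 0 \in max_ideal P).
  split=> [|k u v um vm]; first by rewrite mxE rpred0.
  rewrite !mxE rpredD //; exact: (rpredZ k um).
have [e [X [Xm Xmin]]] := minimal_generators noethP locmP HmP.
have XSmin : minimal_rows m (map_mx p X).
  by apply: koszul_minimal => // y /pI/Imm.
have [rF [F [F0 Fex FminS]]] := minimal_resolution (map_mx p X) noethS locm.
have Fmin i : minimal_rows m (F i) by case: i => [|i] //; rewrite F0.
have X0m b : X b 0 \in max_ideal P.
  have -> : X b 0 = (row b X) 0 0 by rewrite mxE.
  by apply/Xm; exists (delta_mx 0 b); rewrite rowE.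
have Fm i j k : m (F i j k).
  case: i j k => [|i] j k; last exact: (minimal_entries (Fmin i) (mx_exact0 (Fex i))).
  by rewrite F0 mxE (ord1 k); exists (X j 0).
have mgen y : m y -> exists u : 'rV_e, y = (u *m (F 0%N : 'M_(e, 1))) 0 0.
  case=> z zm <-; have /Xm[u uE] : (const_mx z : 'rV[P]_1) 0 0 \in max_ideal P.
    by rewrite mxE.
  exists (map_mx p u); rewrite F0 -map_mxM -uE.
  by rewrite !mxE.
have [v [gv kv nv]] := koszul_not_exact p_surj pI noethP locmP Xm I_neq0 Imm.
have xE b : p (X b 0) = (F 0%N : 'M_(e, 1)) b 0 by rewrite F0 mxE.
have F_neq0 : forall i, ranks e 1 rF i != 0%N.
  apply: (infinite_resolution locm Fex Fmin Fm mgen gv).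
    by rewrite -[RHS]kv; congr kos; apply: funext => b; rewrite xE.
  move=> w gw; have := nv w gw; congr (_ != kos _ _); apply: funext => b.
  exact: xE.
(* Dual exactness at one fixed position, for every exact sequence over [S] indexed by the
   naturals. *)
have dualS (q : nat -> nat) (M : forall i, 'M[S]_(q i.+1, q i)) :
    (forall i, mx_exact (M i.+1) (M i)) -> mx_exact (M K.+2)^T (M K.+3)^T.
  move=> Mex; pose M' i := projT1 (cid (mx_lift p_surj (M i))).
  have M'E i : map_mx p (M' i) = M i := projT2 (cid (mx_lift p_surj (M i))).
  by rewrite -!M'E; apply: dualW => i; rewrite !M'E.
(* Dropping the first [b] terms of [F] moves the fixed position to any higher degree. *)
have Fdual i : (K.+2 <= i)%N -> mx_exact (F i)^T (F i.+1)^T.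
  move=> /subnKC <-; set b := (i - K.+2)%N.
  exact: (@dualS (fun k => ranks e 1 rF (k + b)) (fun k => F (k + b)%N)
    (fun k => Fex (k + b)%N)).
have [x [d [x0 dex dm]]] := splice noethS locm Fm Fdual.
pose d' i j := projT1 (cid (mx_lift p_surj (d i j))).
have d'E i j : map_mx p (d' i j) = d i j := projT2 (cid (mx_lift p_surj (d i j))).
have ddual i j l : j = i - 1 -> l = j - 1 -> mx_exact (d j l)^T (d i j)^T.
  (* The spliced complex extends in both directions, so a suitable base [b] brings any given
     position into the window. *)
  have win b i' j' l' : i' = b + K.+4%:Z -> j' = b + K.+3%:Z -> l' = b + K.+2%:Z ->
      mx_exact (d j' l')^T (d i' j')^T.
    move=> -> -> ->.
    apply: (@dualS (fun k => x (b + k%:Z)) (fun k => d (b + k.+1%:Z) (b + k%:Z))) => k.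
    by apply: dex; lia.
  by move=> ji lj; apply: (win (l - K.+2%:Z)); lia.
pose N i j := map_mx phi (map_mx psi (d' i j)).
have Nex i j l : j = i - 1 -> l = j - 1 -> mx_exact (N i j) (N j l).
  have win b i' j' l' : i' = b + T.+3%:Z -> j' = b + T.+2%:Z -> l' = b + T.+1%:Z ->
      mx_exact (N i' j') (N j' l').
    move=> -> -> ->.
    apply: (tensorW (fun k => x (b + k%:Z)) (fun k => d' (b + k.+1%:Z) (b + k%:Z))) => k.
    by rewrite !d'E; apply: dex; lia.
  by move=> ji lj; apply: (win (l - T.+1%:Z)); lia.
(* The dual complex over [S], read with decreasing indices [b - k], is exact by [ddual], so that
   [tensorW] applies to it in turn. *)
have Ndual i j l : j = i - 1 -> l = j - 1 -> mx_exact (N j l)^T (N i j)^T.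
  have win b i' j' l' : i' = b - T.+1%:Z -> j' = b - T.+2%:Z -> l' = b - T.+3%:Z ->
      mx_exact (N j' l')^T (N i' j')^T.
    move=> -> -> ->; rewrite /N !map_trmx.
    apply: (tensorW (fun k => x (b - k%:Z)) (fun k => (d' (b - k%:Z) (b - k.+1%:Z))^T)) => k.
    by rewrite -!map_trmx !d'E; apply: ddual; lia.
  by move=> ji lj; apply: (win (i + T.+1%:Z)); lia.
apply: (@nontrivial_mx_complex R x (fun i => N i (i - 1))).
- by move=> i; exact: Nex.
- by move=> i; exact: Ndual.
- move=> i s t; rewrite !mxE; apply: (surj_local_hom phi_surj); apply: psi_loc.
  (* The chosen lift of an entry need not be the one known to lie in the maximal ideal, but the two
     differ by an element of [I]. *)
  have [z zm zE] := dm i s t.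
  have /Im : (z - d' i (i - 1) s t : P^o) \in I.
    by apply/pI; rewrite rmorphB zE -d'E mxE subrr.
  move=> zd; rewrite -[d' _ _ _ _](subKr z) rpredB //.
by exists 0; rewrite x0.
Qed.
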